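(* Let $P\in\mathcal{P}(4,n,s)$ with distinguished facet $F$ (the facet with $4+s$ vertices, all other facets being simplices). Let $\Delta_F$ be the polyhedral complex corresponding to the prime decomposition of $F$, and let $\Delta$ be the refinement of $\partial P$ obtained by refining $F$ by $\Delta_F$. Assume there is some $1\le i\le 3$ for which $f_i(P)=f_i(S(4,n,s))$. Then each prime factor in the prime decomposition of $\Delta$ is either a $4$-simplex with no facet contained in $|F|$ (the point set of $F$), or a pyramid over a prime factor of $F$.
   Context: $f_i$ is the number of $i$-faces. $\mathcal{P}(d,n,s)$ is the family of $d$-polytopes with $n$ vertices having a facet $F$ with exactly $d+s$ vertices such that every other facet is a simplex. $S(4,n,s)$: take a stacked $3$-polytope with $4+s$ vertices (stacked = obtained from a simplex by repeatedly adding a vertex beyond a facet and taking the convex hull), form a pyramid over it, then stack $n-5-s$ times over facets other than the base; its $f$-vector is $(f_0,f_1,f_2,f_3)=(n,\,4n-10,\,6n-20-s,\,3n-10-s)$. Prime decomposition: for an $m$-polytope (or polyhedral $(m-1)$-sphere) $Q$, $m\ge3$, a missing $(m-1)$-face is a set $A$ of $m$ vertices such that the simplex on $A$ is not a face but the simplex on every proper subset of $A$ is a face. Inserting the simplex on $A$ cuts $Q$ into two pieces glued along it (a connected sum). Repeating on the pieces until no piece has a missing $(m-1)$-face gives the (unique) prime decomposition; its pieces are the prime factors, and they form the polyhedral complex of the prime decomposition. $\Delta_F$ subdivides the simplicial $3$-polytope $F$ into its prime factors, and $\Delta$ is the polyhedral $3$-sphere obtained from $\partial P$ by replacing $F$ with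 the cells of $\Delta_F$; its prime factors are $4$-dimensional pieces. *)

(* Defs.v *)
From HB Require Import structures.
From mathcomp Require Import all_boot all_order all_algebra.
From mathcomp Require Import boolp classical_sets reals.
Set Implicit Arguments.
Unset Strict Implicit.
Unset Printing Implicit Defensive.
Import Order.TTheory GRing.Theory Num.Theory.
Local Open Scope ring_scope.

(* A polytope is given by a finite family of points p : V -> R^e together with
   a set X of indices, and stands for conv (p X).  Its faces are represented by
   the sets of indices of the points of X lying on them. *)

Definition hull (R : realType) (e : nat) (V : finType) (p : V -> 'rV[R]_e)
    (A : {set V}) : set 'rV[R]_e :=
  [set x | exists w : V -> R,
     [/\ forall i, 0 <= w i, \sum_(i in A) w i = 1 &
         x = \sum_(i in A) w i *: p i]]%classic.

(* Rank of the homogenized points (1, p i): one more than the dimension of the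
   affine span of p A (and 0 if A is empty). *)
Definition affrank (R : realType) (e : nat) (V : finType) (p : V -> 'rV[R]_e)
    (A : {set V}) : nat :=
  \rank (\sum_(i in A) <<row_mx (1 : 'rV[R]_1) (p i)>>)%MS.

Definition dot (R : realType) (e : nat) (x : 'rV[R]_e) (c : 'cV[R]_e) : R :=
  (x *m c) 0 0.

Definition supports (R : realType) (e : nat) (V : finType) (p : V -> 'rV[R]_e)
    (X A : {set V}) (c : 'cV[R]_e) (b : R) : Prop :=
  (forall i, i \in X -> dot (p i) c <= b) /\
  A = [set i in X | dot (p i) c == b].

(* All faces, including the empty face and X itself (take c = 0). *)
Definition faces (R : realType) (e : nat) (V : finType) (p : V -> 'rV[R]_e)
    (X : {set V}) : {set {set V}} :=
  [set A | `[< exists c b, supports p X A c b >]].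

Definition boundary (R : realType) (e : nat) (V : finType) (p : V -> 'rV[R]_e)
    (X : {set V}) : {set {set V}} := faces p X :\ X.

Definition facet (R : realType) (e : nat) (V : finType) (p : V -> 'rV[R]_e)
    (X G : {set V}) : bool :=
  (G \in faces p X) && ((affrank p G).+1 == affrank p X).

Definition is_simplex (R : realType) (e : nat) (V : finType)
    (p : V -> 'rV[R]_e) (A : {set V}) : bool :=
  affrank p A == #|A|.

Definition fvec (R : realType) (e : nat) (V : finType) (p : V -> 'rV[R]_e)
    (i : nat) : nat :=
  #|[set A in faces p [set: V] | affrank p A == i.+1]|.

(* d-polytope whose vertices are exactly the points p i, without repetition;
   the ambient dimension e may exceed d. *)
Definition polytope (R : realType) (e : nat) (V : finType) (d : nat)
    (p : V -> 'rV[R]_e) : Prop :=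
  affrank p [set: V] = d.+1 /\ forall i, ~ hull p (~: [set i]) (p i).

(* The family P(d,n,s), with n = #|V| and distinguished facet F. *)
Definition family_P (R : realType) (e : nat) (V : finType) (d s : nat)
    (p : V -> 'rV[R]_e) (F : {set V}) : Prop :=
  [/\ polytope d p, facet p [set: V] F, #|F| = (d + s)%N &
      forall G, facet p [set: V] G -> G != F -> is_simplex p G].

(* p v lies in the affine span of X, beyond the facet G and beneath all the
   others. *)
Definition beyond (R : realType) (e : nat) (V : finType) (p : V -> 'rV[R]_e)
    (X G : {set V}) (v : V) : Prop :=
  [/\ affrank p (v |: X) = affrank p X,
      facet p X G,
      forall c b, supports p X G c b -> b < dot (p v) c &
      forall G' c b, facet p X G' -> G' != G -> supports p X G' c b ->
        dot (p v) c < b].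

Inductive stacked (R : realType) (e : nat) (V : finType) (p : V -> 'rV[R]_e)
    (d : nat) : {set V} -> Prop :=
| stacked_simplex (X : {set V}) :
    #|X| = d.+1 -> is_simplex p X -> stacked p d X
| stacked_stack (X G : {set V}) (v : V) :
    stacked p d X -> beyond p X G v -> stacked p d (v |: X).

Inductive stacked_pyramid (R : realType) (e : nat) (V : finType)
    (p : V -> 'rV[R]_e) (B : {set V}) : {set V} -> Prop :=
| stacked_pyramid_base (v : V) :
    affrank p (v |: B) = (affrank p B).+1 -> stacked_pyramid p B (v |: B)
| stacked_pyramid_stack (X G : {set V}) (v : V) :
    stacked_pyramid p B X -> G != B -> beyond p X G v ->
    stacked_pyramid p B (v |: X).

(* S(d,n,s), with n = #|V|; the number n - d - 1 - s of stackings is forced by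
   the requirement that all of V be used. *)
Definition family_S (R : realType) (e : nat) (V : finType) (d s : nat)
    (p : V -> 'rV[R]_e) : Prop :=
  exists B : {set V},
    [/\ stacked p d.-1 B, #|B| = (d + s)%N & stacked_pyramid p B [set: V]].

(* A polyhedral sphere is represented by the set of vertex sets of its faces,
   including the empty face. *)

Definition missing_face (V : finType) (m : nat) (K : {set {set V}})
    (A : {set V}) : Prop :=
  [/\ #|A| = m, A \notin K & forall B : {set V}, B \proper A -> B \in K].

Definition subcomplex (V : finType) (K1 K : {set {set V}}) : Prop :=
  K1 \subset K /\
  forall f g : {set V}, f \in K1 -> g \in K -> g \subset f -> g \in K1.

(* Inserting the simplex A cuts the sphere K into K1 and K2, i.e. K is the
   connected sum of K1 and K2 along A.  When K is a sphere and A a missing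
   face of codimension 0, its boundary separates K into two components, and
   K1 and K2 can only be the closures of these, completed by A. *)
Definition cuts_into (V : finType) (K : {set {set V}}) (A : {set V})
    (K1 K2 : {set {set V}}) : Prop :=
  [/\ subcomplex K1 (A |: K), subcomplex K2 (A |: K),
      K1 :|: K2 = A |: K, K1 :&: K2 = powerset A &
      K1 != powerset A /\ K2 != powerset A].

(* L is the set of prime factors of the (m-1)-sphere K. *)
Inductive prime_decomposition (V : finType) (m : nat) :
    {set {set V}} -> {set {set {set V}}} -> Prop :=
| prime_decomposition_prime (K : {set {set V}}) :
    (forall A, ~ missing_face m K A) -> prime_decomposition m K [set K]
| prime_decomposition_cut (K : {set {set V}}) (A : {set V})
    (K1 K2 : {set {set V}}) (L1 L2 : {set {set {set V}}}) :
    missing_face m K A -> cuts_into K A K1 K2 ->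
    prime_decomposition m K1 L1 -> prime_decomposition m K2 L2 ->
    prime_decomposition m K (L1 :|: L2).

Definition vertex_set (V : finType) (K : {set {set V}}) : {set V} :=
  finset.cover K.

(* The complex whose maximal cells are the prime factors in L: each sphere in
   L bounds a cell, whose vertex set is the union of the sphere's faces. *)
Definition decomposition_complex (V : finType) (L : {set {set {set V}}}) :
    {set {set V}} :=
  \bigcup_(K in L) (vertex_set K |: K).

Definition refine_facet (V : finType) (K : {set {set V}}) (F : {set V})
    (L : {set {set {set V}}}) : {set {set V}} :=
  (K :\ F) :|: decomposition_complex L.

Definition simplex_boundary (V : finType) (B : {set V}) : {set {set V}} :=
  powerset B :\ B.

(* Boundary complex of the pyramid with apex v over the polytope whose boundary
   complex is K. *)
Definition pyramid_boundary (V : finType) (v : V) (K : {set {set V}}) :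
    {set {set V}} :=
  (vertex_set K |: K) :|: [set v |: f | f in K].

(* Main.v *)
(* By Euler's relation in the figures of P, f_2(P) and f_3(P) are determined by
   f_1(P), n and s, so the assumption yields f_1(P) <= 4n - 10.  The link of a
   vertex outside F is a simplicial 2-sphere, so its closed star is a cone over a
   maximal planar graph.  Adding these stars one at a time, as in Gromov's proof
   of the lower bound theorem, gives f_1(P) >= 4n - 10; equality forces every set
   U of at least 4 vertices to span at most 4|U| - 10 edges, with equality for
   closed stars, and all 3-cliques to be faces of Delta.  These properties, and
   the fact that the link of an edge not contained in F is a cycle, survive
   cutting along a missing 3-face.

   Consider a prime factor.  Its 4-cliques are faces.  If it contains adjacent
   vertices u, v outside F having m common neighbours, tightness of the stars of
   u and v makes these span at least 2m - 3 edges, whereas every such edge is one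
   of the m edges of the link of uv; hence m = 3, and the star of u is a 5-clique
   filling the whole factor.  If v is its only vertex outside F, the factor is a
   cone with apex v over its intersection with F, which is a maximal planar graph
   not separated by a triangle, that is, a prime factor of F. *)
Require Import Defs.
From HB Require Import structures.
From mathcomp Require Import all_boot all_order all_algebra.
From mathcomp Require Import boolp classical_sets reals.
From mathcomp Require Import eqtype choice fintype bigop finset.
From mathcomp Require Import zify lra ring.
Set Implicit Arguments.
Unset Strict Implicit.
Unset Printing Implicit Defensive.
Import Order.TTheory GRing.Theory Num.Theory.
Local Open Scope ring_scope.

(** * Faces of a point configuration *)

(** A piece of a cut is only a set of faces: nothing says that it is a polytope or a sphere, so
    neither planarity nor Euler's relation is available for it. What is carried down the
    decomposition is therefore graph-theoretic: a piece is controlled by its vertex set, and the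
    bounds 3k - 6 inside [F] and 4k - 10 in general hold for all sufficiently large vertex sets of
    the original polytope. The constants are such that two of these bounds add up along a common
    m-clique, so tightness of a whole forces tightness of both sides. Tightness forces minimum
    degrees, and these keep the cuts of links nondegenerate.

    The planar bound for an arbitrary set of vertices comes from convexity: such a set spans a
    polytope of its own, and every edge of the large polytope between its points remains an edge of
    the small one. With faces taken as zero sets of functionals nonnegative on finitely many
    vectors, this restriction is immediate. Euler's relation is proved for figures of faces, by
    sweeping with a generic functional. *)

Lemma exists_argmin (R : realFieldType) (T : finType) (P : pred T) (f : T -> R) x :
  P x -> exists2 j, P j & forall i, P i -> f j <= f i.
Proof. by move=> Px; case: (arg_minP f Px) => j Pj hj; exists j. Qed.

Section Config.
Variables (R : realFieldType) (N : nat) (V : finType) (g : V -> 'rV[R]_N).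
Implicit Types (X A B C : {set V}) (c d : 'cV[R]_N).

Definition spn A : 'M[R]_N := (\sum_(i in A) <<g i>>)%MS.
Definition rk A : nat := \rank (spn A).
Definition ev c i : R := (g i *m c) 0 0.
Definition vanishes c A := forall i, i \in A -> ev c i = 0.
Definition nonneg c A := forall i, i \in A -> 0 <= ev c i.
Definition zeros c X := [set i in X | ev c i == 0].
(** The faces of the cone spanned by the vectors [g i], each recorded by the indices lying on it;
    [X] itself arises from c = 0. For homogenized points these are the faces of the polytope, and
    [rk] is the dimension plus one. *)
Definition fcs X : {set {set V}} :=
  [set A | `[< exists2 c, nonneg c X & A = zeros c X >]].

Lemma fcsP X A : reflect (exists2 c, nonneg c X & A = zeros c X) (A \in fcs X).
Proof. by rewrite inE; apply: asboolP. Qed.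

Lemma evD c d i : ev (c + d) i = ev c i + ev d i.
Proof. by rewrite /ev mulmxDr mxE. Qed.
Lemma evN c i : ev (- c) i = - ev c i.
Proof. by rewrite /ev mulmxN mxE. Qed.
Lemma evZ a c i : ev (a *: c) i = a * ev c i.
Proof. by rewrite /ev -scalemxAr mxE. Qed.
Lemma ev0 i : ev 0 i = 0.
Proof. by rewrite /ev mulmx0 mxE. Qed.
Definition evE := (evD, evN, evZ).

Lemma sub_spn i A : i \in A -> (g i <= spn A)%MS.
Proof.
move=> iA; apply: submx_trans (_ : (<<g i>> <= _)%MS); first by rewrite genmxE.
exact: (sumsmx_sup i).
Qed.

Lemma spn_subP A n (M : 'M_(n, N)) :
  reflect (forall i, i \in A -> (g i <= M)%MS) (spn A <= M)%MS.
Proof.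
apply: (iffP sumsmx_subP) => h i iA; first by have := h i iA; rewrite genmxE.
by rewrite genmxE h.
Qed.

Lemma spnS A X : A \subset X -> (spn A <= spn X)%MS.
Proof. by move=> sAX; apply/spn_subP => i /(subsetP sAX); exact: sub_spn. Qed.

Lemma rkS A X : A \subset X -> (rk A <= rk X)%N.
Proof. by move/spnS; exact: mxrankS. Qed.

Lemma ev_eq0 c i : (ev c i == 0) = (g i <= kermx c)%MS.
Proof.
apply/eqP/sub_kermxP => [h|h]; last by rewrite /ev h mxE.
by apply/matrixP => a b; rewrite !ord1 [RHS]mxE; exact: h.
Qed.

Lemma vanishesP c A : vanishes c A <-> (spn A <= kermx c)%MS.
Proof.
split=> [h|/spn_subP h i /h]; last by rewrite -ev_eq0 => /eqP.
by apply/spn_subP => i /h /eqP; rewrite ev_eq0.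
Qed.

Lemma rk_vanish A X c :
  A \subset X -> (rk X <= rk A)%N -> vanishes c A -> vanishes c X.
Proof.
move=> sAX rXA /vanishesP h; apply/vanishesP; apply: submx_trans h.
by rewrite -(geq_leqif (mxrank_leqif_sup (spnS sAX))).
Qed.

(** The columns of [cokermx (spn A)] are functionals vanishing on [A]; one of them is nonzero on a
    vector outside the span. *)
Lemma rk_sep A X : (rk A < rk X)%N ->
  exists c, vanishes c A /\ exists2 i, i \in X & ev c i != 0.
Proof.
move=> rAX; have [i iX ni] : exists2 i, i \in X & ~~ (g i <= spn A)%MS.
  apply: contrapT => h; move: rAX; apply/negP; rewrite -leqNgt.
  apply/mxrankS/spn_subP => i iX; apply: contrapT => ni; apply: h.
  by exists i => //; apply/negP.
have [j hj] : exists j, (g i *m cokermx (spn A)) 0 j != 0.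
  apply/existsP; move: ni; rewrite submxE; apply: contraR.
  rewrite negb_exists => /forallP h; apply/eqP/rowP => j; rewrite [RHS]mxE.
  by apply/eqP; have := h j; rewrite negbK.
have evj k : ev (col j (cokermx (spn A))) k = (g k *m cokermx (spn A)) 0 j.
  by rewrite /ev !mxE; apply: eq_bigr => l _; rewrite mxE.
exists (col j (cokermx (spn A))); split; last by exists i; rewrite ?evj.
move=> k /sub_spn; rewrite submxE => /eqP h.
by rewrite evj h mxE.
Qed.

Lemma rk0 : rk set0 = 0%N.
Proof. by rewrite /rk /spn big_set0 mxrank0. Qed.

Lemma rk_setU1 x A : (rk (x |: A) <= (rk A).+1)%N.
Proof.
have [xA|xA] := boolP (x \in A); first by rewrite (setUidPr _) ?sub1set.
rewrite /rk /spn big_setU1 //= addsmxC.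
apply: leq_trans (mxrank_adds_leqif _ _) _.
by rewrite -[X in (_ <= X)%N]addn1 leq_add2l genmxE rank_leq_row.
Qed.

Lemma rk_setU1_strict c x A :
  vanishes c A -> ev c x != 0 -> rk (x |: A) = (rk A).+1.
Proof.
move=> cA cx; apply/eqP; rewrite eqn_leq rk_setU1 ltnNge /=.
apply/negP => h; have := rk_vanish (subsetUr _ _) h cA.
by move/(_ x (setU11 _ _)) => /eqP; apply/negP.
Qed.

End Config.

Lemma finite_bound (R : realFieldType) (T : finType) (f : T -> R) :
  exists2 M, 0 < M & forall i, f i < M.
Proof.
have s0 : 0 <= \sum_i `|f i| by apply: sumr_ge0.
exists (1 + \sum_i `|f i|) => [|i]; first by lra.
have : `|f i| <= \sum_i `|f i| by rewrite (bigD1 i) //= lerDl sumr_ge0.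
have := ler_norm (f i); lra.
Qed.

Section Faces.
Variables (R : realFieldType) (N : nat) (V : finType) (g : V -> 'rV[R]_N).
Implicit Types (X Y A B C G : {set V}) (c d : 'cV[R]_N).
Local Notation rk := (rk g).
Local Notation ev := (ev g).
Local Notation fcs := (fcs g).
Local Notation vanishes := (vanishes g).
Local Notation nonneg := (nonneg g).

Lemma fcs_sub X A : A \in fcs X -> A \subset X.
Proof. by case/fcsP => c _ ->; apply/subsetP => i; rewrite inE => /andP[]. Qed.

Lemma fcs_full X : X \in fcs X.
Proof.
by apply/fcsP; exists 0 => [i _|]; [|apply/setP => i];
  rewrite ?inE ev0 // eqxx andbT.
Qed.

Lemma fcs_pos X A : A \in fcs X ->
  exists c, [/\ vanishes c A, nonneg c X &
               forall i, i \in X -> i \notin A -> 0 < ev c i].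
Proof.
case/fcsP => c c0 ->; exists c; split=> // i; rewrite inE.
  by case/andP => _ /eqP.
by move=> iX; rewrite iX lt_def c0 // andbT.
Qed.

Lemma fcs_intro X A c : A \subset X -> vanishes c A ->
  (forall i, i \in X -> i \notin A -> 0 < ev c i) -> A \in fcs X.
Proof.
move=> sAX cA cp; apply/fcsP; exists c => [i iX|].
  by have [/cA->//|/cp/ltW->] := boolP (i \in A).
apply/setP => i; rewrite inE; apply/idP/andP => [iA|[iX /eqP ci]].
  by rewrite (subsetP sAX) // cA ?eqxx.
by apply: contraT => /(cp _ iX); rewrite ci ltxx.
Qed.

Lemma fcs_restrict X Y A : A \in fcs X -> Y \subset X -> A :&: Y \in fcs Y.
Proof.
move=> /fcs_pos[c [cA _ cp]] sYX; apply: (@fcs_intro _ _ c); first exact: subsetIr.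
  by move=> i /setIP[/cA].
by move=> i iY; rewrite inE iY andbT => /cp; apply; apply: (subsetP sYX).
Qed.

Lemma fcs_sub_face X A B : B \in fcs X -> A \subset X -> B \subset A -> B \in fcs A.
Proof. by move=> BX AX BA; rewrite -(setIidPl BA); apply: fcs_restrict BX AX. Qed.

(** A large multiple of the functional cutting [A] out of [X] makes up for the negative values, off
    [A], of the functional cutting [B] out of [A]. *)
Lemma fcs_trans X A B : A \in fcs X -> B \in fcs A -> B \in fcs X.
Proof.
move=> AX BA; have sAX := fcs_sub AX; have sBA := fcs_sub BA.
case/fcs_pos: AX => c1 [c1A _ c1p]; case/fcs_pos: BA => c2 [c2B _ c2p].
have [M M0 hM] := finite_bound (fun i => - ev c2 i / ev c1 i).
apply: (@fcs_intro _ _ (c2 + M *: c1)); first exact: subset_trans sAX.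
  by move=> i iB; rewrite !evE c2B // c1A ?(subsetP sBA) // mulr0 addr0.
move=> i iX iB; rewrite !evE; have [iA|iA] := boolP (i \in A).
  by rewrite c1A // mulr0 addr0 c2p.
by have := hM i; rewrite ltr_pdivrMr ?c1p //; lra.
Qed.

Lemma rk_fcs_setU1 X A x : A \in fcs X -> x \in X -> x \notin A ->
  rk (x |: A) = (rk A).+1.
Proof.
case/fcs_pos => c [cA _ cp] xX xA; apply: (rk_setU1_strict cA).
by rewrite gt_eqF ?cp.
Qed.

Lemma rk_fcs_lt X A B : A \in fcs X -> A \proper B -> B \subset X ->
  (rk A < rk B)%N.
Proof.
move=> AX /properP[sAB [x xB xA]] sBX.
rewrite -(rk_fcs_setU1 AX _ xA) ?(subsetP sBX) //.
by apply: rkS; rewrite subUset sub1set xB.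
Qed.

Lemma fcs_rk_inj X A B : A \in fcs X -> B \subset X -> A \subset B ->
  (rk B <= rk A)%N -> A = B.
Proof.
move=> AX sBX sAB rBA; apply/eqP; rewrite eqEproper sAB /=.
by apply/negP => /(rk_fcs_lt AX) /(_ sBX); rewrite ltnNge rBA.
Qed.

Lemma fcsI X A B : A \in fcs X -> B \in fcs X -> A :&: B \in fcs X.
Proof.
move=> AX BX; apply: (fcs_trans BX).
exact: fcs_restrict AX (fcs_sub BX).
Qed.

(* Rotate a supporting functional of A about A + x until it meets a new point. *)
Lemma facet_avoiding X A x : A \in fcs X -> x \in X -> x \notin A ->
  exists G, [/\ G \in fcs X, A \subset G, x \notin G & rk X = (rk G).+1].
Proof.
have [m] := ubnP #|X :\: A|; elim: m A => // m IH A hm AX xX xA.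
have rA := rk_fcs_setU1 AX xX xA.
have sxX : x |: A \subset X by rewrite subUset sub1set xX fcs_sub.
have := rkS g sxX; rewrite leq_eqVlt => /orP[/eqP rX|rX].
  by exists A; rewrite -rX rA.
have sAX := fcs_sub AX.
have [c [cA c0 cp]] := fcs_pos AX.
have [d [dA [i iX di]]] : exists d, vanishes d (x |: A) /\ exists2 i, i \in X & ev d i < 0.
  have [d [dA [i iX]]] := rk_sep rX; rewrite neq_lt => /orP[di|di].
    by exists d; split => //; exists i.
  exists (- d); split; last by exists i => //; rewrite evN oppr_lt0.
  by move=> k /dA; rewrite evN => ->; rewrite oppr0.
have [j /andP[jX dj] hj] := exists_argmin (P := fun i => (i \in X) && (ev d i < 0))
  (fun i => ev c i / - ev d i) (introT andP (conj iX di)).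
have jA : j \notin A.
  by apply/negP => jA; move: dj; rewrite (dA j (setU1r _ jA)) ltxx.
pose t := ev c j / - ev d j.
have dj0 : 0 < - ev d j by rewrite oppr_gt0.
have t0 : 0 < t by rewrite divr_gt0 ?cp.
pose c' := c + t *: d.
have c'0 : nonneg c' X.
  move=> k kX; rewrite !evE; have := c0 k kX.
  have [dk|dk] := ltP (ev d k) 0; last by have := mulr_ge0 (ltW t0) dk; lra.
  have := hj k; rewrite kX dk => /(_ isT); rewrite -/t ler_pdivlMr ?oppr_gt0 //.
  lra.
have ZX : zeros g c' X \in fcs X by apply/fcsP; exists c'.
have sAZ : A \subset zeros g c' X.
  apply/subsetP => k kA; rewrite inE (subsetP sAX) //= !evE cA // dA ?mulr0 ?addr0 //.
  by rewrite setU1r.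
have jZ : j \in zeros g c' X.
  rewrite inE jX /= !evE /t; apply/eqP; field.
  by rewrite lt_eqF.
have xZ : x \notin zeros g c' X.
  by rewrite inE xX /= !evE dA ?setU11 // mulr0 addr0 gt_eqF ?cp.
have [|G [GX sZG xG rG]] := IH _ _ ZX xX xZ.
  rewrite ltnS in hm; apply: leq_trans hm; apply: proper_card.
  apply/properP; split; first exact: setDS.
  by exists j; rewrite inE ?jZ ?jX // jA.
by exists G; split => //; apply: subset_trans sZG.
Qed.

(** Replacing [C] by a facet of [C] that contains [A] but avoids a chosen point lowers it until its
    rank is one above that of [A]. *)
Lemma fcs_next X A C : A \in fcs X -> C \in fcs X -> A \proper C ->
  exists B, [/\ B \in fcs X, A \proper B, B \subset C & rk B = (rk A).+1].
Proof.
have [m] := ubnP #|C|; elim: m C => // m IH C hm AX CX pAC.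
have [sAC [x xC xA]] := properP pAC.
have AC := fcs_sub_face AX (fcs_sub CX) sAC.
have [G [GC sAG xG rG]] := facet_avoiding AC xC xA.
have [e|ne] := eqVneq (rk C) (rk A).+1; first by exists C.
have pAG : A \proper G.
  rewrite properEneq sAG andbT; apply: contra ne => /eqP->; exact/eqP.
have pGC : G \proper C.
  by apply/properP; split; [apply: fcs_sub|exists x].
have [|B [BX pAB sBG rB]] := IH G _ AX (fcs_trans CX GC) pAG.
  by rewrite ltnS in hm; apply: leq_trans hm; apply: proper_card.
by exists B; split => //; apply: subset_trans (fcs_sub GC).
Qed.

(* A pointed cone is generated by its extreme rays: minimise d / c. *)
Lemma nonneg_next X A d : A \in fcs X -> vanishes d A ->
  (forall B, B \in fcs X -> A \proper B -> rk B = (rk A).+1 -> nonneg d B) ->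
  nonneg d X.
Proof.
move=> AX dA hd i iX; have [iA|iA] := boolP (i \in A); first by rewrite dA.
have [c [cA c0 cp]] := fcs_pos AX.
have [j] := exists_argmin (P := [in X :\: A]) (fun i => ev d i / ev c i)
  (introT setDP (conj iX iA)).
rewrite inE => /andP[jA jX] hj.
pose t := ev d j / ev c j; have cj : 0 < ev c j by apply: cp.
pose c' := d - t *: c.
have c'0 : nonneg c' X.
  move=> k kX; rewrite !evE; have [kA|kA] := boolP (k \in A).
    by rewrite dA // cA // mulr0 subr0.
  have := hj k; rewrite -/t inE kA kX => /(_ isT).
  by rewrite ler_pdivlMr ?cp //; lra.
have ZX : zeros g c' X \in fcs X by apply/fcsP; exists c'.
have pAZ : A \proper zeros g c' X.
  apply/properP; split.
    apply/subsetP => k kA; rewrite inE (subsetP (fcs_sub AX)) //= !evE.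
    by rewrite dA // cA // mulr0 subr0.
  exists j => //; rewrite inE jX /= !evE /t divfK ?subrr //.
  by rewrite gt_eqF.
have [B [BX pAB sBZ rB]] := fcs_next AX ZX pAZ.
have [sAB [x xB xA]] := properP pAB.
have dx := hd B BX pAB rB x xB.
have xX := subsetP (fcs_sub BX) x xB.
have := subsetP sBZ x xB; rewrite inE xX /= !evE subr_eq0 => /eqP e.
have t0 : 0 <= t by move: dx; rewrite e pmulr_lge0 // cp.
have := c'0 i iX; rewrite !evE; have := mulr_ge0 t0 (c0 i iX); lra.
Qed.

End Faces.

(** * Figures of a face: the diamond property and connectivity *)

Section Upper.
Variables (R : realFieldType) (N : nat) (V : finType) (g : V -> 'rV[R]_N).
Implicit Types (X Y A B C G S : {set V}) (c d : 'cV[R]_N).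
Local Notation rk := (rk g).
Local Notation ev := (ev g).
Local Notation fcs := (fcs g).
Local Notation vanishes := (vanishes g).
Local Notation nonneg := (nonneg g).

(** The faces of dimension k - 1 of the figure X / A: vertices, edges and 2-faces for k = 1, 2,
    3. *)
Definition upper X A k := [set B in fcs X | (A \subset B) && (rk B == rk A + k)%N].

Lemma in_upper X A k B : (B \in upper X A k) =
  [&& B \in fcs X, A \subset B & rk B == rk A + k]%N.
Proof. by rewrite inE. Qed.

Lemma upper_face X A C k : A \in fcs X -> C \in fcs X -> A \subset C ->
  upper C A k = [set B in upper X A k | B \subset C].
Proof.
move=> AX CX sAC; apply/setP => B; rewrite inE !in_upper.
apply/and3P/andP => [[BC sAB rB]|[/and3P[BX sAB rB] sBC]].
  by rewrite (fcs_trans CX BC) sAB rB (fcs_sub BC).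
by split => //; apply: fcs_sub_face BX (fcs_sub CX) sBC.
Qed.

(** Two facets [G1], [G2] through [A] are found by avoiding one point each. Modulo functionals
    vanishing on [X], those vanishing on [A] form a space of dimension two, so the functional of any
    facet [G] through [A] is a combination of the two, with nonnegative coefficients. One nonzero
    coefficient already puts [G] inside the corresponding facet. *)
Lemma diamond X A : A \in fcs X -> rk X = (rk A + 2)%N -> #|upper X A 1| = 2%N.
Proof.
move=> AX rX.
have nA B : rk B = (rk A).+1 -> A \subset B -> exists2 y, y \in B & y \notin A.
  move=> rB sAB; apply/subsetPn; apply/negP => sBA.
  by have := rkS g sBA; rewrite rB ltnn.
have [x xX xA] : exists2 x, x \in X & x \notin A.
  by apply/subsetPn; apply/negP => /(rkS g); rewrite rX addn2 -addn1 -ltn_subRL subnn.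
have [G1 [G1X sAG1 xG1]] := facet_avoiding AX xX xA.
rewrite rX addn2 => -[rG1].
have [y yG1 yA] := nA _ (esym rG1) sAG1.
have yX := subsetP (fcs_sub G1X) _ yG1.
have [G2 [G2X sAG2 yG2]] := facet_avoiding AX yX yA.
rewrite rX addn2 => -[rG2].
have [z zG2 zA] := nA _ (esym rG2) sAG2.
have zX := subsetP (fcs_sub G2X) _ zG2.
have nG12 : G1 != G2 by apply: contraNneq yG2 => <-.
have zG1 : z \notin G1.
  apply/negP => zG1; case/eqP: nG12.
  have sA12 : z |: A \subset G1 :&: G2.
    by rewrite subUset sub1set inE zG1 zG2 subsetI sAG1.
  have := rkS g sA12; rewrite (rk_fcs_setU1 AX zX zA) => r12.
  have I12 := fcsI G1X G2X.
  have <- : G1 :&: G2 = G1.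
    by apply: (fcs_rk_inj I12 (fcs_sub G1X) (subsetIl _ _)); rewrite -rG1.
  by apply: (fcs_rk_inj I12 (fcs_sub G2X) (subsetIr _ _)); rewrite -rG2.
have [c1 [c1G c10 c1p]] := fcs_pos G1X.
have [c2 [c2G c20 c2p]] := fcs_pos G2X.
suff -> : upper X A 1 = [set G1; G2] by rewrite cards2 nG12.
apply/setP => G; rewrite in_upper in_set2 addn1; apply/and3P/orP; last first.
  by case=> /eqP->; split=> //; rewrite -?rG1 -?rG2.
case=> GX sAG /eqP rG.
have [c3 [c3G c30 c3p]] := fcs_pos GX.
have c2y : 0 < ev c2 y by exact: c2p.
have c1z : 0 < ev c1 z by exact: c1p.
(* The coefficients are read off at [y], where [c1] vanishes, and at [z], where [c2] vanishes. *)
pose b := ev c3 y / ev c2 y; pose a := ev c3 z / ev c1 z.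
have b0 : 0 <= b by rewrite divr_ge0 // ?c30 // ltW.
have a0 : 0 <= a by rewrite divr_ge0 // ?c30 // ltW.
have vX : vanishes (c3 - b *: c2 - a *: c1) X.
  apply: (@rk_vanish _ _ _ _ (z |: (y |: A))).
  - by rewrite !subUset !sub1set zX yX (fcs_sub AX).
  - rewrite (rk_setU1_strict (c := c1)) ?gt_eqF //.
      by rewrite (rk_fcs_setU1 AX yX yA) rX addn2.
    by move=> i /setU1P[->|iA]; rewrite c1G // (subsetP sAG1).
  - move=> i; rewrite !inE !evE => /or3P[/eqP->|/eqP->|iA].
    + by rewrite (c2G z) // /a; field; rewrite gt_eqF.
    + by rewrite (c1G y) // /b; field; rewrite gt_eqF.
    + by rewrite c3G ?c2G ?c1G ?(subsetP sAG) ?(subsetP sAG2) ?(subsetP sAG1) //; lra.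
have c3E i : i \in X -> ev c3 i = b * ev c2 i + a * ev c1 i.
  by move=> /vX; rewrite !evE; lra.
have sub_eq H : H \in fcs X -> rk H = (rk A).+1 -> G \subset H -> G = H.
  by move=> HX rH sGH; apply: (fcs_rk_inj GX (fcs_sub HX) sGH); rewrite rH rG.
have inH H c i : (forall i, i \in X -> i \notin H -> 0 < ev c i) ->
    i \in X -> ev c i = 0 -> i \in H.
  by move=> hp iX ci; apply: contraT => /(hp _ iX); rewrite ci ltxx.
have G0 i : i \in G -> [/\ i \in X, b * ev c2 i = 0 & a * ev c1 i = 0].
  move=> iG; have iX := subsetP (fcs_sub GX) i iG; split => //.
    by have := c3E i iX; rewrite c3G //; have := mulr_ge0 b0 (c20 i iX);
       have := mulr_ge0 a0 (c10 i iX); lra.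
  by have := c3E i iX; rewrite c3G //; have := mulr_ge0 b0 (c20 i iX);
     have := mulr_ge0 a0 (c10 i iX); lra.
have [e|nb] := eqVneq b 0.
  left; rewrite (sub_eq _ G1X) //; apply/subsetP => i /G0[iX _ /eqP].
  rewrite mulf_eq0 => /orP[/eqP ea|/eqP]; last exact: inH c1p iX.
  have [j jX jG] : exists2 j, j \in X & j \notin G.
    by apply/subsetPn; apply/negP => /(rkS g); rewrite rX rG addn2 ltnn.
  by have := c3p j jX jG; rewrite c3E // e ea !mul0r addr0 ltxx.
right; rewrite (sub_eq _ G2X) //; apply/subsetP => i /G0[iX /eqP + _].
by rewrite mulf_eq0 (negbTE nb) /= => /eqP; exact: inH c2p iX.
Qed.

Lemma diamond_in X A C : A \in fcs X -> C \in fcs X -> A \subset C ->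
  rk C = (rk A + 2)%N -> #|[set B in upper X A 1 | B \subset C]| = 2%N.
Proof.
move=> AX CX sAC rC; rewrite -upper_face //; apply: diamond => //.
exact: fcs_sub_face AX (fcs_sub CX) sAC.
Qed.

Definition verts X A := [set x in X :\: A | x |: A \in fcs X].
(** Lets the vertices of the figure X / A be named by points: [verts X A] is then in bijection with
    [upper X A 1]. *)
Definition simple_base X A :=
  forall B, B \in upper X A 1 -> exists2 x, x \notin A & B = x |: A.

Lemma vertsP X A x : reflect [/\ x \in X, x \notin A & x |: A \in fcs X] (x \in verts X A).
Proof. by rewrite !inE -andbA andbCA; apply: and3P. Qed.

Lemma verts_upper X A x : A \in fcs X -> x \in verts X A -> x |: A \in upper X A 1.
Proof.
move=> AX /vertsP[xX xA xAX]; rewrite in_upper xAX subsetUr /=.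
by rewrite (rk_fcs_setU1 AX xX xA) addn1.
Qed.

(* The path of the simplex algorithm, for the fractional objective c1 / c0. *)
Lemma verts_connected X A c0 S : A \in fcs X -> simple_base X A ->
  vanishes c0 A -> S \subset verts X A -> S != set0 ->
  (forall x, x \in S -> 0 < ev c0 x) ->
  (forall x y C, x \in S -> C \in upper X A 2 -> x \in C -> y \in C ->
     y \in verts X A -> 0 < ev c0 y -> y \in S) ->
  forall y, y \in verts X A -> 0 < ev c0 y -> y \in S.
Proof.
move=> AX sb c0A sS /set0Pn[x0 x0S] Sp Scl y yv c0y.
have [yX yA yF] := vertsP _ _ _ yv.
have [c1 [c1A c10 c1p]] := fcs_pos yF.
have [x xS hx] := exists_argmin (P := [in S]) (fun i => ev c1 i / ev c0 i) x0S.
have [xX xA xF] := vertsP _ _ _ (subsetP sS _ xS).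
have c0x := Sp _ xS.
have [e|c1x] := eqVneq (ev c1 x) 0.
  suff : x \in y |: A by rewrite in_setU1 (negbTE xA) orbF => /eqP <-.
  by apply: contraT => /(c1p _ xX); rewrite e ltxx.
have c1x0 : 0 < ev c1 x by rewrite lt_def c1x c10.
pose t := ev c1 x / ev c0 x; have t0 : 0 < t by rewrite divr_gt0.
have dX : nonneg (c1 - t *: c0) X.
  apply: (nonneg_next xF) => [i /setU1P[->|iA]|B BX pB rB].
  - by rewrite !evE /t divfK ?subrr // gt_eqF.
  - by rewrite !evE (c1A i) ?setU1r // c0A // mulr0 subr0.
  have sAB : A \subset B by rewrite (subset_trans _ (proper_sub pB)) ?subsetUr.
  have xB : x \in B by rewrite (subsetP (proper_sub pB)) ?setU11.
  have Bu : B \in upper X A 2.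
    by rewrite in_upper BX sAB rB (rk_fcs_setU1 AX xX xA) addn2 eqxx.
  have AB := fcs_sub_face AX (fcs_sub BX) sAB.
  apply: (nonneg_next AB) => [i iA|B' B'B pB' rB' i iB'].
    by rewrite !evE (c1A i) ?setU1r // c0A // mulr0 subr0.
  have B'X := fcs_trans BX B'B.
  have [z zA eB'] : exists2 z, z \notin A & B' = z |: A.
    by apply: sb; rewrite in_upper B'X proper_sub // rB' addn1 /=.
  move: iB'; rewrite eB' => /setU1P[->|iA]; last first.
    by rewrite !evE (c1A i) ?setU1r // c0A // mulr0 subr0.
  have zB : z \in B by rewrite (subsetP (fcs_sub B'B)) // eB' setU11.
  have zX := subsetP (fcs_sub BX) z zB.
  rewrite !evE; have [c0z|c0z] := ltP 0 (ev c0 z).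
    have zv : z \in verts X A by apply/vertsP; rewrite -eB'.
    by have := hx z (Scl _ _ _ xS Bu xB zB zv c0z); rewrite -/t ler_pdivlMr //; lra.
  by have := c10 z zX; have := mulr_ge0_le0 (ltW t0) c0z; lra.
have := dX y yX; rewrite !evE (c1A y) ?setU11 //.
by have := mulr_gt0 t0 c0y; lra.
Qed.

End Upper.

(* Bartl's induction on the number of generators. *)
Lemma farkas (R : realFieldType) (N : nat) (V : finType) (A : {set V})
    (g : V -> 'rV[R]_N) (b : 'rV[R]_N) :
  (forall x : 'cV_N, (forall i, i \in A -> (g i *m x) 0 0 <= 0) -> (b *m x) 0 0 <= 0) ->
  exists w : V -> R, (forall i, 0 <= w i) /\ b = \sum_(i in A) w i *: g i.
Proof.
have [m] := ubnP #|A|; elim: m A g b => // m IH A g b hm hb.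
have [e|[k kA]] := set_0Vmem A.
  exists (fun=> 0); split => //; rewrite e big_set0.
  apply/rowP => j; rewrite mxE; apply/eqP; rewrite eq_le.
  have := hb (delta_mx j 0); have := hb (- delta_mx j 0).
  rewrite !mulmxN -!colE !mxE oppr_le0 => h1 h2.
  by rewrite h1 ?h2 // => i; rewrite e inE.
have hm' : (#|A :\ k| < m)%N.
  by rewrite ltnS in hm; apply: leq_trans hm; rewrite [X in (_ < X)%N](cardsD1 k) kA.
have [h|] := pselect (forall x : 'cV_N,
  (forall i, i \in A :\ k -> (g i *m x) 0 0 <= 0) -> (b *m x) 0 0 <= 0).
  have [w [w0 wE]] := IH _ _ _ hm' h.
  exists (fun i => if i == k then 0 else w i); split => [i|]; first by case: eqP.
  rewrite wE [RHS](big_setD1 k) //= eqxx scale0r add0r.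
  by apply: eq_bigr => i; rewrite !inE => /andP[/negbTE->].
move=> /existsNP[x0 /not_implyP[x0A /negP]]; rewrite -ltNge => bx0.
have kx0 : 0 < (g k *m x0) 0 0.
  rewrite ltNge; apply/negP => kx0; move: bx0; rewrite ltNge hb // => i iA.
  by have [->//|ne] := eqVneq i k; apply: x0A; rewrite !inE ne.
pose f (a : 'rV[R]_N) := (a *m x0) 0 0 / (g k *m x0) 0 0.
pose g' i := g i - f (g i) *: g k.
have [w [w0 wE]] : exists w : V -> R, (forall i, 0 <= w i) /\
    b - f b *: g k = \sum_(i in A :\ k) w i *: g' i.
  apply: IH => // x hx.
  pose x' := x - ((g k *m x) 0 0 / (g k *m x0) 0 0) *: x0.
  have E a : (a *m x') 0 0 = ((a - f a *: g k) *m x) 0 0.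
    rewrite /x' mulmxBl mulmxBr -scalemxAl -scalemxAr /f.
    move: (a *m x) (g k *m x) (a *m x0) (g k *m x0) => u1 u2 u3 u4.
    by rewrite !mxE; ring.
  rewrite -E; apply: hb => i iA; rewrite E.
  have [->|ne] := eqVneq i k; last by apply: hx; rewrite !inE ne.
  have -> : f (g k) = 1 by rewrite /f divff // gt_eqF.
  by rewrite scale1r subrr mul0mx mxE.
pose wk := f b - \sum_(i in A :\ k) w i * f (g i).
exists (fun i => if i == k then wk else w i); split=> [i|].
  case: eqP => // _; rewrite subr_ge0; apply: (@le_trans _ _ 0).
    apply: sumr_le0 => j jA; apply: mulr_ge0_le0 => //.
    by rewrite /f pmulr_lle0 ?invr_gt0 // x0A.
  by rewrite divr_ge0 // ltW.
rewrite (big_setD1 k) //= eqxx /wk.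
rewrite (eq_bigr (fun i => w i *: g i)); last first.
  by move=> i; rewrite !inE => /andP[/negbTE->].
rewrite -[LHS](subrK (f b *: g k)) wE.
rewrite scalerBl scaler_suml -addrA [LHS]addrC; congr (_ + _).
by rewrite [RHS]addrC -sumrB; apply: eq_bigr => i _; rewrite /g' scalerBr scalerA.
Qed.

(** * Counting in 2-regular incidence structures *)

Section Incidence.
Variables (T1 T2 : finType) (P : {set T1}) (L : {set T2}) (inc : T1 -> T2 -> bool).
Implicit Types (D S : {set T1}).

Lemma double_count : (\sum_(C in L) #|[set B in P | inc B C]| =
  \sum_(B in P) #|[set C in L | inc B C]|)%N.
Proof.
transitivity (\sum_(C in L) \sum_(B in P) inc B C)%N.
  apply: eq_bigr => C _; rewrite -sum1_card big_mkcond [RHS]big_mkcond.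
  by apply: eq_bigr => B _; rewrite inE; case: (B \in P); case: inc.
rewrite exchange_big; apply: eq_bigr => B _; rewrite -sum1_card big_mkcond.
rewrite [RHS]big_mkcond.
by apply: eq_bigr => C _; rewrite inE; case: (C \in L); case: inc.
Qed.

(** When [P] and [L] are the vertices and edges of a graph, these are the edges with both ends in
    [D]. *)
Definition inner D := [set C in L | [forall B in P, inc B C ==> (B \in D)]].

End Incidence.

Section Incidence2.
Variables (T1 T2 : finType) (P : {set T1}) (L : {set T2}) (inc : T1 -> T2 -> bool).
Implicit Types (D S : {set T1}).
Let inner := inner P L inc.

(** The degrees over [D] add up to 2 |D|; each inner edge uses up two of them, and an edge leaving
    [D] uses up one more. Together with [inner_lower] this says that a proper arc of a cycle has
    Euler characteristic 1. *)
Lemma inner_upper D :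
  (forall C, C \in L -> #|[set B in P | inc B C]| = 2%N) ->
  (forall B, B \in P -> #|[set C in L | inc B C]| = 2%N) ->
  D \subset P ->
  (exists B C, [/\ B \in D, C \in L, inc B C & C \notin inner D]) ->
  (#|inner D| < #|D|)%N.
Proof.
move=> hL hP sDP [B0 [C0 [B0D C0L i0 C0n]]].
have e := double_count D L inc.
have e2 : (\sum_(B in D) #|[set C in L | inc B C]| = 2 * #|D|)%N.
  rewrite mulnC -sum_nat_const; apply: eq_bigr => B BD.
  by rewrite hP // (subsetP sDP).
have sI : inner D \subset L by apply/subsetP => C; rewrite inE => /andP[].
have : (2 * #|inner D| + 1 <= \sum_(C in L) #|[set B in D | inc B C]|)%N.
  rewrite (big_setID (inner D)) /= (setIidPr sI) leq_add //.
    rewrite mulnC -sum_nat_const; apply: leq_sum => C CI.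
    have CL := subsetP sI _ CI.
    rewrite -(hL C) //; apply/subset_leq_card/subsetP => B; rewrite !inE.
    case/andP => BP iB; rewrite iB andbT.
    by move: CI; rewrite inE => /andP[_ /forall_inP/(_ B BP)]; rewrite iB.
  rewrite (bigD1 C0) /=; last by rewrite inE C0n.
  apply: leq_trans (leq_addr _ _); rewrite card_gt0; apply/set0Pn.
  by exists B0; rewrite inE B0D.
by rewrite e e2 addn1 ltn_pmul2l.
Qed.

(** A connected set can be built one element at a time, each new element bringing at least one edge
    to those already present. *)
Lemma inner_lower D : D != set0 -> D \subset P ->
  (forall S, S \subset D -> S != set0 -> S != D ->
     exists C B B', [/\ C \in inner D, B \in S, inc B C, B' \in D :\: S & inc B' C]) ->
  (forall C, C \in L -> #|[set B in P | inc B C]| = 2%N) ->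
  (#|D| <= #|inner D|.+1)%N.
Proof.
move=> D0 sDP conn hL.
suff H k : (0 < k)%N -> (k <= #|D|)%N ->
    exists2 S : {set T1}, S \subset D & #|S| = k /\ (k <= #|inner S|.+1)%N.
  have [|S sSD [cS]] := H #|D| _ (leqnn _); first by rewrite card_gt0.
  move=> h; apply: leq_trans h _; rewrite ltnS; apply/subset_leq_card/subsetP => C.
  rewrite !inE => /andP[-> /forall_inP h]; apply/forall_inP => B BP.
  by apply/implyP => iB; apply: (subsetP sSD); apply: (implyP (h B BP)).
elim: k => // -[_ _ _|k IH _ kD].
  case/set0Pn: D0 => x xD; exists [set x]; first by rewrite sub1set.
  by rewrite cards1.
have [S sSD [cS hS]] := IH isT (ltnW kD).
have [||C [B [B' [CI BS iB]]]] := conn S sSD.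
- by rewrite -card_gt0 cS.
- by apply/eqP => e; rewrite -cS e ltnn in kD.
rewrite inE => /andP[B'S B'D] iB'.
exists (B' |: S); first by rewrite subUset sub1set B'D.
split; first by rewrite cardsU1 B'S cS.
have CL : C \in L by move: CI; rewrite inE => /andP[].
have B'P := subsetP sDP _ B'D.
have BP := subsetP sDP _ (subsetP sSD _ BS).
have CS : C \notin inner S.
  rewrite inE CL /=; apply/negP => /forall_inP/(_ B' B'P).
  by rewrite iB' (negbTE B'S).
have eC : [set B in P | inc B C] = [set B; B'].
  apply/esym/eqP; rewrite eqEcard hL // cards2.
  have -> : B != B' by apply: contraNneq B'S => <-.
  by rewrite andbT subUset !sub1set !inE BP B'P iB iB'.
rewrite ltnS; apply: leq_trans hS _.
have : C |: inner S \subset inner (B' |: S).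
  apply/subsetP => C'; rewrite in_setU1 => /orP[/eqP->|].
    rewrite inE CL; apply/forall_inP => B1 B1P; apply/implyP => i1.
    have : B1 \in [set B; B'] by rewrite -eC inE B1P.
    by rewrite !inE => /orP[/eqP->|->//]; rewrite BS orbT.
  rewrite !inE => /andP[-> /forall_inP h]; apply/forall_inP => B1 B1P.
  by apply/implyP => i1; rewrite inE (implyP (h _ B1P) i1) orbT.
by move/subset_leq_card; rewrite cardsU1 CS add1n.
Qed.
End Incidence2.

Lemma sum_indicator_card (T : finType) (A : {set T}) (p : pred T) :
  (\sum_(x in A) p x = #|[set x in A | p x]|)%N.
Proof.
rewrite -sum1_card big_mkcond [RHS]big_mkcond.
by apply: eq_bigr => x _; rewrite inE; case: (x \in A); case: (p x).
Qed.

(** The hyperplanes are treated one at a time: adding a large multiple of a vector off the next one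
    keeps the values that were nonzero away from 0. *)
Lemma avoid_hyperplanes (R : realFieldType) (N : nat) (Q : 'cV[R]_N -> Prop)
    (I : finType) (h : I -> 'rV[R]_N) :
  Q 0 -> (forall a c d, Q c -> Q d -> Q (c + a *: d)) ->
  (forall i, exists2 c, Q c & (h i *m c) 0 0 != 0) ->
  exists2 c, Q c & forall i, (h i *m c) 0 0 != 0.
Proof.
move=> Q0 QD hh.
suff H (s : seq I) : exists2 c, Q c & forall i, i \in s -> (h i *m c) 0 0 != 0.
  by have [c Qc hc] := H (enum I); exists c => // i; apply: hc; rewrite mem_enum.
elim: s => [|k s [c Qc hc]]; first by exists 0.
have [ck|ck] := eqVneq ((h k *m c) 0 0) 0; last first.
  by exists c => // i; rewrite inE => /orP[/eqP->|/hc].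
have [d Qd dk] := hh k.
have [M M0 hM] := finite_bound (fun i => - (h i *m c) 0 0 / (h i *m d) 0 0).
exists (c + M *: d) => [|i]; first exact: QD.
have E : (h i *m (c + M *: d)) 0 0 = (h i *m c) 0 0 + M * (h i *m d) 0 0.
  by rewrite mulmxDr -scalemxAr; move: (h i *m c) (h i *m d) => u v; rewrite !mxE.
rewrite inE E => /orP[/eqP->|/hc ci]; first by rewrite ck add0r mulf_neq0 // gt_eqF.
have [->|di] := eqVneq ((h i *m d) 0 0) 0; first by rewrite mulr0 addr0.
apply/negP; rewrite addrC addr_eq0 => /eqP e.
by have := hM i; rewrite -e mulfK // ltxx.
Qed.

(** * Euler's relation for simple figures *)

(** Stated as a sum of indicators so that a count of faces can be distributed over their extreme
    vertices. *)
Lemma sum_argmin (R : realFieldType) (T : finType) (A : {set T}) (f : T -> R) :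
  A != finset.set0 -> {in A &, injective f} ->
  (\sum_(v in A) [forall y in A, (f v <= f y)%R] = 1)%N.
Proof.
case/set0Pn => x0 x0A fI.
have [v vA hv] := exists_argmin (P := [in A]) f x0A.
rewrite (bigD1 v) //= big1 ?addn0 => [|u /andP[uA uv]]; apply/eqP.
  by rewrite eqb1; apply/forall_inP => y /hv.
rewrite eqb0; apply: contra uv => /forall_inP/(_ v vA) h.
by apply/eqP/fI => //; apply/le_anti; rewrite h hv.
Qed.

Section UpperFaces.
Variables (R : realFieldType) (N : nat) (V : finType) (g : V -> 'rV[R]_N).
Implicit Types (X Y A B C G S : {set V}) (c d : 'cV[R]_N).
Local Notation rk := (rk g).
Local Notation ev := (ev g).
Local Notation fcs := (fcs g).
Local Notation vanishes := (vanishes g).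
Local Notation nonneg := (nonneg g).
Local Notation upper := (upper g).
Local Notation verts := (verts g).
Local Notation simple_base := (simple_base g).

Definition pos c B := [exists x in B, 0 < ev c x].

Lemma pos_setU1 c A x : vanishes c A -> pos c (x |: A) = (0 < ev c x).
Proof.
move=> cA; apply/exists_inP/idP => [[y /setU1P[->//|/cA->]]|h].
  by rewrite ltxx.
by exists x; rewrite ?setU11.
Qed.

Lemma upper_verts X A B : A \in fcs X -> simple_base X A -> B \in upper X A 1 ->
  exists2 x, x \in verts X A & B = x |: A.
Proof.
move=> AX sb Bu; have [x xA eB] := sb B Bu; exists x => //; apply/vertsP.
move: Bu; rewrite in_upper => /and3P[BX _ _]; rewrite -eB; split => //.
by apply: (subsetP (fcs_sub BX)); rewrite eB setU11.
Qed.

Lemma upper_connected X A c0 (S : {set {set V}}) : A \in fcs X -> simple_base X A ->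
  vanishes c0 A -> S \subset upper X A 1 -> S != finset.set0 ->
  (forall B, B \in S -> pos c0 B) ->
  (forall B B' C, B \in S -> C \in upper X A 2 -> B \subset C -> B' \subset C ->
     B' \in upper X A 1 -> pos c0 B' -> B' \in S) ->
  forall B, B \in upper X A 1 -> pos c0 B -> B \in S.
Proof.
move=> AX sb c0A sS /set0Pn[B0 B0S] Sp Scl B Bu pB.
have [y yv eB] := upper_verts AX sb Bu.
pose S' := [set x in verts X A | x |: A \in S].
suff : y \in S' by rewrite inE yv -eB.
apply: (verts_connected (S := S') AX sb c0A) yv _.
- by apply/subsetP => x; rewrite inE => /andP[].
- have [x xv eB0] := upper_verts AX sb (subsetP sS _ B0S).
  by apply/set0Pn; exists x; rewrite inE xv -eB0.
- by move=> x; rewrite inE => /andP[_ /Sp]; rewrite pos_setU1.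
- move=> x z C; rewrite [x \in S']inE [z \in S']inE => /andP[xv xS] Cu xC zC zv c0z.
  rewrite zv /=; have sAC : A \subset C by move: Cu; rewrite in_upper => /and3P[].
  apply: (Scl _ _ C xS Cu); rewrite ?subUset ?sub1set ?xC ?zC //.
    exact: verts_upper.
  by rewrite pos_setU1.
- by rewrite -(pos_setU1 _ c0A) -eB.
Qed.

Lemma card_verts_upper X A C : A \in fcs X -> simple_base X A -> C \in fcs X ->
  A \subset C -> #|C :&: verts X A| = #|[set B in upper X A 1 | B \subset C]|.
Proof.
move=> AX sb CX sAC; have -> : [set B in upper X A 1 | B \subset C] =
    [set x |: A | x in C :&: verts X A].
  apply/setP => B; rewrite inE; apply/andP/imsetP => [[Bu sBC]|[x xC ->]].
    have [x xv eB] := upper_verts AX sb Bu; exists x => //.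
    by rewrite inE xv (subsetP sBC) // eB setU11.
  move: xC; rewrite inE => /andP[xC xv]; rewrite verts_upper //.
  by rewrite subUset sub1set xC.
rewrite card_in_imset // => x y /setIP[_ /vertsP[_ xA _]] _ /setP/(_ x).
by rewrite !inE eqxx (negbTE xA) !orbF => /esym/eqP.
Qed.

Lemma upper_upper X A B j k : B \in upper X A j ->
  upper X B k = [set C in upper X A (j + k) | B \subset C].
Proof.
rewrite in_upper => /and3P[BX sAB /eqP rB]; apply/setP => C.
rewrite [RHS]inE !in_upper rB addnA; case: (C \in fcs X) => //=.
have [sBC|] := boolP (B \subset C); last by rewrite andbF.
by rewrite (subset_trans sAB sBC) andbT.
Qed.

End UpperFaces.

Section Euler.
Variables (R : realFieldType) (N : nat) (V : finType) (g : V -> 'rV[R]_N).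
Variables (X A : {set V}).
Implicit Types (B C S : {set V}) (c d : 'cV[R]_N).
Local Notation rk := (rk g).
Local Notation ev := (ev g).
Local Notation fcs := (fcs g).
Local Notation vanishes := (vanishes g).
Local Notation nonneg := (nonneg g).
Local Notation upper := (upper g).
Local Notation verts := (verts g).
Local Notation simple_base := (simple_base g).
Local Notation pos := (pos g).
Hypotheses (AX : A \in fcs X) (sb : simple_base X A).
Hypothesis sb2 : forall v, v \in verts X A -> simple_base X (v |: A).
Hypothesis rX : rk X = (rk A + 4)%N.
Let Vt := verts X A.
Let E := upper X A 2.
Let T := upper X A 3.

Let vX v : v \in Vt -> v |: A \in fcs X. Proof. by case/vertsP. Qed.
Let vu v : v \in Vt -> v |: A \in upper X A 1. Proof. exact: verts_upper. Qed.
Let rkv v : v \in Vt -> rk (v |: A) = (rk A).+1.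
Proof. by move=> /vu; rewrite in_upper => /and3P[_ _ /eqP->]; rewrite addn1. Qed.

Lemma upper_point v k : v \in Vt ->
  upper X (v |: A) k = [set C in upper X A k.+1 | v \in C].
Proof.
move=> vV; rewrite (upper_upper k (vu vV)) add1n; apply/setP => C.
by rewrite [LHS]inE [RHS]inE subUset sub1set andbA andbAC
  in_upper; case: (A \subset C); rewrite ?andbF ?andbT.
Qed.

Lemma card_edge_verts B : B \in E -> #|B :&: Vt| = 2%N.
Proof.
rewrite in_upper => /and3P[BX sAB /eqP rB].
by rewrite card_verts_upper // diamond_in.
Qed.

Lemma upper_point1 v B : v \in Vt -> B \in upper X (v |: A) 1 ->
  exists y, [/\ y \in Vt, y != v & B = y |: (v |: A)].
Proof.
move=> vV Bu; have [y _ eB] := sb2 vV Bu.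
move: Bu; rewrite upper_point // inE => /andP[BE vB].
have : (B :&: Vt) :\ v != finset.set0.
  rewrite -card_gt0 -ltnS; have := cardsD1 v (B :&: Vt).
  by rewrite inE vB vV card_edge_verts // add1n => <-.
case/set0Pn => z /setD1P[zv /setIP[zB zV]].
have [_ zA _] := vertsP _ _ _ _ zV.
by move: zB; rewrite eB !inE (negbTE zv) (negbTE zA) !orbF => /eqP e; exists z; split => //; rewrite e.
Qed.

Lemma card_two_in v C : v \in Vt -> C \in upper X (v |: A) 2 ->
  #|[set B in upper X (v |: A) 1 | B \subset C]| = 2%N.
Proof.
move=> vV; rewrite in_upper => /and3P[CX sC /eqP rC].
exact: diamond_in (vX vV) CX sC rC.
Qed.

Lemma card_two_out v B : v \in Vt -> B \in upper X (v |: A) 1 ->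
  #|[set C in upper X (v |: A) 2 | B \subset C]| = 2%N.
Proof.
move=> vV Bu; rewrite -(upper_upper 1 Bu); apply: diamond.
  by move: Bu; rewrite in_upper => /andP[].
move: Bu; rewrite in_upper => /and3P[_ _ /eqP->].
by rewrite rX rkv // -addnA addSnnS.
Qed.

(** The figure over [v |: A] is a polygon: each edge has two vertices and each vertex lies on two
    edges. *)
Lemma card_upper_point v : v \in Vt -> #|upper X (v |: A) 1| = #|upper X (v |: A) 2|.
Proof.
move=> vV; have := double_count (upper X (v |: A) 1) (upper X (v |: A) 2)
  (fun B C => B \subset C).
rewrite (eq_bigr (fun=> 2%N)) => [|C]; last exact: card_two_in.
rewrite [X in _ = X](eq_bigr (fun=> 2%N)) => [|B]; last exact: card_two_out.
by rewrite !sum_nat_const => /eqP; rewrite eqn_pmul2r // => /eqP.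
Qed.

Lemma sum_card_point k :
  (\sum_(v in Vt) #|upper X (v |: A) k| = \sum_(B in upper X A k.+1) #|B :&: Vt|)%N.
Proof.
transitivity (\sum_(v in Vt) #|[set B in upper X A k.+1 | v \in B]|)%N.
  by apply: eq_bigr => v vV; rewrite upper_point.
rewrite -(double_count Vt _ (fun v B => v \in B)); apply: eq_bigr => B _.
by apply: eq_card => v; rewrite !inE andbC.
Qed.

(** Both sides count pairs of a vertex and a 2-face through it, since around a vertex there are as
    many 2-faces as edges. *)
Lemma sum_facet_verts : (\sum_(C in T) #|C :&: Vt| = 2 * #|E|)%N.
Proof.
rewrite -sum_card_point.
transitivity (\sum_(v in Vt) #|upper X (v |: A) 1|)%N.
  by apply: eq_bigr => v /card_upper_point.
by rewrite sum_card_point (eq_bigr _ card_edge_verts) sum_nat_const mulnC.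
Qed.

Variables (c0 l : 'cV[R]_N).
Hypotheses (c0A : vanishes c0 A) (c0p : forall x, x \in X -> x \notin A -> 0 < ev c0 x).
Hypothesis lA : vanishes l A.
(** The height of a vertex of the figure. Dividing by [c0], which is positive off [A], makes it
    depend only on the ray of the vertex. *)
Let rho x := ev l x / ev c0 x.
Hypothesis rho_inj : {in Vt &, injective rho}.

Let istop v B := (v \in B) && [forall y in B :&: Vt, rho y <= rho v].
(** This functional vanishes on [v |: A] and is positive at exactly those vertices that lie below
    [v]. *)
Let dv v := rho v *: c0 - l.
Let c0V v : v \in Vt -> 0 < ev c0 v.
Proof. by case/vertsP => vX' vA _; apply: c0p. Qed.
Let ev_dv v y : y \in Vt -> ev (dv v) y = ev c0 y * (rho v - rho y).
Proof.
move=> /c0V yp; have e : ev l y = ev c0 y * rho y.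
  by rewrite /rho mulrC divfK ?gt_eqF.
by rewrite !evE e; ring.
Qed.
Let dvA v : vanishes (dv v) A.
Proof. by move=> x xA; rewrite !evE c0A // lA // mulr0 subr0. Qed.
Let dvAv v : v \in Vt -> vanishes (dv v) (v |: A).
Proof. by move=> vV x /setU1P[->|/dvA//]; rewrite ev_dv // subrr mulr0. Qed.
Let dv_gt0 v y : y \in Vt -> (0 < ev (dv v) y) = (rho y < rho v).
Proof. by move=> yV; rewrite ev_dv // pmulr_rgt0 ?c0V // subr_gt0. Qed.
Let dv_ge0 v y : y \in Vt -> (0 <= ev (dv v) y) = (rho y <= rho v).
Proof. by move=> yV; rewrite ev_dv // pmulr_rge0 ?c0V // subr_ge0. Qed.

Let sum_top (B : {set V}) : B :&: Vt != finset.set0 -> (\sum_(v in Vt) istop v B = 1)%N.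
Proof.
move=> Bn0; rewrite -[RHS](@sum_argmin _ _ _ (fun y => - rho y) Bn0); last first.
  move=> x y /setIP[_ xV] /setIP[_ yV] /oppr_inj; exact: rho_inj.
rewrite (big_setID B) /= [X in (_ + X)%N]big1 ?addn0 => [|v]; last first.
  by rewrite in_setD /istop => /andP[/negbTE->].
rewrite setIC; apply: eq_bigr => v /setIP[vB vV]; rewrite /istop vB /=.
by congr (nat_of_bool _); apply: eq_forallb => y; rewrite lerN2.
Qed.

Let count_tops (U : {set {set V}}) : (forall B, B \in U -> B :&: Vt != finset.set0) ->
  (#|U| = \sum_(v in Vt) #|[set B in U | istop v B]|)%N.
Proof.
move=> hU; rewrite -(double_count Vt U (fun v B => istop v B)).
rewrite -sum1_card; apply: eq_bigr => B BU.
by rewrite -sum_indicator_card sum_top // hU.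
Qed.

Let isbot v := [forall y in Vt, rho v <= rho y].
Let ismax v := [forall y in Vt, rho y <= rho v].

Let pos_dv v y : v \in Vt -> y \in Vt ->
  pos (dv v) (y |: (v |: A)) = (rho y < rho v).
Proof. by move=> vV yV; rewrite (pos_setU1 _ (dvAv vV)) dv_gt0. Qed.

Let istop_edge v B : v \in Vt -> B \in upper X (v |: A) 1 -> istop v B = pos (dv v) B.
Proof.
move=> vV Bu; have [y [yV yv eB]] := upper_point1 vV Bu.
have vB : v \in B by rewrite eB !inE eqxx orbT.
rewrite {2}eB pos_dv // /istop vB /=; apply/forall_inP/idP => [h|h z].
  have yB : y \in B :&: Vt by rewrite in_setI yV eB setU11.
  rewrite lt_neqAle (h _ yB) andbT.
  by apply: contra yv => /eqP/(rho_inj yV vV)/eqP.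
rewrite in_setI {1}eB => /andP[+ zV]; have [_ zA _] := vertsP _ _ _ _ zV.
by rewrite !inE (negbTE zA) orbF => /orP[/eqP->|/eqP->//]; apply: ltW.
Qed.

Let istop_face v C : v \in Vt -> C \in upper X (v |: A) 2 ->
  istop v C = [forall B in upper X (v |: A) 1, (B \subset C) ==> pos (dv v) B].
Proof.
move=> vV Cu; move: (Cu); rewrite in_upper => /and3P[CX sC rC].
have vC : v \in C by rewrite (subsetP sC) ?setU11.
rewrite {1}/istop vC /=; apply/forall_inP/forall_inP => [h B Bu|h y].
  apply/implyP => sBC; rewrite -istop_edge // /istop.
  move: (Bu); rewrite in_upper => /and3P[BX sB _].
  rewrite (subsetP sB) ?setU11 //=; apply/forall_inP => y /setIP[yB yV].
  by apply: h; rewrite in_setI yV (subsetP sBC).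
move=> /setIP[yC yV]; rewrite -dv_ge0 //.
suff : nonneg (dv v) C by apply.
apply: (nonneg_next (fcs_sub_face (vX vV) (fcs_sub CX) sC) (dvAv vV)) => B BC pB rB.
have Bu : B \in upper X (v |: A) 1.
  by rewrite in_upper (fcs_trans CX BC) (proper_sub pB) rB addn1 /=.
have [z [zV zv eB]] := upper_point1 vV Bu.
have := h B Bu; rewrite (fcs_sub BC) /= eB pos_dv // => hz x /setU1P[->|xv].
  by rewrite dv_ge0 // ltW.
by rewrite (dvAv vV).
Qed.

Let edge_exists v : v \in Vt -> exists B, B \in upper X (v |: A) 1.
Proof.
move=> vV; have [|B [BX pB _ rB]] := fcs_next (vX vV) (fcs_full g X).
  rewrite properEneq (fcs_sub (vX vV)) andbT; apply/eqP => e.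
  by have := rkv vV; rewrite e rX => /eqP; rewrite -[X in _ == X]addn1 eqn_add2l.
by exists B; rewrite in_upper BX proper_sub // rB addn1 /=.
Qed.

Let edge_lt v B : v \in Vt -> B \in upper X (v |: A) 1 -> exists2 y, y \in Vt &
  if pos (dv v) B then rho y < rho v else rho v < rho y.
Proof.
move=> vV Bu; have [y [yV yv eB]] := upper_point1 vV Bu; exists y => //.
rewrite eB pos_dv //; case: ltgtP => // /(rho_inj yV vV) e.
by rewrite e eqxx in yv.
Qed.

(** In the polygon around [v] the descending edges form an arc [D], and the 2-faces with top [v] are
    the sides with both ends in [D]. A proper nonempty arc has one vertex more than it has sides;
    the two corrections account for the empty arc at the bottom vertex and for the full polygon at
    the top one. *)
Let local_euler v : v \in Vt ->
  (#|[set B in E | istop v B]| + isbot v + ismax v = #|[set C in T | istop v C]|.+1)%N.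
Proof.
move=> vV; pose D := [set B in upper X (v |: A) 1 | pos (dv v) B].
have hE : [set B in E | istop v B] = D.
  apply/setP => B; rewrite [LHS]inE [RHS]inE upper_point // [in RHS]inE.
  case vB : (v \in B); last by rewrite /istop vB !andbF.
  rewrite andbT; case BE : (B \in upper X A 2) => //=.
  by rewrite istop_edge // upper_point // inE BE.
have hT : [set C in T | istop v C] =
    inner (upper X (v |: A) 1) (upper X (v |: A) 2) (fun B C => B \subset C) D.
  apply/setP => C; rewrite [LHS]inE [RHS]inE.
  have [Cu|Cu] := boolP (C \in upper X (v |: A) 2); last first.
    by move: Cu; rewrite upper_point // inE /istop => /nandP[/negbTE->|/negbTE->] //; rewrite andbF.
  have -> : C \in T by move: Cu; rewrite upper_point // inE => /andP[].
  rewrite istop_face //=; apply: eq_forallb => B; case Bu: (B \in _) => //=.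
  by rewrite [in RHS]inE Bu.
rewrite hE hT; set I := inner _ _ _ _.
have sD : D \subset upper X (v |: A) 1 by apply/subsetP => B; rewrite inE => /andP[].
have [B0 B0u] := edge_exists vV.
have [D0|[B1 B1D]] := set_0Vmem D.
  have nD B : B \in upper X (v |: A) 1 -> ~~ pos (dv v) B.
    move=> Bu; have : B \notin D by rewrite D0 inE.
    by rewrite inE Bu.
  have -> : isbot v.
    apply/forall_inP => y yV; have [yX yA _] := vertsP _ _ _ _ yV.
    rewrite -subr_le0 -(pmulr_rle0 _ (c0V yV)) -ev_dv // -oppr_ge0 -evN.
    suff : nonneg (- dv v) X by apply.
    apply: (nonneg_next (vX vV)) => [i /(dvAv vV)|B BX pB rB i iB].
      by rewrite evN => ->; rewrite oppr0.
    have Bu : B \in upper X (v |: A) 1 by rewrite in_upper BX proper_sub // rB addn1 /=.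
    rewrite evN oppr_ge0 leNgt; apply: contra (nD B Bu) => h.
    by apply/exists_inP; exists i.
  have -> : ismax v = false.
    have [y yV] := edge_lt vV B0u; rewrite (negbTE (nD _ B0u)) => h.
    by apply/negbTE/negP => /forall_inP/(_ y yV); rewrite leNgt h.
  have -> : I = finset.set0.
    apply/setP => C; rewrite in_set0; apply/negbTE/negP; rewrite inE => /andP[Cu /forall_inP h].
    have : [set B in upper X (v |: A) 1 | B \subset C] != finset.set0.
      by rewrite -card_gt0 card_two_in.
    case/set0Pn => B; rewrite inE => /andP[Bu sBC].
    by have := h B Bu; rewrite sBC D0 inE.
  by rewrite D0 !cards0.
have isbotF : isbot v = false.
  have := B1D; rewrite inE => /andP[B1u p1].
  have [y yV] := edge_lt vV B1u; rewrite p1 => h.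
  by apply/negbTE/negP => /forall_inP/(_ y yV); rewrite leNgt h.
rewrite isbotF addn0.
have [eD|nD] := eqVneq D (upper X (v |: A) 1).
  have -> : ismax v.
    apply/forall_inP => y yV; have [yX yA _] := vertsP _ _ _ _ yV.
    rewrite -dv_ge0 //.
    suff : nonneg (dv v) X by apply.
    apply: (nonneg_next (vX vV) (dvAv vV)) => B BX pB rB i iB.
    have Bu : B \in upper X (v |: A) 1 by rewrite in_upper BX proper_sub // rB addn1 /=.
    have [y' [y'V y'v eB]] := upper_point1 vV Bu.
    move: (Bu); rewrite -eD inE => /andP[_]; rewrite eB pos_dv // => hy.
    by move: iB; rewrite eB => /setU1P[->|/(dvAv vV)->//]; rewrite dv_ge0 // ltW.
  have -> : I = upper X (v |: A) 2.
    apply/setP => C; rewrite inE; case: (C \in _) => //=.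
    by apply/forall_inP => B Bu; rewrite eD Bu implybT.
  by rewrite eD card_upper_point // addn1.
have -> : ismax v = false.
  have [B2 B2u B2D] : exists2 B, B \in upper X (v |: A) 1 & B \notin D.
    by apply/subsetPn; apply: contra nD => h; rewrite eqEsubset sD.
  have [y yV] := edge_lt vV B2u; have := B2D; rewrite inE B2u /= => /negbTE-> h.
  by apply/negbTE/negP => /forall_inP/(_ y yV); rewrite leNgt h.
rewrite addn0; apply/eqP; rewrite eqn_leq.
have Dn0 : D != finset.set0 by apply/set0Pn; exists B1.
apply/andP; split.
  (* [D] is connected, being the part of the polygon where [dv v] is positive. *)
  apply: inner_lower => // [S sSD S0 nS|C]; last exact: card_two_in.
  apply: contrapT => hn; case/eqP: nS; apply/eqP; rewrite eqEsubset sSD /=.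
  apply/subsetP => B; rewrite inE => /andP[Bu pB].
  apply: (upper_connected (S := S) (vX vV) (sb2 vV) (dvAv vV)) Bu pB => //.
  - exact: subset_trans sD.
  - by move=> B' /(subsetP sSD); rewrite inE => /andP[].
  - move=> B' B'' C B'S Cu sB' sB'' B''u p''; apply: contrapT => nB''; apply: hn.
    have B''D : B'' \in D by rewrite inE B''u.
    exists C, B', B''; split => //; last by rewrite inE B''D andbT; apply/negP.
    rewrite inE Cu; apply/forall_inP => B3 B3u; apply/implyP => s3.
    have e2 : [set B in upper X (v |: A) 1 | B \subset C] = [set B'; B''].
      apply/esym/eqP; rewrite eqEcard card_two_in // cards2.
      have -> : B' != B'' by apply/eqP => e; apply: nB''; rewrite -e.
      rewrite andbT subUset !sub1set [B' \in _]inE [B'' \in _]inE sB' sB'' B''u.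
      by rewrite (subsetP sD) // (subsetP sSD).
    have : B3 \in [set B'; B''] by rewrite -e2 inE B3u.
    by rewrite in_set2 => /orP[/eqP->|/eqP->//]; apply: (subsetP sSD).
(* Some side leaves [D]: otherwise connectivity, now for a functional [c] positive on the whole
   polygon, would make [D] everything. *)
apply: inner_upper => // [C|B|]; [exact: card_two_in|exact: card_two_out|].
apply: contrapT => hn; case/eqP: nD; apply/eqP; rewrite eqEsubset sD /=.
have [c [cA _ cp]] := fcs_pos (vX vV).
have pc B : B \in upper X (v |: A) 1 -> pos c B.
  move=> Bu; have [y [yV yv ->]] := upper_point1 vV Bu; rewrite (pos_setU1 _ cA).
  by have [yX yA _] := vertsP _ _ _ _ yV; apply: cp => //; rewrite !inE negb_or yv.
apply/subsetP => B Bu.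
apply: (upper_connected (S := D) (vX vV) (sb2 vV) cA) Bu (pc _ Bu) => //.
- by move=> B' /(subsetP sD)/pc.
- move=> B' B'' C B'D Cu sB' sB'' B''u _; apply: contrapT => nB''; apply: hn.
  exists B', C; split => //; rewrite inE Cu /=; apply/negP => /forall_inP/(_ B'' B''u).
  by rewrite sB'' => /nB''.
Qed.

Lemma upper_has_vert B k : B \in upper X A k.+1 -> B :&: Vt != finset.set0.
Proof.
rewrite in_upper => /and3P[BX sAB /eqP rB].
have [|B' [B'X pB' sB' rB']] := fcs_next AX BX.
  rewrite properEneq sAB andbT; apply/eqP => e.
  by move/eqP: rB; rewrite e -[X in X == _]addn0 eqn_add2l.
have [|x xV e] := upper_verts AX sb (B := B').
  by rewrite in_upper B'X proper_sub // rB' addn1 /=.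
by apply/set0Pn; exists x; rewrite in_setI xV (subsetP sB') // e setU11.
Qed.

(** Summing [local_euler] over the vertices counts each edge and each 2-face once, at its top; the
    bottom and the top vertex contribute the 2. *)
Lemma euler_generic : (#|Vt| + #|T| = #|E| + 2)%N.
Proof.
have [B0 B0V] : exists x, x \in Vt.
  have : X :&: Vt != finset.set0.
    by apply: (@upper_has_vert _ 3); rewrite in_upper fcs_full (fcs_sub AX) rX /=.
  by case/set0Pn => x /setIP[_ xV]; exists x.
have V0 : Vt != finset.set0 by apply/set0Pn; exists B0.
have hmax : (\sum_(v in Vt) ismax v = 1)%N.
  rewrite -[RHS](@sum_argmin _ _ _ (fun y => - rho y) V0); last first.
    by move=> x y xV yV /oppr_inj; exact: rho_inj.
  apply: eq_bigr => v _; congr (nat_of_bool _); apply: eq_forallb => y.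
  by rewrite lerN2.
have h : (\sum_(v in Vt) (#|[set B in E | istop v B]| + isbot v + ismax v) =
    \sum_(v in Vt) (#|[set C in T | istop v C]| + 1))%N.
  by apply: eq_bigr => v vV; rewrite local_euler // addn1.
move: h; rewrite !big_split /= sum1_card -!count_tops; [|by move=> B /upper_has_vert..].
by rewrite hmax sum_argmin // => h; rewrite [LHS]addnC -h -addnA.
Qed.

End Euler.

Section EulerConsequences.
Variables (R : realFieldType) (N : nat) (V : finType) (g : V -> 'rV[R]_N).
Variables (X A : {set V}).
Implicit Types (B C S : {set V}).
Local Notation rk := (rk g).
Local Notation fcs := (fcs g).
Local Notation upper := (upper g).
Local Notation verts := (verts g).
Local Notation simple_base := (simple_base g).
Hypotheses (AX : A \in fcs X) (sb : simple_base X A).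
Hypothesis sb2 : forall v, v \in verts X A -> simple_base X (v |: A).

(** Two vertices x, y have equal heights only for functionals on one hyperplane, and a functional
    cutting out the face [x |: A] is not on it; hence some [l] gives all vertices different
    heights. *)
Lemma euler : rk X = (rk A + 4)%N ->
  (#|verts X A| + #|upper X A 3| = #|upper X A 2| + 2)%N.
Proof.
move=> rX; have [c0 [c0A _ c0p]] := fcs_pos AX.
pose I := {xy : V * V | [&& xy.1 \in verts X A, xy.2 \in verts X A & xy.1 != xy.2]}.
pose h (i : I) := ev g c0 (val i).2 *: g (val i).1 - ev g c0 (val i).1 *: g (val i).2.
have hE i c : (h i *m c) 0 0 = ev g c0 (val i).2 * ev g c (val i).1 -
    ev g c0 (val i).1 * ev g c (val i).2.
  rewrite /h mulmxBl -!scalemxAl /(ev g c).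
  by move: (g (val i).1 *m c) (g (val i).2 *m c) => u v; rewrite !mxE.
have c0V v : v \in verts X A -> 0 < ev g c0 v by case/vertsP => vX vA _; apply: c0p.
have [||i|l lA hl] :=
  avoid_hyperplanes (Q := fun c => vanishes g c A) (h := h).
- by move=> i _; rewrite /ev mulmx0 mxE.
- by move=> a c d hc hd i iA; rewrite !evE hc // hd // mulr0 addr0.
- case: i => -[x y] xyP; have /and3P[/= xV yV xy] := xyP.
  have [xX xA /fcs_pos[c [cA _ cp]]] := vertsP _ _ _ _ xV.
  exists c => [i iA|]; first by rewrite cA ?setU1r.
  have [yX yA _] := vertsP _ _ _ _ yV.
  rewrite hE /= (cA x) ?setU11 // mulr0 add0r oppr_eq0 mulf_neq0 ?gt_eqF ?c0V //.
  by apply: cp => //; rewrite !inE negb_or eq_sym xy.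
apply: (euler_generic AX sb sb2 rX c0A c0p lA) => x y xV yV e.
apply/eqP; apply: contraT => xy.
have xyP : [&& (x, y).1 \in verts X A, (x, y).2 \in verts X A & (x, y).1 != (x, y).2].
  by rewrite /= xV yV.
have := hl (exist _ (x, y) xyP); rewrite hE /= subr_eq0 => /negP[].
have c0n v : v \in verts X A -> ev g c0 v != 0 by move=> /c0V; case: ltgtP.
move/eqP: e; rewrite (eqr_div _ _ (c0n _ xV) (c0n _ yV)) => /eqP e.
by apply/eqP; rewrite mulrC e mulrC.
Qed.

(** A vertex of the 2-face, together with the other ends of its two edges in that 2-face. *)
Lemma card_facet_verts C : C \in upper X A 3 -> (3 <= #|C :&: verts X A|)%N.
Proof.
move=> Cu; have /set0Pn[v /setIP[vC vV]] := upper_has_vert AX sb Cu.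
have Cv : C \in upper X (v |: A) 2 by rewrite upper_point // inE Cu.
have := card_two_in vV Cv.
have s : [set B in upper X (v |: A) 1 | B \subset C] \subset
    [set y |: (v |: A) | y in (C :&: verts X A) :\ v].
  apply/subsetP => B; rewrite inE => /andP[Bu sBC].
  have [y [yV yv eB]] := upper_point1 AX sb sb2 vV Bu.
  apply/imsetP; exists y => //; rewrite in_setD1 yv in_setI yV andbT.
  by rewrite (subsetP sBC) // eB setU11.
have := leq_trans (subset_leq_card s) (leq_imset_card _ _).
by rewrite (cardsD1 v (C :&: _)) in_setI vC vV /=; lia.
Qed.

(** In dimension 3, Euler's relation is combined with the fact that 2-faces have at least three
    vertices; a polygon has as many edges as vertices; smaller figures have fewer than three
    vertices. The rank is only bounded above because the vertex sets to which this is applied may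
    span less. *)
Lemma edges_le : (rk X <= rk A + 4)%N -> (3 <= #|verts X A|)%N ->
  (#|upper X A 2| + 6 <= 3 * #|verts X A|)%N.
Proof.
rewrite leq_eqVlt => /orP[/eqP rX|rX] V3.
  have := euler rX; have := sum_facet_verts AX sb rX.
  have : (3 * #|upper X A 3| <= \sum_(C in upper X A 3) #|C :&: verts X A|)%N.
    by rewrite mulnC -sum_nat_const; apply: leq_sum => C /card_facet_verts.
  lia.
have [r3|r3] := eqVneq (rk X) (rk A + 3)%N.
  have := sum_card_point AX 1.
  rewrite (eq_bigr (fun=> 2%N)) => [|v vV]; last first.
    apply: diamond; first by case/vertsP: vV.
    have := verts_upper AX vV; rewrite in_upper => /and3P[_ _ /eqP->].
    by rewrite r3 -addnA.
  rewrite [in RHS](eq_bigr (fun=> 2%N)) => [|B Bu]; last exact: card_edge_verts.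
  rewrite !sum_nat_const; lia.
have sAX := fcs_sub AX.
have VX : X :&: verts X A = verts X A.
  by apply/setIidPr/subsetP => v /vertsP[].
have [r2|r2] := eqVneq (rk X) (rk A + 2)%N.
  have := @card_edge_verts _ _ _ g X A AX sb X.
  by rewrite in_upper fcs_full sAX r2 eqxx VX => /(_ isT) e; rewrite e in V3.
have r1 : (rk X <= rk A + 1)%N by move: rX r3 r2; move: (rk X) (rk A) => a b; lia.
have /card_gt0P[v vV] : (0 < #|verts X A|)%N by apply: leq_trans V3.
have [vX' vA vF] := vertsP _ _ _ _ vV.
have eX : v |: A = X.
  apply: (fcs_rk_inj vF) => //; first exact: fcs_sub vF.
  by rewrite (rk_fcs_setU1 AX vX' vA) -addn1.
have : verts X A \subset [set v].
  apply/subsetP => u /vertsP[uX uA _]; move: uX; rewrite -eX !inE.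
  by rewrite (negbTE uA) orbF.
by move/subset_leq_card; rewrite cards1 => h; move: (leq_trans V3 h).
Qed.

Lemma edges_eq : rk X = (rk A + 4)%N ->
  (forall C, C \in upper X A 3 -> #|C :&: verts X A| = 3%N) ->
  (#|upper X A 2| + 6 = 3 * #|verts X A|)%N.
Proof.
move=> rX h; have := euler rX; have := sum_facet_verts AX sb rX.
by rewrite (eq_bigr (fun=> 3%N)) ?sum_nat_const //; lia.
Qed.

End EulerConsequences.

Local Open Scope nat_scope.

(** * Graphs and cycles *)

Section Graph.
Variables (V : finType) (E : {set {set V}}).
Hypothesis E2 : forall f, f \in E -> #|f| = 2.
Implicit Types (S U A B f : {set V}).

Definition nb x := [set y | [set x; y] \in E].
Definition edg S := [set f in E | f \subset S].
Definition clique S := [forall x in S, forall y in S, (x != y) ==> (y \in nb x)].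

Lemma nbE x y : (y \in nb x) = ([set x; y] \in E). Proof. by rewrite inE. Qed.
Lemma nbC x y : (y \in nb x) = (x \in nb y). Proof. by rewrite !nbE setUC. Qed.
Lemma nb_irr x : x \notin nb x.
Proof. by apply/negP; rewrite nbE => /E2; rewrite setUid cards1. Qed.
Lemma nb_neq x y : y \in nb x -> x != y.
Proof. by apply: contraTneq => ->; exact: nb_irr. Qed.

Lemma edgP S f : reflect (exists x y, [/\ x \in S, y \in S, y \in nb x & f = [set x; y]])
  (f \in edg S).
Proof.
apply: (iffP idP) => [|[x [y [xS yS xy ->]]]]; last first.
  by rewrite inE -nbE xy subUset !sub1set xS.
rewrite inE => /andP[fE]; have /eqP/cards2P[x [y [_ e]]] := E2 fE.
rewrite e subUset !sub1set => /andP[xS yS].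
by exists x, y; rewrite nbE -e.
Qed.

Lemma edgS S U : S \subset U -> edg S \subset edg U.
Proof.
move=> sSU; apply/subsetP => f; rewrite !inE => /andP[-> fS].
exact: subset_trans sSU.
Qed.

Lemma edgI S U : edg (S :&: U) = edg S :&: edg U.
Proof. by apply/setP => f; rewrite !inE subsetI; case: (f \in E). Qed.

Lemma cliqueP S : reflect {in S &, forall x y, x != y -> y \in nb x} (clique S).
Proof.
apply: (iffP forall_inP) => [h x y xS yS|h x xS].
  by move=> xy; have /forall_inP/(_ y yS) := h x xS; rewrite xy.
by apply/forall_inP => y yS; apply/implyP; exact: h.
Qed.

Lemma cliqueS S U : S \subset U -> clique U -> clique S.
Proof.
by move=> /subsetP sSU /cliqueP h; apply/cliqueP => x y /sSU xU /sSU; exact: h.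
Qed.

Lemma clique_setU1 x S : clique S -> S \subset nb x -> clique (x |: S).
Proof.
move=> /cliqueP hS /subsetP hx; apply/cliqueP => y z.
move=> /setU1P[->|yS] /setU1P[->|zS]; rewrite ?eqxx //.
- by move=> _; exact: hx.
- by move=> _; rewrite nbC; exact: hx.
- exact: hS.
Qed.

Lemma card_edg_del v S : v \in S -> #|edg S| = #|edg (S :\ v)| + #|S :&: nb v|.
Proof.
move=> vS; rewrite -(cardsID (edg (S :\ v))) -edgI (setIidPr (subsetDl _ _)).
congr (_ + _); have -> : edg S :\: edg (S :\ v) = [set [set v; y] | y in S :&: nb v].
  apply/setP => f; apply/setDP/imsetP => [[/edgP[x [y [xS yS xy ->]]] n]|[y]].
    have [e|xv] := eqVneq x v; first by exists y; rewrite ?in_setI ?yS -e.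
    have [e|yv] := eqVneq y v; first by exists x; rewrite ?in_setI ?xS -e 1?nbC // setUC.
    by case/negP: n; apply/edgP; exists x, y; rewrite !inE xv yv xS yS -nbE.
  rewrite in_setI => /andP[yS yv] ->; split; first by apply/edgP; exists v, y.
  by rewrite inE subUset sub1set !inE eqxx andbF.
rewrite card_in_imset // => x y _ /setIP[_ yv] /setP/(_ y).
by rewrite !inE eqxx orbT eq_sym (negbTE (nb_neq yv)) /= => /eqP.
Qed.

Lemma card_edg_cut S1 S2 : (forall x y, x \in S1 :\: S2 -> y \in S2 :\: S1 -> y \notin nb x) ->
  #|edg (S1 :|: S2)| + #|edg (S1 :&: S2)| = #|edg S1| + #|edg S2|.
Proof.
move=> h; rewrite edgI -[RHS]cardsUI; suff -> : edg (S1 :|: S2) = edg S1 :|: edg S2 by [].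
apply/setP => f; apply/idP/setUP => [|[]]; last 2 first.
- exact/subsetP/edgS/subsetUl.
- exact/subsetP/edgS/subsetUr.
case/edgP => x [y [/setUP xS /setUP yS xy ->]].
have [x1|x1] := boolP (x \in S1); have [y1|y1] := boolP (y \in S1).
- by left; apply/edgP; exists x, y.
- have [x2|x2] := boolP (x \in S2).
    by right; apply/edgP; exists x, y; case: yS y1 => [->|].
  case: yS y1 => [->//|y2 y1].
  by have := h x y; rewrite !inE x1 x2 y1 y2 -nbE xy => /(_ isT isT).
- have [y2|y2] := boolP (y \in S2).
    by right; apply/edgP; exists x, y; case: xS x1 => [->|].
  case: xS x1 => [->//|x2 x1].
  by have := h y x; rewrite !inE x1 x2 y1 y2 -nbE nbC xy => /(_ isT isT).
- by right; apply/edgP; exists x, y; case: xS x1 => [->|] //; case: yS y1 => [->|].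
Qed.

Lemma card_edg_sub S : #|edg S| <= 'C(#|S|, 2).
Proof.
rewrite -cards_draws; apply/subset_leq_card/subsetP => f.
by rewrite !inE => /andP[/E2-> ->] /=.
Qed.

Lemma card_edg_clique S : clique S -> #|edg S| = 'C(#|S|, 2).
Proof.
move=> /cliqueP h; rewrite -cards_draws; apply: eq_card => f; rewrite !inE.
case fS: (f \subset S); rewrite ?andbF ?andbT //=.
apply/idP/eqP => [/E2//|/eqP/cards2P[x [y [xy e]]]].
move: fS; rewrite e subUset !sub1set => /andP[xS yS].
by rewrite -nbE h.
Qed.

End Graph.

(** * Cutting a cycle at two vertices *)

Section Cycles.
Variable V : finType.
Implicit Types (X S f : {set V}) (H : {set {set V}}).

(** A connected 2-regular graph. Connectivity is the absence of proper nonempty closed sets, which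
    is the form that the simplex path provides. *)
Definition cyc X H :=
  [/\ X != finset.set0, forall f, f \in H -> #|f| = 2 /\ f \subset X,
      forall x, x \in X -> #|[set f in H | x \in f]| = 2 &
      forall S, S \subset X -> S != finset.set0 ->
        (forall f, f \in H -> f :&: S != finset.set0 -> f \subset S) -> S = X].

Lemma degree_sum X H : (forall f, f \in H -> #|f| = 2 /\ f \subset X) ->
  \sum_(x in X) #|[set f in H | x \in f]| = 2 * #|H|.
Proof.
move=> hH; rewrite -(double_count X H (fun x f => x \in f)).
rewrite mulnC -sum_nat_const; apply: eq_bigr => f /hH[<- fX].
by apply: eq_card => x; rewrite inE; case xf: (x \in f); rewrite ?andbF // (subsetP fX).
Qed.

Lemma cyc_card X H : cyc X H -> #|H| = #|X|.
Proof.
case=> _ hH hX _; have := degree_sum hH.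
by rewrite (eq_bigr (fun=> 2)) // sum_nat_const mulnC => /eqP; rewrite eqn_pmul2l // => /eqP.
Qed.

Section Cut.
Variables (X X1 X2 : {set V}) (H : {set {set V}}) (x z : V).
Hypotheses (hc : cyc X H) (xz : x != z) (eX : X = X1 :|: X2)
  (eI : X1 :&: X2 = [set x; z])
  (n1 : ~~ (X1 \subset [set x; z])) (n2 : ~~ (X2 \subset [set x; z]))
  (hf : forall f, f \in H -> f \subset X1 \/ f \subset X2).

(** The chord {x, z} is left out because it would lie on both sides. *)
Let part (Y : {set V}) := [set f in H | (f \subset Y) && (f != [set x; z])].
Let deg (Y : {set V}) v := #|[set f in part Y | v \in f]|.

Lemma part_inner y f : y \in X1 -> y \notin [set x; z] -> f \in H -> y \in f ->
  f \in part X1.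
Proof.
move=> y1 ny fH yf; rewrite !inE fH /=; apply/andP; split; last by apply: contraNneq ny => <-.
case: (hf fH) => // f2; case/negP: ny; rewrite -eI inE y1; exact: (subsetP f2).
Qed.

(** Handshake inside [X1]: every vertex other than [x] and [z] keeps its degree 2. *)
Lemma part_even : ~~ odd (deg X1 x + deg X1 z).
Proof.
have [_ hH hX _] := hc.
have h1 : forall f, f \in part X1 -> #|f| = 2 /\ f \subset X1.
  by move=> f; rewrite inE => /and3P[/hH[-> _] ->].
have := degree_sum h1.
rewrite (big_setID [set x; z]) /=.
have -> : X1 :&: [set x; z] = [set x; z].
  by apply/setIidPr; rewrite -eI subsetIl.
rewrite big_setU1 ?inE //= big_set1 (eq_bigr (fun=> 2)) => [|y]; last first.
  rewrite inE => /andP[ny y1]; rewrite -(hX y); last by rewrite eX inE y1.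
  apply: eq_card => f; rewrite inE [RHS]inE.
  case yf: (y \in f); rewrite ?andbF // !andbT; apply/idP/idP => [|fH].
    by rewrite inE => /andP[].
  exact: part_inner yf.
rewrite sum_nat_const -/(deg _ _) -/(deg _ _) => e.
have -> : deg X1 x + deg X1 z = 2 * #|part X1| - #|X1 :\: [set x; z]| * 2 by rewrite -e addnK.
by rewrite mulnC -mulnBl oddM andbF.
Qed.

Lemma deg_sum v : v \in [set x; z] -> deg X1 v + deg X2 v + ([set x; z] \in H) = 2.
Proof.
have [_ hH hX _] := hc.
move=> vxz; rewrite -(hX v); last by rewrite eX inE; move: vxz; rewrite -eI inE => /andP[->].
rewrite -(cardsID [set [set x; z]] [set f in H | v \in f]) addnC; congr (_ + _).
  have -> : [set f in H | v \in f] :&: [set [set x; z]] =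
    if [set x; z] \in H then [set [set x; z]] else finset.set0.
    apply/setP => f; rewrite in_setI [X in X && _]in_set in_set1.
    case: eqP => [->|nf]; rewrite ?andbF ?andbT ?vxz ?andbT; case: ifP => _;
      by rewrite ?in_set1 ?in_set0 ?eqxx //; apply/esym/eqP.
  by case: ifP; rewrite ?cards1 ?cards0.
rewrite -cardsUI [X in _ + X](_ : _ = 0) ?addn0.
  apply: eq_card => f; rewrite !inE; case fH: (f \in H) => //=.
  by case: eqP => e; rewrite ?andbF ?andbT //=; case: (hf fH) => -> /=; case: (v \in f); rewrite /= ?andbT ?andbF ?orbT.
  by rewrite andbF.
apply/eqP; rewrite cards_eq0; apply/eqP/setP => f; rewrite !inE.
case fH: (f \in H) => //=; case: eqP => [_|nf]; rewrite ?andbF //= !andbT.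
apply/negbTE/negP => /andP[/andP[f1 _] /andP[f2 _]]; apply: nf.
have [cf _] := hH _ fH.
by apply/eqP; rewrite eqEcard cf cards2 xz andbT -eI subsetI f1.
Qed.

(** Otherwise [X1] without [x] and [z] would be a proper closed subset of the cycle. *)
Lemma deg_neq0 (Y := X1 :\: [set x; z]) : ~~ ((deg X1 x == 0) && (deg X1 z == 0)).
Proof.
have [_ hH hX hcl] := hc.
apply/negP => /andP[/eqP/cards0_eq dx /eqP/cards0_eq dz].
suff eY : Y = X.
  have : x \in Y by rewrite eY eX inE; have := set21 x z; rewrite -eI inE => /andP[->].
  by rewrite !inE eqxx.
apply: hcl.
- by rewrite eX subDset setUCA subsetUl.
- by rewrite setD_eq0.
- move=> f fH /set0Pn[y]; rewrite inE => /andP[yf /setDP[y1 ny]].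
  have fp := part_inner y1 ny fH yf.
  apply/subsetP => u uf; move: (fp); rewrite inE => /and3P[_ f1 _].
  rewrite inE (subsetP f1) // andbT; apply/negP; rewrite in_set2 => /orP[]/eqP e.
    by have := in_set0 f; rewrite -dx in_set fp -{1}e uf.
  by have := in_set0 f; rewrite -dz in_set fp -{1}e uf.
Qed.

(** Otherwise [X1 :\ x] would be closed: no edge leaves it at [z] into the other side, and none
    leads to [x]. *)
Lemma deg_cross : [set x; z] \notin H -> ~~ ((deg X1 x == 0) && (deg X2 z == 0)).
Proof.
have [_ hH hX hcl] := hc.
move=> nH; apply/negP => /andP[/eqP/cards0_eq dx /eqP/cards0_eq dz].
have z1 : z \in X1 by have := set22 x z; rewrite -eI inE => /andP[].
suff eY : X1 :\ x = X.
  have : x \in X1 :\ x by rewrite eY eX inE; have := set21 x z; rewrite -eI inE => /andP[->].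
  by rewrite !inE eqxx.
apply: hcl.
- by rewrite eX subDset setUCA subsetUl.
- by apply/set0Pn; exists z; rewrite !inE eq_sym xz.
- move=> f fH /set0Pn[y]; rewrite inE => /andP[yf /setD1P[yx y1]].
  have nf : f != [set x; z] by apply: contraNneq nH => <-.
  have fp : f \in part X1.
    have [e|ne] := eqVneq y z; last first.
      by apply: part_inner yf => //; rewrite in_set2 negb_or yx.
    rewrite inE fH nf andbT /=; case: (hf fH) => // f2.
    by have := in_set0 f; rewrite -dz !in_set fH f2 nf -e yf.
  move: (fp); rewrite inE => /and3P[_ f1 _].
  apply/subsetP => u uf; rewrite !inE (subsetP f1) // andbT.
  by apply/eqP => e; have := in_set0 f; rewrite -dx in_set fp -{1}e uf.
Qed.
End Cut.

Section Cut2.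
Variables (X X1 X2 : {set V}) (H : {set {set V}}) (x z : V).
Hypotheses (hc : cyc X H) (xz : x != z) (eX : X = X1 :|: X2)
  (eI : X1 :&: X2 = [set x; z])
  (n1 : ~~ (X1 \subset [set x; z])) (n2 : ~~ (X2 \subset [set x; z]))
  (hf : forall f, f \in H -> f \subset X1 \/ f \subset X2).

Let part (Y : {set V}) := [set f in H | (f \subset Y) && (f != [set x; z])].
Let deg (Y : {set V}) v := #|[set f in part Y | v \in f]|.

(** If the chord were an edge, parity would put the remaining edges at [x] and [z] on the same side
    and leave the other side with none. Without the chord, the degrees at [x] and [z] sum to 2 over
    the two sides, and parity and the exclusions above leave only 1 for each. *)
Lemma cut_degrees : [/\ [set x; z] \notin H, deg X1 x = 1 & deg X1 z = 1].
Proof.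
have eX' : X = X2 :|: X1 by rewrite setUC.
have eI' : X2 :&: X1 = [set x; z] by rewrite setIC.
have hf' f : f \in H -> f \subset X2 \/ f \subset X1 by move/hf; tauto.
have xz' : z != x by rewrite eq_sym.
have eIs : X1 :&: X2 = [set z; x] by rewrite setUC.
have ns : ~~ (X1 \subset [set z; x]) by rewrite setUC.
have := deg_sum hc xz eX eI hf (set21 x z); have := deg_sum hc xz eX eI hf (set22 x z).
have := part_even hc xz eX eI hf; have := deg_neq0 hc eX eI n1 hf.
have := deg_neq0 hc eX' eI' n2 hf'.
move: (deg_cross hc xz eX eI hf) (deg_cross hc xz eX' eI' hf').
rewrite -!/(part _) -!/(deg _ _).
case: ([set x; z] \in H); move: (deg X1 x) (deg X1 z) (deg X2 x) (deg X2 z) => a b c d /=.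
  by move=> *; exfalso; lia.
by move=> *; split => //; lia.
Qed.

(** A set closed in the new graph contains both or neither of [x] and [z]. Of such a set and its
    complement, the one that misses them is closed in the old cycle, hence empty. *)
Lemma cyc_cut : cyc X1 ([set x; z] |: [set f in H | f \subset X1]).
Proof.
have [nH dx dz] := cut_degrees; have [_ hH hX hcl] := hc.
have s1 : [set x; z] \subset X1 by rewrite -eI subsetIl.
have eP : part X1 = [set f in H | f \subset X1].
  apply/setP => f; rewrite [LHS]in_set [RHS]in_set; case fH: (f \in H) => //=.
  by rewrite (_ : f != _) ?andbT //; apply: contraNneq nH => <-.
have degE v : #|[set f in [set x; z] |: [set f in H | f \subset X1] | v \in f]| =
    (v \in [set x; z]) + deg X1 v.
  rewrite /deg eP -[LHS](cardsID [set [set x; z]]); congr (_ + _).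
    have [vxz|vxz] := boolP (v \in [set x; z]).
      rewrite -[RHS](cards1 [set x; z]); apply: eq_card => f.
      rewrite in_setI in_set in_setU1 in_set1; case: eqP => [->|_]; rewrite ?andbF //.
      by rewrite vxz.
    apply/eqP; rewrite cards_eq0; apply/eqP/setP => f.
    rewrite in_setI in_set in_set1 in_set0; case: eqP => [->|_]; rewrite ?andbF //.
    by rewrite (negbTE vxz) andbF.
  apply: eq_card => f; rewrite in_setD in_set1 [X in _ && X]in_set in_setU1.
  rewrite !in_set; case: eqP => [->|_] //=.
  by rewrite (negbTE nH).
split.
- by apply/set0Pn; exists x; rewrite (subsetP s1) ?set21.
- move=> f /setU1P[->|]; first by rewrite cards2 xz.
  by rewrite inE => /andP[/hH[-> _] ->].
- move=> v v1; rewrite degE; have [|nv] := boolP (v \in _).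
    by rewrite in_set2 => /orP[]/eqP->; rewrite ?dx ?dz.
  rewrite -(hX v); last by rewrite eX inE v1.
  apply: eq_card => f; rewrite inE [RHS]inE; case vf: (v \in f); rewrite ?andbF // !andbT.
  apply/idP/idP => [|fH]; first by rewrite inE => /andP[].
  exact: (part_inner eI hf v1 nv fH vf).
have key S : S \subset X1 -> x \notin S -> z \notin S ->
    (forall f, f \in [set x; z] |: [set f in H | f \subset X1] ->
       f :&: S != finset.set0 -> f \subset S) -> S = finset.set0.
  move=> sS xS zS clS; apply/eqP; apply: contraT => S0.
  suff eS : S = X by case/negP: xS; rewrite eS eX inE (subsetP s1) ?set21.
  apply: hcl => // [|f fH fS]; first by rewrite eX (subset_trans sS) ?subsetUl.
  apply: (clS _ _ fS); rewrite in_setU1 in_set fH /=; apply/orP; right.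
  case/set0Pn: (fS) => y /setIP[yf yS].
  have ny : y \notin [set x; z].
    by rewrite in_set2; apply/norP; split; [apply: contraNneq xS|apply: contraNneq zS] => <-.
  by have := part_inner eI hf (subsetP sS _ yS) ny fH yf; rewrite inE => /and3P[].
move=> S sS S0 clS.
have xz_in : x \in S -> z \in S.
  move=> xS; apply: (subsetP (clS [set x; z] (setU11 _ _) _)); last exact: set22.
  by apply/set0Pn; exists x; rewrite inE set21.
have zx_in : z \in S -> x \in S.
  move=> zS; apply: (subsetP (clS [set x; z] (setU11 _ _) _)); last exact: set21.
  by apply/set0Pn; exists z; rewrite inE set22.
have [xS|xS] := boolP (x \in S); last first.
  case/eqP: S0; apply: key => //; apply: contra xS; exact: zx_in.
apply/eqP; rewrite eqEsubset sS -setD_eq0; apply/eqP/key.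
- exact: subsetDl.
- by rewrite inE xS.
- by rewrite inE xz_in.
- move=> f fH /set0Pn[y]; rewrite inE => /andP[yf /setDP[y1 yS]].
  have f1 : f \subset X1 by move: fH => /setU1P[->//|]; rewrite inE => /andP[].
  apply/subsetP => u uf; rewrite inE (subsetP f1) // andbT; apply: contra yS => uS.
  by apply: (subsetP (clS f fH _)) => //; apply/set0Pn; exists u; rewrite inE uf.
Qed.
End Cut2.
End Cycles.

(** * The lower bound theorem *)

Lemma edges_sparse_small (V : finType) (E : {set {set V}}) (U : {set V}) :
  (forall f, f \in E -> #|f| = 2) -> #|U| = 4 -> #|edg E U| <= 6.
Proof. by move=> E2 U4; apply: leq_trans (card_edg_sub E2 U) _; rewrite U4. Qed.

(* The lower bound theorem by Gromov's combinatorial rigidity: the closed star of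
   a vertex outside F is the cone over a maximal planar graph, so adding such a
   star along at least four vertices adds at least four edges per new vertex. *)
Section StarCount.
Variables (V : finType) (E : {set {set V}}) (F : {set V}) (lk : V -> {set {set V}}).
Hypothesis E2 : forall f, f \in E -> #|f| = 2.
Implicit Types (S U A B f : {set V}).
Local Notation nb := (nb E).
Local Notation edg := (edg E).
Hypothesis lk_edg : forall w, w \notin F -> lk w \subset edg (nb w).
Hypothesis lk_card : forall w, w \notin F -> #|lk w| + 6 = 3 * #|nb w|.
Hypothesis lk_sub : forall w B, w \notin F -> B \subset nb w -> 3 <= #|B| ->
  #|[set f in lk w | f \subset B]| + 6 <= 3 * #|B|.
Hypothesis F_sub : forall U, U \subset F -> 3 <= #|U| -> #|edg U| + 6 <= 3 * #|U|.
Hypothesis conn : forall S, S \subset ~: F -> S != finset.set0 ->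
  (forall x, x \in S -> nb x :\: F \subset S) -> S = ~: F.
Hypothesis F_nb : forall x, x \in F -> exists2 w, w \notin F & w \in nb x.
Hypothesis nb4 : forall w w', w \notin F -> w' \in nb w ->
  4 <= #|(w |: nb w) :&: (w' |: nb w')|.

Definition cnb w : {set V} := w |: nb w.

Lemma cnbU w : cnb w = w |: nb w. Proof. by []. Qed.

Let spokes w := [set [set w; y] | y in nb w].
Let star w := lk w :|: spokes w.

Lemma card_spokes w S : S \subset nb w -> #|[set [set w; y] | y in S]| = #|S|.
Proof.
move=> sS; rewrite card_in_imset // => x y _ /(subsetP sS) yw /setP/(_ y).
by rewrite !inE eqxx orbT eq_sym (negbTE (nb_neq E2 yw)) /= => /eqP.
Qed.

Lemma star_sub w : w \notin F -> star w \subset edg (cnb w).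
Proof.
move=> wF; rewrite subUset (subset_trans (lk_edg wF)) ?edgS ?subsetUr //=.
apply/subsetP => f /imsetP[y yw ->].
by rewrite inE -nbE yw subUset !sub1set setU11 setU1r.
Qed.

Lemma lk_spokes w : w \notin F -> [disjoint lk w & spokes w].
Proof.
move=> wF; rewrite -setI_eq0; apply/eqP/setP => f; rewrite !inE.
apply/negbTE/negP => /andP[fl /imsetP[y _ e]].
have := subsetP (lk_edg wF) _ fl; rewrite inE => /andP[_ /subsetP/(_ w)].
by rewrite e set21 (negbTE (nb_irr E2 _)) => /(_ isT).
Qed.

Lemma card_star w : w \notin F -> #|star w| + 6 = 4 * #|nb w|.
Proof.
move=> wF; rewrite cardsU (disjoint_setI0 (lk_spokes wF)) cards0 subn0.
by rewrite card_spokes //; have := lk_card wF; lia.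
Qed.

(** With B the part of the link in [U], the old edges of the star number at most 3 |B| - 6 in the
    link, plus |B| spokes if [w] is in [U], while the star has 4 |nb w| - 6 edges. If [w] is not in
    [U] it is a new vertex itself, paid for by the spokes to B, of which there are at least four:
    this is the origin of the threshold. *)
Lemma star_new w U : w \notin F -> 4 <= #|cnb w :&: U| ->
  4 * #|cnb w :\: U| + #|star w :&: edg U| <= #|star w|.
Proof.
move=> wF h4; set B := nb w :&: U.
have hst : star w :&: edg U \subset [set f in lk w | f \subset B] :|:
    (if w \in U then [set [set w; y] | y in B] else finset.set0).
  apply/subsetP => f /setIP[/setUP[fl|/imsetP[y yw ->]] fU]; apply/setUP.
    left; rewrite inE fl subsetI; move: fU; rewrite inE => /andP[_ ->].
    by have := subsetP (lk_edg wF) _ fl; rewrite inE => /andP[_ ->].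
  right; move: fU; rewrite inE subUset !sub1set => /and3P[_ -> yU].
  by apply/imsetP; exists y => //; rewrite inE yw.
have hB : B \subset nb w by apply: subsetIl.
have c1 := leq_trans (subset_leq_card hst) (leq_card_setU _ _).
have cn := cardsID U (cnb w).
have ccn : #|cnb w| = #|nb w|.+1 by rewrite cardsU1 (nb_irr E2).
have cs := card_star wF.
have [wU|wU] := boolP (w \in U).
  have cI : #|cnb w :&: U| = #|B|.+1.
    have -> : cnb w :&: U = w |: B by rewrite /cnb setIUl (setIidPl _) // sub1set.
    by rewrite cardsU1 in_setI (negbTE (nb_irr E2 w)).
  move: c1; rewrite wU card_spokes //.
  have := lk_sub wF hB; rewrite cI in h4 cn; move=> /(_ h4).
  lia.
have cI : #|cnb w :&: U| = #|B|.
  congr (#|pred_of_set _|); rewrite /cnb setIUl [X in X :|: _](_ : _ = finset.set0) ?set0U //.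
  by apply/setP => y; rewrite !inE; case: eqP => [->|//]; rewrite (negbTE wU).
move: c1; rewrite (negbTE wU) cards0 addn0; rewrite cI in h4 cn.
have := lk_sub wF hB; move=> /(_ (ltnW h4)); lia.
Qed.

Lemma grow w U : w \notin F -> 4 <= #|cnb w :&: U| ->
  #|edg U| + 4 * #|cnb w :\: U| <= #|edg (U :|: cnb w)|.
Proof.
move=> wF h4; have := star_new wF h4; have := cardsID (edg U) (star w).
have : #|edg U| + #|star w :\: edg U| <= #|edg (U :|: cnb w)|.
  have <- : #|edg U :|: (star w :\: edg U)| = #|edg U| + #|star w :\: edg U|.
    rewrite cardsU (_ : edg U :&: (star w :\: edg U) = finset.set0) ?cards0 ?subn0 //.
    by apply/eqP; rewrite setIDA setD_eq0 subsetIl.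
  apply/subset_leq_card; rewrite subUset edgS ?subsetUl //=.
  apply: subset_trans (subsetDl _ _) (subset_trans (star_sub wF) _).
  by apply: edgS; apply: subsetUr.
lia.
Qed.

Lemma cnb4 w : w \notin F -> exists2 w', w' \in nb w & 4 <= #|cnb w :&: cnb w'|.
Proof.
move=> wF; have : 0 < #|nb w| by have := lk_card wF; lia.
by case/card_gt0P => w' w'w; exists w' => //; apply: nb4.
Qed.

(** When no star can add a vertex, every closed star meeting [U] in four points lies in [U]. By
    [nb4] this property passes to neighbours outside [F], so by connectivity it holds for all
    vertices outside [F], and their stars cover [F] as well. *)
Lemma count_from w U : w \notin F -> 4 <= #|cnb w :&: U| ->
  #|edg U| + 4 * #|~: U| <= #|edg setT|.
Proof.
have [m] := ubnP #|~: U|; elim: m w U => // m IH w U hm wF h4.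
have [e|[w' [w'F h4' nU]]] : U = setT \/
    exists w', [/\ w' \notin F, 4 <= #|cnb w' :&: U| & ~~ (cnb w' \subset U)].
- apply: contrapT => /not_orP[nT nE]; apply: nT.
  have nE' w' : w' \notin F -> 4 <= #|cnb w' :&: U| -> cnb w' \subset U.
    by move=> w'F h; apply: contrapT => /negP h'; apply: nE; exists w'.
  pose S := [set x in ~: F | 4 <= #|cnb x :&: U|].
  have eS : S = ~: F.
    apply: conn => [||x].
    + by apply/subsetP => x; rewrite inE => /andP[].
    + by apply/set0Pn; exists w; rewrite inE inE wF.
    rewrite inE inE => /andP[xF x4]; apply/subsetP => y /setDP[yx yF].
    rewrite inE inE yF /=; apply: leq_trans (nb4 xF yx) _.
    by apply: subset_leq_card; rewrite setIC; apply: setIS; apply: nE'.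
  have hS x : x \notin F -> cnb x \subset U.
    by move=> xF; apply: nE' => //; have : x \in S; [rewrite eS inE|rewrite inE => /andP[]].
  apply/setP => x; rewrite inE; have [xF|xF] := boolP (x \in F); last first.
    by rewrite (subsetP (hS x xF)) ?setU11.
  have [y yF yx] := F_nb xF; by rewrite (subsetP (hS y yF)) // setU1r // nbC.
- by rewrite e setCT cards0 muln0 addn0.
have := grow w'F h4'.
have cU : #|~: U| = #|cnb w' :\: U| + #|~: (U :|: cnb w')|.
  by rewrite -(cardsID (cnb w') (~: U)) setDE setCU; congr (_ + _); rewrite setIC setDE.
have : 0 < #|cnb w' :\: U| by rewrite card_gt0 setD_eq0.
move=> h0 hg; have := IH w' (U :|: cnb w') _ w'F.
have h5 : 4 <= #|cnb w' :&: (U :|: cnb w')|.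
  by apply: leq_trans h4' _; apply/subset_leq_card/setIS/subsetUl.
move=> /(_ _ h5); rewrite -ltnS in hm; lia.
Qed.

Hypothesis nF : F != setT.

(** The growth starts from one closed star, which already has at least 4 |nb w| - 6 = 4 |cnb w| - 10
    edges. *)
Lemma lower_bound : 4 * #|V| <= #|edg setT| + 10.
Proof.
have [w wF] : exists w, w \notin F.
  by apply/existsP; move: nF; apply: contraR; rewrite negb_exists => /forallP h;
    apply/eqP/setP => x; rewrite inE; have := h x; rewrite negbK => ->.
have [w' _ h4] := cnb4 wF.
have h4' : 4 <= #|cnb w :&: cnb w| by rewrite setIid (leq_trans h4) // subset_leq_card ?subsetIl.
have := count_from wF h4'; have := card_star wF.
have := subset_leq_card (star_sub wF).
have ccn : #|cnb w| = #|nb w|.+1 by rewrite cardsU1 (nb_irr E2).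
have := cardsC (cnb w); lia.
Qed.

Hypothesis tight : #|edg setT| + 10 <= 4 * #|V|.

(** Any surplus in [U] would persist while [U] grows to the full vertex set. If the star of a vertex
    of [U] outside [F] meets [U] in at most three points, that vertex has degree at most 2 in [U]
    and can be deleted. Inside [F], 3k - 6 is at most 4k - 10 once k >= 4. *)
Lemma sparse U : 4 <= #|U| -> #|edg U| + 10 <= 4 * #|U|.
Proof.
have [m] := ubnP #|U|; elim: m U => // m IH U hm U4.
have [U4e|U5] := eqVneq #|U| 4; first by have := edges_sparse_small E2 U4e; lia.
have [UF|] := boolP (U \subset F); first by have := F_sub UF (ltnW U4); lia.
case/subsetPn => w wU wF.
have cI : #|cnb w :&: U| = #|U :&: nb w|.+1.
  have -> : cnb w :&: U = w |: (U :&: nb w).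
    by rewrite /cnb setIUl (setIidPl _) ?sub1set // setIC.
  by rewrite cardsU1 in_setI (negbTE (nb_irr E2 w)) andbF.
have [h4|h4] := leqP 4 #|cnb w :&: U|.
  by have := count_from wF h4; have := cardsC U; lia.
have := card_edg_del E2 wU; have cU := cardsD1 w U; rewrite wU in cU.
have := IH (U :\ w); lia.
Qed.

(** The link edges and spokes alone already reach the bound of [sparse]. *)
Lemma star_tight w : w \notin F -> #|edg (cnb w)| + 10 = 4 * #|cnb w|.
Proof.
move=> wF; have [w' _ h4] := cnb4 wF.
have h4' : 4 <= #|cnb w| by rewrite (leq_trans h4) // subset_leq_card ?subsetIl.
have := sparse h4'; have := card_star wF; have := subset_leq_card (star_sub wF).
have ccn : #|cnb w| = #|nb w|.+1 by rewrite cardsU1 (nb_irr E2).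
lia.
Qed.

(** The tight star leaves no room for further edges among the neighbours of [w]. For the links of
    the polytope this makes every 3-clique through [w] a face. *)
Lemma link_induced w : w \notin F -> edg (nb w) = lk w.
Proof.
move=> wF; apply/esym/eqP; rewrite eqEcard lk_edg //=.
have := star_tight wF; have := lk_card wF; rewrite (card_edg_del E2 (setU11 w _)).
have -> : cnb w :\ w = nb w by rewrite setU1K // nb_irr.
have -> : cnb w :&: nb w = nb w by apply/setIidPr/subsetUr.
have -> : #|cnb w| = #|nb w|.+1 by rewrite cardsU1 (nb_irr E2).
move=> h1 h2; have e : #|edg (nb w)| + 6 = 3 * #|nb w| by move: h2; lia.
by rewrite -(leq_add2r 6) h1 e.
Qed.

End StarCount.

(** * Connected sums *)

(** Preservation is asked for the first piece only, [cuts_into] being symmetric in the two. *)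
Lemma prime_decomposition_leaves (V : finType) m (P : {set {set V}} -> Prop) K L :
  (forall K A K1 K2, P K -> missing_face m K A -> cuts_into K A K1 K2 -> P K1) ->
  prime_decomposition m K L -> P K ->
  forall K0, K0 \in L -> P K0 /\ forall A, ~ missing_face m K0 A.
Proof.
move=> hcut; elim=> {K L} [K hK PK K0|K A K1 K2 L1 L2 hm hc _ IH1 _ IH2 PK K0].
  by rewrite in_set1 => /eqP->.
have hc' : cuts_into K A K2 K1.
  by case: hc => h1 h2 h3 h4 [h5 h6]; split => //; rewrite 1?setUC 1?setIC.
by case/setUP; [apply: IH1; apply: hcut hm hc|apply: IH2; apply: hcut hm hc'].
Qed.

Section Cuts.
Variables (V : finType) (E : {set {set V}}).
Hypothesis E2 : forall f, f \in E -> #|f| = 2.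
Implicit Types (A S U W Y f s : {set V}) (K D Ki Kj : {set {set V}}).
Local Notation nb := (nb E).
Local Notation edg := (edg E).
Local Notation clique := (clique E).

(* A node of the decomposition tree of a complex D with edge set E, cut along
   m-cliques: K is determined by its vertices up to the m-cliques inserted. *)
Definition node m D K :=
  [/\ forall f, f \in K -> f \in D \/ #|f| = m /\ clique f,
      forall f, f \in D -> f \subset vertex_set K -> f \in K &
      forall x, x \in vertex_set K -> [set x] \in D].

Definition no_cross S1 S2 :=
  forall x y, x \in S1 :\: S2 -> y \in S2 :\: S1 -> y \notin nb x.

Record cut_node m K A K1 K2 : Prop := CutNode {
  cut_clique : clique A;
  cut_card : #|A| = m;
  cut_new : A \notin K;
  cut_U : vertex_set K = vertex_set K1 :|: vertex_set K2;
  cut_I : vertex_set K1 :&: vertex_set K2 = A;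
  cut_n1 : ~~ (vertex_set K1 \subset A);
  cut_n2 : ~~ (vertex_set K2 \subset A);
  cut_cross : no_cross (vertex_set K1) (vertex_set K2);
  cut_mem1 : forall f, f \in K1 = (f == A) || (f \in K) && (f \subset vertex_set K1);
  cut_mem2 : forall f, f \in K2 = (f == A) || (f \in K) && (f \subset vertex_set K2);
  cut_side : forall f, f \in K -> f \subset vertex_set K1 \/ f \subset vertex_set K2 }.

Lemma sub_vertex_set K f : f \in K -> f \subset vertex_set K.
Proof. by move=> fK; apply: bigcup_sup. Qed.

Lemma vertex_setP K x : reflect (exists2 f, f \in K & x \in f) (x \in vertex_set K).
Proof. exact: bigcupP. Qed.

(** Every face lies in one of the pieces, so no edge joins a vertex private to one side with a
    vertex private to the other. A piece is then recovered as the faces inside its vertex set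
    together with [A]. The condition 2 < m keeps edges apart from the inserted m-cliques. *)
Lemma cuts_node m D K A K1 K2 : 2 < m ->
  (forall f, f \in E -> f \subset vertex_set K -> f \in D) ->
  (forall f, f \in D -> #|f| = 2 -> f \in E) ->
  node m D K -> missing_face m K A -> cuts_into K A K1 K2 ->
  cut_node m K A K1 K2 /\ node m D K1.
Proof.
move=> m2 ED DE [hK1 hK2 hK3] [cA nA hA] [[sK1 cl1] [sK2 cl2] eU eI [n1 n2]].
set W := vertex_set K.
have clA : clique A.
  apply/cliqueP => x y xA yA xy; rewrite nbE.
  have c2 : #|[set x; y]| = 2 by rewrite cards2 xy.
  have : [set x; y] \in K.
    apply: hA; rewrite properEcard subUset !sub1set xA yA /=.
    by rewrite cA c2.
  case/hK1 => [/DE->//|[e _]]; by rewrite -e c2 in m2.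
have sAW : A \subset W.
  apply/subsetP => x xA; have : [set x] \in K.
    by apply: hA; rewrite properEcard sub1set xA cA cards1 (ltn_trans _ m2).
  by move=> /sub_vertex_set/subsetP; apply; rewrite inE.
have AK12 : A \in K1 :&: K2 by rewrite eI powersetE.
have [AK1 AK2] := setIP AK12.
have in12 f : f \in A |: K -> f \in K1 \/ f \in K2 by rewrite -eU => /setUP.
have one x : x \in W -> [set x] \in A |: K.
  by move=> xW; rewrite in_setU1 hK2 ?orbT ?sub1set // hK3.
have subW Ki : Ki \subset A |: K -> vertex_set Ki \subset W.
  move=> sKi; apply/subsetP => x /vertex_setP[f /(subsetP sKi)].
  by case/setU1P => [->/(subsetP sAW)//|/sub_vertex_set/subsetP]; apply.
have single Ki x : subcomplex Ki (A |: K) -> (x \in vertex_set Ki) = ([set x] \in Ki).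
  case=> sKi cli; apply/idP/idP => [xKi|/sub_vertex_set]; last by rewrite sub1set.
  have xW := subsetP (subW _ sKi) x xKi.
  case/vertex_setP: xKi => f fKi xf.
  by apply: cli fKi (one _ xW) _; rewrite sub1set.
have h1 : subcomplex K1 (A |: K) by [].
have h2 : subcomplex K2 (A |: K) by [].
have cI : vertex_set K1 :&: vertex_set K2 = A.
  apply/setP => x; rewrite inE (single _ _ h1) (single _ _ h2) -in_setI eI.
  by rewrite powersetE sub1set.
have side f : f \in K -> f \subset vertex_set K1 \/ f \subset vertex_set K2.
  by move=> fK; case: (in12 f); rewrite ?setU1r //; [left|right]; apply: sub_vertex_set.
have mem Ki Kj f : subcomplex Ki (A |: K) -> A \in Ki ->
    vertex_set Ki :&: vertex_set Kj = A -> (forall f, f \in A |: K -> f \in Ki \/ f \in Kj) ->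
    f \in Ki = (f == A) || (f \in K) && (f \subset vertex_set Ki).
  move=> hi AKi eij hij; apply/idP/orP => [fKi|[/eqP->//|/andP[fK sf]]].
    have := subsetP hi.1 _ fKi; rewrite in_setU1 => /orP[->|fK]; first by left.
    by right; rewrite fK sub_vertex_set.
  case: (hij f) => [|//|fKj]; first by rewrite setU1r.
  apply: (hi.2 A) => //; rewrite ?setU1r // -eij subsetI sf.
  exact: sub_vertex_set.
have mem1 f : f \in K1 = (f == A) || (f \in K) && (f \subset vertex_set K1).
  exact: mem h1 AK1 cI in12.
have mem2 f : f \in K2 = (f == A) || (f \in K) && (f \subset vertex_set K2).
  by apply: (mem K2 K1) => //; [rewrite setIC|move=> f' /in12; tauto].
have uW : W = vertex_set K1 :|: vertex_set K2.
  apply/eqP; rewrite eqEsubset subUset !subW // !andbT.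
  by apply/subsetP => x /one/in12; rewrite -(single _ _ h1) -(single _ _ h2) inE => -[]->; rewrite ?orbT.
have nW Ki : subcomplex Ki (A |: K) -> A \in Ki -> (forall f, f \subset A -> f \in Ki) ->
    Ki != powerset A -> ~~ (vertex_set Ki \subset A).
  move=> hi AKi sA; apply: contra => sW; apply/eqP/setP => f; rewrite powersetE.
  by apply/idP/idP => [/sub_vertex_set/subset_trans|]; [apply|exact: sA].
have sA1 f : f \subset A -> f \in K1 by rewrite -powersetE -eI => /setIP[].
have sA2 f : f \subset A -> f \in K2 by rewrite -powersetE -eI => /setIP[].
split.
  split => //; try exact: nW.
  move=> x y /setDP[x1 x2] /setDP[y2 y1]; rewrite nbE; apply/negP => xy.
  have : [set x; y] \in K.
    have xyW : [set x; y] \subset W by rewrite uW subUset !sub1set !inE x1 y2 orbT.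
    by apply: hK2 => //; apply: ED.
  by case/side; rewrite subUset !sub1set ?(negbTE x2) ?(negbTE y1) ?andbF.
split=> [f|f fD fW|x x1].
- by rewrite mem1 => /orP[/eqP->|/andP[/hK1]]; [right|].
- by rewrite mem1 fW hK2 ?orbT // -/W (subset_trans fW) // uW subsetUl.
- by apply: hK3; rewrite -/W uW inE x1.
Qed.

(** [lv] and [lnk] are the vertices and edges of the link of [s]; the vertices are read off from the
    graph, the edges from the complex. *)
Definition lv W s := [set y in W | s \subset nb y].
Definition lnk K s := [set f : {set V} | [&& #|f| == 2, [disjoint f & s] & s :|: f \in K]].

(** If [s] has a vertex off [A], its link lies in the first piece and does not change. Otherwise [A]
    minus [s] is a pair at which the link cycle is cut, and the inserted [A] supplies the chord. *)
Lemma cyc_step m K A K1 K2 s : cut_node m K A K1 K2 -> #|s|.+2 = m ->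
  s \subset vertex_set K1 ->
  (s \subset A -> ~~ (lv (vertex_set K1) s \subset A) /\ ~~ (lv (vertex_set K2) s \subset A)) ->
  cyc (lv (vertex_set K) s) (lnk K s) -> cyc (lv (vertex_set K1) s) (lnk K1 s).
Proof.
move=> hc cs s1 hn; set W := vertex_set K; set W1 := vertex_set K1 in s1 hn *.
set W2 := vertex_set K2 in hn *.
have [sA|/subsetPn[x xs xA]] := boolP (s \subset A); last first.
  have -> : lv W1 s = lv W s.
    apply/setP => y; rewrite [LHS]inE [RHS]inE /W (cut_U hc) inE -/W1 -/W2.
    have [y1|y1] //= := boolP (y \in W1).
    have [y2|y2] //= := boolP (y \in W2).
    apply/esym/negbTE/negP => /subsetP/(_ x xs); rewrite nbC; apply/negP.
    apply: (cut_cross hc); rewrite inE -/W1 -/W2 ?y1 ?y2 // (subsetP s1) // andbT.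
    by apply: contra xA => x2; rewrite -(cut_I hc) inE -/W1 (subsetP s1).
  suff -> : lnk K1 s = lnk K s by [].
  apply/setP => f; rewrite [LHS]inE [RHS]inE (cut_mem1 hc); case: (_ == 2) => //=.
  case: [disjoint _ & _] => //=; rewrite (_ : (_ == A) = false) /=; last first.
    by apply: contraNF xA => /eqP<-; rewrite inE xs.
  case fK: (_ \in K) => //=; case: (cut_side hc fK) => [->//|].
  rewrite subUset => /andP[/subsetP/(_ x xs) x2 _].
  by case/negP: xA; rewrite -(cut_I hc) inE x2 (subsetP s1).
have [n1 n2] := hn sA => hcyc.
have cAs : #|A :\: s| = 2.
  by have := cardsID s A; rewrite (setIidPr sA) (cut_card hc); lia.
have /eqP/cards2P[x [z [xz eAs]]] := cAs.
have eA : A = s :|: [set x; z] by rewrite -[LHS](setID A s) (setIidPr sA) eAs.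
have eI : lv W1 s :&: lv W2 s = [set x; z].
  apply/setP => y; rewrite -eAs in_setI in_set [y \in lv W2 s]in_set in_setD.
  rewrite andbACA andbb -in_setI (cut_I hc).
  have [yA|] := boolP (y \in A); last by rewrite andbF.
  rewrite andbT /=; have [ys|ys] := boolP (y \in s).
    by apply/negbTE/negP => /subsetP/(_ y ys); rewrite (negbTE (nb_irr E2 y)).
  apply/subsetP => u us; apply: (cliqueP _ _ (cut_clique hc)) => //; first exact: (subsetP sA).
  by apply: contraNneq ys => ->.
have dlv U y : y \in lv U s -> y \notin s.
  rewrite inE => /andP[_ /subsetP h]; apply/negP => /h.
  by rewrite (negbTE (nb_irr E2 y)).
have lvA U : lv U s \subset [set x; z] -> lv U s \subset A.
  by move=> h; apply: subset_trans h _; rewrite eA subsetUr.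
have eU : lv W s = lv W1 s :|: lv W2 s.
  apply/setP => y; rewrite [LHS]inE in_setU [y \in lv W1 s]inE [y \in lv W2 s]inE.
  by rewrite /W (cut_U hc) inE andb_orl.
have hf f : f \in lnk K s -> f \subset lv W1 s \/ f \subset lv W2 s.
  move=> fl; have [_ /(_ f fl)[_ flv] _ _] := hcyc; move: fl; rewrite inE => /and3P[_ _ fK].
  have h U : f \subset U -> f \subset lv U s.
    move=> /subsetP fU; apply/subsetP => y yf; rewrite inE fU //=.
    by have := subsetP flv y yf; rewrite inE => /andP[].
  by case: (cut_side hc fK); rewrite subUset => /andP[_ /h]; [left|right].
have n1' : ~~ (lv W1 s \subset [set x; z]) by apply: contra n1 => /lvA.
have n2' : ~~ (lv W2 s \subset [set x; z]) by apply: contra n2 => /lvA.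
have := cyc_cut hcyc xz eU eI n1' n2' hf.
suff -> : lnk K1 s = [set x; z] |: [set f in lnk K s | f \subset lv W1 s] by [].
have dxz : [disjoint [set x; z] & s].
  by rewrite -eAs -setI_eq0 setIDAC setDIl setDv setI0.
apply/setP => f; rewrite [LHS]inE in_setU1 [X in _ || X]in_set (cut_mem1 hc).
have [->|nf] := eqVneq f [set x; z]; first by rewrite cards2 xz dxz -eA eqxx.
rewrite /= [f \in lnk K s]in_set; have [f2|] //= := boolP (#|f| == 2).
have [fs|] //= := boolP [disjoint f & s].
rewrite (_ : (_ == A) = false) /=; last first.
  apply: contraNF nf => /eqP e; rewrite -eAs -e setDUl setDv set0U; apply/eqP/esym.
  by apply/setDidPl.
have [fK|] //= := boolP (_ \in K).
have fl : f \in lnk K s by rewrite inE f2 fs.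
rewrite subUset s1 /=; apply/idP/idP => [f1|/subset_trans->//].
  have [_ /(_ f fl)[_ /subsetP flv] _ _] := hcyc.
  apply/subsetP => y yf; rewrite inE (subsetP f1) //=.
  by have := flv y yf; rewrite inE => /andP[].
by apply/subsetP => y; rewrite inE => /andP[].
Qed.

(** As m * m = a + b, the bounds for the two sides add up to exactly the number of edges available,
    so both are attained. The instances are 9 = 3 + 6 and 16 = 6 + 10. *)
Lemma tight_cut m a b S1 S2 : m * m = a + b -> no_cross S1 S2 ->
  #|S1 :&: S2| = m -> #|edg (S1 :&: S2)| = a ->
  #|edg S1| + b <= m * #|S1| -> #|edg S2| + b <= m * #|S2| ->
  #|edg (S1 :|: S2)| + b = m * #|S1 :|: S2| -> #|edg S1| + b = m * #|S1|.
Proof.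
move=> emm nc cI eI h1 h2; have := card_edg_cut E2 nc; rewrite eI => h3.
have := cardsUI S1 S2; rewrite cI => h4 h5.
have : m * #|S1 :|: S2| + m * m = m * #|S1| + m * #|S2| by rewrite -!mulnDr h4.
lia.
Qed.

(** If [v] had smaller degree, deleting it would leave a set with too many edges. *)
Lemma tight_degree m b S v : v \in S -> #|edg S| + b = m * #|S| ->
  #|edg (S :\ v)| + b <= m * #|S :\ v| -> m <= #|S :&: nb v|.
Proof.
move=> vS; rewrite (card_edg_del E2 vS) (cardsD1 v S) vS mulnDr muln1.
lia.
Qed.

End Cuts.

(** * The prime factors of the facet *)

Section Tree3.
Variables (V : finType) (E : {set {set V}}) (F : {set V}) (KF : {set {set V}}).
Hypothesis E2 : forall f, f \in E -> #|f| = 2.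
Implicit Types (A S U W Y f s T : {set V}) (K D Ki Kj L : {set {set V}}).
Local Notation nb := (nb E).
Local Notation edg := (edg E).
Local Notation clique := (clique E).
Hypothesis F_sub : forall U, U \subset F -> 3 <= #|U| -> #|edg U| + 6 <= 3 * #|U|.
Hypothesis KF_face : forall f, f \in KF -> [/\ f \subset F, clique f & #|f| <= 3].
Hypothesis KF0 : finset.set0 \in KF.
Hypothesis KF1 : forall x, x \in F -> [set x] \in KF.
Hypothesis KF2 : forall f, f \in E -> f \subset F -> f \in KF.

(** The edge count is that of a maximal planar graph; it is carried along because it forces the
    degrees that [cyc_step] asks for. *)
Definition node3 K :=
  [/\ node E 3 KF K, vertex_set K \subset F, 4 <= #|vertex_set K|,
      #|edg (vertex_set K)| + 6 = 3 * #|vertex_set K| &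
      forall x, x \in vertex_set K -> cyc (lv E (vertex_set K) [set x]) (lnk K [set x])].

Lemma clique_pair f : clique f -> #|f| = 2 -> f \in E.
Proof.
move=> /cliqueP h /eqP/cards2P[x [y [xy e]]].
by rewrite e -nbE h // e ?set21 ?set22.
Qed.

Lemma KF_edge f : f \in KF -> #|f| = 2 -> f \in E.
Proof. by case/KF_face => _ cf _ c2; exact: clique_pair. Qed.

Lemma lv1 U x : lv E U [set x] = U :&: nb x.
Proof. by apply/setP => y; rewrite [LHS]inE [RHS]inE sub1set nbC. Qed.

Lemma node3_cut K A K1 K2 : node3 K -> missing_face 3 K A -> cuts_into K A K1 K2 ->
  cut_node E 3 K A K1 K2 /\ node3 K1.
Proof.
move=> [hN sWF W4 tW hL] hm hcut.
have [|f fE fW||hc hN1] := cuts_node (E := E) (D := KF) _ _ _ hN hm hcut => //.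
- by apply: KF2 => //; apply: subset_trans sWF.
- exact: KF_edge.
split => //; have [cA1 cA2] : A \subset vertex_set K1 /\ A \subset vertex_set K2.
  by rewrite -(cut_I hc) subsetIl subsetIr.
have s1 : vertex_set K1 \subset F by apply: subset_trans sWF; rewrite (cut_U hc) subsetUl.
have s2 : vertex_set K2 \subset F by apply: subset_trans sWF; rewrite (cut_U hc) subsetUr.
have big U : A \subset U -> ~~ (U \subset A) -> 4 <= #|U|.
  by move=> sAU nUA; rewrite -(cut_card hc) proper_card // properE sAU.
have b1 := big _ cA1 (cut_n1 hc); have b2 := big _ cA2 (cut_n2 hc).
have eA : #|edg A| = 3 by rewrite (card_edg_clique E2 (cut_clique hc)) (cut_card hc).
have cr := cut_cross hc.
have cr' : no_cross E (vertex_set K2) (vertex_set K1).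
  by move=> x y x2 y1; rewrite nbC; apply: cr.
have sp1 := F_sub s1 (ltnW b1); have sp2 := F_sub s2 (ltnW b2).
have t1 : #|edg (vertex_set K1)| + 6 = 3 * #|vertex_set K1|.
  apply: (tight_cut E2 (a := 3) _ cr _ _ sp1 sp2) => //.
  - by rewrite (cut_I hc) (cut_card hc).
  - by rewrite (cut_I hc).
  - by rewrite -(cut_U hc).
have t2 : #|edg (vertex_set K2)| + 6 = 3 * #|vertex_set K2|.
  apply: (tight_cut E2 (a := 3) _ cr' _ _ sp2 sp1) => //.
  - by rewrite setIC (cut_I hc) (cut_card hc).
  - by rewrite setIC (cut_I hc).
  - by rewrite setUC -(cut_U hc).
split => // x x1.
have xW : x \in vertex_set K by rewrite (cut_U hc) inE x1.
apply: (cyc_step E2 hc) (hL x xW) => //; [by rewrite cards1|by rewrite sub1set|].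
rewrite sub1set => xA.
(* Tightness gives [x] at least three neighbours in [U], while [A] offers only two. *)
have deg U : A \subset U -> U \subset F -> 4 <= #|U| -> #|edg U| + 6 = 3 * #|U| ->
    ~~ (lv E U [set x] \subset A).
  move=> sAU sUF U4 tU; rewrite lv1; apply/negP => sA.
  have xU := subsetP sAU x xA.
  have cU := cardsD1 x U; rewrite xU add1n in cU.
  have sUx : U :\ x \subset F by apply: subset_trans (subsetDl _ _) sUF.
  have c3 : 3 <= #|U :\ x| by rewrite -ltnS -cU.
  have := tight_degree E2 xU tU (F_sub sUx c3).
  have sA' : U :&: nb x \subset A :\ x.
    by rewrite subsetD1 sA inE (negbTE (nb_irr E2 x)) andbF.
  have cA : #|A :\ x| = 2 by have := cardsD1 x A; rewrite xA (cut_card hc) add1n => -[<-].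
  by move=> h; have := leq_trans h (subset_leq_card sA'); rewrite cA.
by split; apply: deg.
Qed.

Lemma missing3 K f : node3 K -> f \subset vertex_set K -> clique f -> #|f| = 3 ->
  f \notin K -> missing_face 3 K f.
Proof.
move=> [[_ hN _] sWF _ _ _] fW cf f3 fK; split => // B pB.
have sB := proper_sub pB; have := proper_card pB; rewrite f3 => cB.
have BW : B \subset vertex_set K := subset_trans sB fW.
apply: hN => //; have [|[|]] : #|B| = 0 \/ #|B| = 1 \/ #|B| = 2 by lia.
- by move/cards0_eq->.
- move=> /eqP/cards1P[x eB]; rewrite eB; apply: KF1.
  by apply: (subsetP (subset_trans BW sWF)); rewrite eB set11.
- move=> B2; apply: KF2; last exact: subset_trans sWF.
  by apply: clique_pair => //; apply: cliqueS cf.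
Qed.

(** A 3-clique that is not a face would be a missing face, as all its proper subsets are faces. So a
    prime factor is determined by its vertex set. *)
Lemma leaf3P K : node3 K -> (forall A, ~ missing_face 3 K A) -> forall f,
  (f \in K) = [&& f \subset vertex_set K, clique f & #|f| <= 3].
Proof.
move=> nK pK f; have [[hN1 hN2 hN3] sWF W4 _ _] := nK.
apply/idP/and3P => [fK|[fW cf f3]].
  split; first exact: sub_vertex_set.
  - by case/hN1: fK => [/KF_face[]|[]].
  - by case/hN1: fK => [/KF_face[]|[-> _]].
have [e|ne] := eqVneq #|f| 3.
  by apply: contraT => fK; case: (pK f); apply: missing3.
apply: hN2 => //; have [|[|]] : #|f| = 0 \/ #|f| = 1 \/ #|f| = 2 by lia.
- by move/cards0_eq->.
- move=> /eqP/cards1P[x eB]; rewrite eB; apply: KF1.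
  by apply: (subsetP (subset_trans fW sWF)); rewrite eB set11.
- by move=> B2; apply: KF2; [apply: clique_pair|apply: subset_trans sWF].
Qed.

(** [A] need only contain the intersection: the parts of [Y] on the two sides of a cut may share
    just some of the vertices of [A]. *)
Definition unseparated Y := forall A Y1 Y2, clique A -> #|A| = 3 ->
  Y = Y1 :|: Y2 -> Y1 :&: Y2 \subset A -> no_cross E Y1 Y2 -> Y = Y1 \/ Y = Y2.

Lemma unseparated_leaf K LF Y : prime_decomposition 3 K LF -> node3 K ->
  Y \subset vertex_set K -> unseparated Y ->
  exists2 K0, K0 \in LF & Y \subset vertex_set K0.
Proof.
elim=> {K LF} [K hK nK sY uY|K A K1 K2 L1 L2 hm hc _ IH1 _ IH2 nK sY uY].
  by exists K; rewrite ?set11.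
have [cd n1] := node3_cut nK hm hc.
have hc' : cuts_into K A K2 K1.
  by case: hc => h1 h2 h3 h4 [h5 h6]; split => //; rewrite 1?setUC 1?setIC.
have [cd' n2] := node3_cut nK hm hc'.
have [|||e|e] := uY A (Y :&: vertex_set K1) (Y :&: vertex_set K2) (cut_clique cd) (cut_card cd).
- by rewrite -setIUr -(cut_U cd) (setIidPl sY).
- by rewrite -(cut_I cd) setISS // subsetIr.
- move=> x y; rewrite !in_setD !in_setI => /and3P[nx xY x1] /and3P[ny yY y2].
  rewrite xY in nx; rewrite yY in ny.
  by apply: (cut_cross cd); rewrite inE ?x1 ?y2 ?andbT.
- have [K0 K0L sK0] := IH1 n1 (introT setIidPl (esym e)) uY.
  by exists K0 => //; rewrite inE K0L.
- have [K0 K0L sK0] := IH2 n2 (introT setIidPl (esym e)) uY.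
  by exists K0 => //; rewrite inE K0L orbT.
Qed.

Lemma clique_unseparated Y : clique Y -> unseparated Y.
Proof.
move=> /cliqueP cY A Y1 Y2 _ _ eY _ nc.
have [e|/subsetPn[x x1 x2]] := boolP (Y1 \subset Y2).
  by right; rewrite eY (setUidPr e).
have [e|/subsetPn[y y2 y1]] := boolP (Y2 \subset Y1).
  by left; rewrite eY (setUidPl e).
have := nc x y; rewrite !inE x1 x2 y1 y2 => /(_ isT isT) /negP[].
rewrite -nbE; apply: cY; rewrite ?eY ?inE ?x1 ?y2 ?orbT //.
by apply: contraNneq x2 => ->.
Qed.

(** At each vertex of [Y] the given cycle consists of edges of the link cycle in [K], hence fills
    it, so no edge of the factor leaves [Y]. The remaining vertices, with fewer than three edges
    each on average, could not bring the total up to 3k - 6. Used for the base of a pyramid, for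
    another cell and for a 4-clique. *)
Lemma full_in_leaf K Y (H : V -> {set {set V}}) :
  node3 K -> (forall A, ~ missing_face 3 K A) ->
  Y \subset vertex_set K -> Y != finset.set0 ->
  (forall x, x \in Y -> cyc (lv E Y [set x]) (H x)) ->
  (forall x f, x \in Y -> f \in H x -> clique (x |: f)) ->
  Y = vertex_set K.
Proof.
move=> nK pK sY Y0 hc hcl; set W := vertex_set K in sY *.
have [[hN1 hN2 hN3] sWF W4 tW hL] := nK.
have nbY x : x \in Y -> Y :&: nb x = W :&: nb x.
  move=> xY; rewrite -!lv1.
  have [_ l2 ldeg lcl] := hL x (subsetP sY _ xY).
  have [S0 c2 cdeg _] := hc x xY.
  apply: lcl => //; first by rewrite !lv1 setSI.
  have HL f : f \in H x -> f \in lnk K [set x].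
    move=> fH; have [f2 fl] := c2 f fH.
    rewrite inE f2 eqxx leaf3P // hcl //=.
    have xf : x \notin f.
      by apply/negP => /(subsetP fl); rewrite lv1 inE (negbTE (nb_irr E2 x)) andbF.
    rewrite -setI_eq0 setIC; apply/and3P; split.
    - by apply/eqP/setP => y; rewrite !inE; case: eqP => [->|//]; rewrite (negbTE xf).
    - rewrite subUset sub1set (subsetP sY) //=; apply: subset_trans fl _.
      by rewrite lv1; apply: subset_trans (subsetIl _ _) sY.
    - by rewrite cardsU1 xf f2.
  move=> f fL /set0Pn[y /setIP[yf yS]].
  suff fH : f \in H x by case: (c2 f fH).
  have eH : [set f in H x | y \in f] = [set f in lnk K [set x] | y \in f].
    apply/eqP; rewrite eqEcard cdeg // ldeg; last first.
      by move: yS; rewrite !lv1; apply/subsetP/setSI.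
    rewrite andbT; apply/subsetP => f'; rewrite inE => /andP[/HL fl yf'].
    by rewrite inE fl.
  have : f \in [set f in H x | y \in f] by rewrite eH inE fL.
  by rewrite inE => /andP[].
apply/eqP; rewrite eqEsubset sY -setD_eq0; apply: contraT => Z0.
set Z := W :\: Y in Z0 *.
have nc : no_cross E Y Z.
  move=> x y /setDP[xY _] /setDP[yZ yY]; apply: contra yY => yx.
  have : y \in W :&: nb x by rewrite inE yx andbT; move: yZ; rewrite inE => /andP[].
  by rewrite -nbY // inE => /andP[].
have eW : Y :|: Z = W by rewrite /Z -{2}(setID W Y) (setIidPr sY).
have := card_edg_cut E2 nc; rewrite eW.
have -> : Y :&: Z = finset.set0 by rewrite /Z setIDA setIC setDIl setDv setI0.
have cW : #|W| = #|Y| + #|Z| by rewrite -(cardsID Y W) (setIidPr sY).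
have Y3 : 3 <= #|Y|.
  have [x xY] := set0Pn _ Y0; have [S0 c2 _ _] := hc x xY.
  have : 0 < #|H x| by rewrite (cyc_card (hc x xY)) card_gt0.
  case/card_gt0P => f /c2[f2 fl].
  have : x |: f \subset Y.
    by rewrite subUset sub1set xY; apply: subset_trans fl _; rewrite lv1 subsetIl.
  move/subset_leq_card; apply: leq_trans; rewrite cardsU1 f2.
  suff -> : x \notin f by [].
  by apply/negP => /(subsetP fl); rewrite lv1 inE (negbTE (nb_irr E2 x)) andbF.
have e1 := F_sub (subset_trans sY sWF) Y3.
have e2 : #|edg Z| < 3 * #|Z|.
  have [Z3|Z3] := leqP 3 #|Z|.
    apply: leq_trans (F_sub (subset_trans (subsetDl _ _) sWF) Z3).
    by rewrite addnS ltnS leq_addr.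
  have := card_edg_sub E2 Z; have : 0 < #|Z| by rewrite card_gt0.
  by move: Z3; case: #|Z| => [|[|[|]]] // _ _ h; apply: leq_ltn_trans h _.
move=> h; have tW' : #|edg W| + 6 = 3 * #|W| := tW.
lia.
Qed.

Hypothesis KF_lnk : forall x, x \in F -> cyc (lv E F [set x]) (lnk KF [set x]).
Hypothesis F4 : 4 <= #|F|.
Hypothesis F_tight : #|edg F| + 6 = 3 * #|F|.

Lemma node3_root : node3 KF.
Proof.
have eF : vertex_set KF = F.
  apply/setP => x; apply/vertex_setP/idP => [[f /KF_face[/subsetP h _ _] /h//]|xF].
  by exists [set x]; rewrite ?KF1 ?set11.
split; rewrite ?eF //; split=> // [f fK|x]; first by left.
by rewrite eF; exact: KF1.
Qed.

Lemma leaves3 LF K : prime_decomposition 3 KF LF -> K \in LF ->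
  node3 K /\ forall A, ~ missing_face 3 K A.
Proof.
move=> hLF; apply: (prime_decomposition_leaves (P := node3)) hLF node3_root K => //.
by move=> K' A K1 K2 h1 h2 h3; case: (node3_cut h1 h2 h3).
Qed.

(** A clique is never separated by a cut, so it reaches a prime factor, where all cliques of at most
    three vertices are faces. *)
Lemma clique_in_leaf LF T : prime_decomposition 3 KF LF -> T \subset F -> clique T ->
  #|T| <= 3 -> exists2 K0, K0 \in LF & T \in K0.
Proof.
move=> hLF sT cT cT3.
have eF : vertex_set KF = F.
  by have [_ s _ _ _] := node3_root; apply/eqP; rewrite eqEsubset s; apply/subsetP => x xF;
     apply/vertex_setP; exists [set x]; rewrite ?KF1 ?set11.
have [|K0 K0L sT0] := unseparated_leaf hLF node3_root _ (clique_unseparated cT).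
  by rewrite eF.
have [n0 p0] := leaves3 hLF K0L.
by exists K0; rewrite // leaf3P // sT0 cT.
Qed.

End Tree3.

(** * The invariants of the prime decomposition of the refined sphere *)

Section Tree4.
Variables (V : finType) (E : {set {set V}}) (F : {set V}) (D : {set {set V}}).
Hypothesis E2 : forall f, f \in E -> #|f| = 2.
Implicit Types (A B S U W X Y f s T : {set V}) (K Ki Kj : {set {set V}}).
Local Notation nb := (nb E).
Local Notation cnb := (cnb E).
Local Notation edg := (edg E).
Local Notation clique := (clique E).
Hypothesis F_sub : forall U, U \subset F -> 3 <= #|U| -> #|edg U| + 6 <= 3 * #|U|.
Hypothesis sparse4 : forall U, 4 <= #|U| -> #|edg U| + 10 <= 4 * #|U|.
Hypothesis V5 : 5 <= #|V|.
Hypothesis V_tight : #|edg setT| + 10 = 4 * #|V|.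
Hypothesis nF : F != setT.
Hypothesis conn : forall S, S \subset ~: F -> S != finset.set0 ->
  (forall x, x \in S -> nb x :\: F \subset S) -> S = ~: F.
Hypothesis st_tight : forall u, u \notin F -> #|edg (cnb u)| + 10 = 4 * #|cnb u|.
Hypothesis D_small : forall f, clique f -> #|f| <= 3 -> f \in D.
Hypothesis D_edge : forall f, f \in D -> #|f| = 2 -> f \in E.
Hypothesis D_lnk : forall u v, u \notin F -> v \in nb u ->
  cyc (lv E setT [set u; v]) (lnk D [set u; v]).

(** Tightness of the closed stars is recorded besides that of the piece because the degrees inside a
    star keep edge links nondegenerate. Connectivity outside [F] will produce two adjacent vertices
    there. *)
Definition node4 K :=
  let W := vertex_set K in
  [/\ node E 4 D K, 5 <= #|W|, #|edg W| + 10 = 4 * #|W|,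
      forall u, u \in W -> u \notin F ->
        #|edg (W :&: cnb u)| + 10 = 4 * #|W :&: cnb u| /\
        forall v, v \in W -> v \in nb u ->
          cyc (lv E W [set u; v]) (lnk K [set u; v]) &
      W :\: F != finset.set0 /\ forall S, S \subset W :\: F -> S != finset.set0 ->
        (forall x, x \in S -> nb x :&: (W :\: F) \subset S) -> S = W :\: F].

Lemma clique_edge f : f \in E -> clique f.
Proof.
move=> fE; have /eqP/cards2P[x [y [xy e]]] := E2 fE.
apply/cliqueP => a b; rewrite e !in_set2 => /orP[]/eqP-> /orP[]/eqP->; rewrite ?eqxx //.
  by move=> _; rewrite nbE -e.
by move=> _; rewrite nbE setUC -e.
Qed.

Lemma clique1 x : clique [set x].
Proof. by apply/cliqueP => a b /set1P-> /set1P->; rewrite eqxx. Qed.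

Lemma cover_full : vertex_set D = setT.
Proof.
apply/setP => x; rewrite inE; apply/vertex_setP; exists [set x]; rewrite ?set11 //.
by apply: D_small; rewrite ?clique1 // cards1.
Qed.

Lemma node4_root : node4 D.
Proof.
rewrite /node4 cover_full; split; rewrite ?cardsT //.
- split=> [f fD|f fD _|x _]; [by left|by []|].
  by apply: D_small; rewrite ?clique1 // cards1.
- by move=> u _ uF; rewrite setTI; split; [exact: st_tight|move=> v _; exact: D_lnk].
- rewrite setTD; split; first by rewrite -setCT (inj_eq (@setC_inj V)).
  move=> S sS S0 hS; apply: conn => // x xS; by rewrite setDE hS.
Qed.

Lemma cut_node_sym m K A K1 K2 : cut_node E m K A K1 K2 -> cut_node E m K A K2 K1.
Proof.
case=> h1 h2 h3 h4 h5 h6 h7 h8 h9 h10 h11; split=> //.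
- by rewrite setUC.
- by rewrite setIC.
- by move=> x y x2 y1; rewrite nbC; apply: h8.
- by move=> f /h11; tauto.
Qed.

Lemma cnbE U u : u \in U -> U :&: cnb u = u |: (U :&: nb u).
Proof. by move=> uU; rewrite cnbU setIUr (setIidPr _) ?sub1set. Qed.

Lemma side_tight K A K1 K2 : node4 K -> cut_node E 4 K A K1 K2 ->
  let W1 := vertex_set K1 in
  [/\ 5 <= #|W1|, #|edg W1| + 10 = 4 * #|W1|, A \subset W1 &
     forall u, u \in W1 -> u \notin F ->
       #|edg (W1 :&: cnb u)| + 10 = 4 * #|W1 :&: cnb u|].
Proof.
move=> [hN W5 tW hL _] hc W1; set W2 := vertex_set K2.
have [cA1 cA2] : A \subset W1 /\ A \subset W2 by rewrite -(cut_I hc) subsetIl subsetIr.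
have big U : A \subset U -> ~~ (U \subset A) -> 5 <= #|U|.
  by move=> sAU nUA; rewrite -(cut_card hc) proper_card // properE sAU.
have b1 := big _ cA1 (cut_n1 hc); have b2 := big _ cA2 (cut_n2 hc).
have eA : #|edg A| = 6 by rewrite (card_edg_clique E2 (cut_clique hc)) (cut_card hc).
have cr : no_cross E W1 W2 := cut_cross hc.
have eI : W1 :&: W2 = A := cut_I hc.
have eU : vertex_set K = W1 :|: W2 := cut_U hc.
split => //.
  apply: (tight_cut E2 (a := 6) _ cr _ _ (sparse4 (ltnW b1)) (sparse4 (ltnW b2))) => //;
    by rewrite ?eI ?(cut_card hc) // -eU.
move=> u u1 uF; have uW : u \in vertex_set K by rewrite eU inE u1.
have [tN _] := hL u uW uF; have [uA|uA] := boolP (u \in A); last first.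
  suff -> : W1 :&: cnb u = vertex_set K :&: cnb u by [].
  rewrite eU setIUl; apply/esym/setUidPl/subsetP => y /setIP[y2 yu].
  rewrite inE yu andbT; apply: contraT => y1; move: yu.
  have u2 : u \notin W2 by apply: contra uA => u2; rewrite -eI inE u1.
  have yN : y \notin nb u by apply: cr; rewrite inE ?u1 ?u2 ?y1.
  by rewrite in_setU1 (negbTE yN) orbF => /eqP e; rewrite -e y2 in u2.
have sAc : A \subset cnb u.
  apply/subsetP => y yA; rewrite in_setU1; have [//|ne] := eqVneq y u.
  by apply: (cliqueP _ _ (cut_clique hc)); rewrite // eq_sym.
have eI' : (W1 :&: cnb u) :&: (W2 :&: cnb u) = A by rewrite -setIIl eI (setIidPl sAc).
have c4 U : A \subset U -> 4 <= #|U :&: cnb u|.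
  by move=> sAU; rewrite -(cut_card hc) subset_leq_card // subsetI sAU.
apply: (tight_cut E2 (a := 6) _ _ _ _ (sparse4 (c4 _ cA1)) (sparse4 (c4 _ cA2))) => //.
- move=> x y; rewrite !inE => /andP[nx /andP[x1 xu]] /andP[ny /andP[y2 yu]].
  rewrite xu andbT in nx; rewrite yu andbT in ny.
  by rewrite -nbE; apply: cr; rewrite inE ?x1 ?y2 ?nx ?ny.
- by rewrite eI' (cut_card hc).
- by rewrite eI'.
- by rewrite -setIUl -eU.
Qed.

(** If the link of uv stayed in [A], [v] would have at most three neighbours in the closed star of
    [u]. Tightness demands four, unless that star is [A] itself; but then [u] has too few neighbours
    in the tight piece. *)
Lemma side_nondegenerate K A K1 K2 u v : node4 K -> cut_node E 4 K A K1 K2 ->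
  u \in A -> v \in A -> u != v -> u \notin F ->
  ~~ (lv E (vertex_set K1) [set u; v] \subset A).
Proof.
move=> nK hc uA vA uv uF; have [W5 tW sAW hN] := side_tight nK hc.
set W1 := vertex_set K1 in W5 tW sAW hN *.
have u1 := subsetP sAW _ uA; have v1 := subsetP sAW _ vA.
have vu : v \in nb u by apply: (cliqueP _ _ (cut_clique hc)).
have tN := hN u u1 uF; set N := W1 :&: cnb u in tN.
have cDA x : x \in A -> #|A :\ x| = 3.
  by move=> xA; have := cardsD1 x A; rewrite xA (cut_card hc) add1n => -[<-].
have vN : v \in N by rewrite inE v1 setU1r.
apply/negP => sA.
have sNv : N :&: nb v \subset A :\ v.
  apply/subsetP => y /setIP[/setIP[y1 /setU1P yu] yv].
  rewrite inE inE eq_sym (nb_neq E2 yv) /=.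
  case: yu => [->//|yu]; apply: (subsetP sA).
  by rewrite inE y1 subUset !sub1set (nbC _ y u) (nbC _ y v) yu.
have cN := cardsD1 v N; rewrite vN add1n in cN.
have sAN : A \subset N.
  apply/subsetP => y yA; rewrite inE (subsetP sAW) //= in_setU1.
  by have [//|ne] := eqVneq y u; apply: (cliqueP _ _ (cut_clique hc)); rewrite // eq_sym.
have [N4|N4] := leqP 4 #|N :\ v|.
  have := tight_degree E2 vN tN (sparse4 N4).
  by move/leq_trans => /(_ _ (subset_leq_card sNv)); rewrite cDA.
have eN : A = N.
  by apply/eqP; rewrite eqEcard sAN (cut_card hc) cN.
have cW := cardsD1 u W1; rewrite u1 add1n in cW.
have W4 : 4 <= #|W1 :\ u| by rewrite -ltnS -cW.
have := tight_degree E2 u1 tW (sparse4 W4).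
have sW : W1 :&: nb u \subset A :\ u.
  rewrite subsetD1 eN inE (negbTE (nb_irr E2 u)) andbF andbT.
  by rewrite /N setIS // subsetUr.
by move/leq_trans => /(_ _ (subset_leq_card sW)); rewrite cDA.
Qed.

Lemma node4_cut K A K1 K2 : node4 K -> missing_face 4 K A -> cuts_into K A K1 K2 ->
  node4 K1.
Proof.
move=> nK hm hcut; have [hN W5 tW hL [cW0 cW]] := nK.
have [|f fE fW||hc hN1] := cuts_node (E := E) (D := D) _ _ _ hN hm hcut => //.
  by apply: D_small; [exact: clique_edge|rewrite (E2 fE)].
have [W15 tW1 cA1 tN1] := side_tight nK hc.
have [W25 tW2 cA2 tN2] := side_tight nK (cut_node_sym hc).
have sW1 : vertex_set K1 \subset vertex_set K by rewrite (cut_U hc) subsetUl.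
split => // [u u1 uF|].
  split=> [|v v1 vu]; first exact: tN1.
  have uW := subsetP sW1 _ u1; have vW := subsetP sW1 _ v1.
  have uv := nb_neq E2 vu.
  have [_ /(_ v vW vu)] := hL u uW uF.
  apply: (cyc_step E2 hc); first by rewrite cards2 uv.
    by rewrite subUset !sub1set u1.
  rewrite subUset !sub1set => /andP[uA vA].
  split; [exact: (side_nondegenerate nK hc)|exact: (side_nondegenerate nK (cut_node_sym hc))].
(* Inside [F] the bound 3k - 6 would contradict the count 4k - 10 for k >= 5. *)
have out Ki : 5 <= #|vertex_set Ki| -> #|edg (vertex_set Ki)| + 10 = 4 * #|vertex_set Ki| ->
    vertex_set Ki :\: F != finset.set0.
  move=> c5 t; rewrite setD_eq0; apply/negP => sF.
  have := F_sub sF (ltnW (ltnW c5)); move: t c5.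
  by move: #|edg _| #|vertex_set _| => a b; lia.
split; first exact: out.
have o2 := out _ W25 tW2; have eI := cut_I hc; have eU := cut_U hc.
move: cW; rewrite eU; move: eI (cut_cross hc) o2.
set W1 := vertex_set K1; set W2 := vertex_set K2 => eI cr o2 cW.
move=> S sS S0 clS.
have sS1 x : x \in S -> x \in W1 /\ x \notin F by move/(subsetP sS); rewrite inE => /andP[].
(* A closed set missing [A] is closed in the undivided piece, hence would contain the vertices of
   the second side outside [F]. One that meets [A] contains all of [A] outside [F], the latter being
   a clique, and is closed in the undivided piece once the second side is added. *)
have [e0|[a /setIP[aS aA]]] := set_0Vmem (S :&: A).
  have eS : S = (W1 :|: W2) :\: F.
    apply: cW => //; first by rewrite (subset_trans sS) // setSD // subsetUl.
    move=> x xS; apply/subsetP => y /setIP[yx /setDP[yW yF]].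
    apply: (subsetP (clS x xS)); rewrite in_setI yx in_setD yF /=.
    have [x1 xF] := sS1 x xS; apply: contraT => y1.
    have y2 : y \in W2 by move: yW; rewrite inE (negbTE y1).
    have xA : x \notin A by apply/negP => xA; have := in_set0 x; rewrite -e0 inE xS xA.
    have x2 : x \notin W2 by apply: contra xA => x2; rewrite -eI inE x1.
    suff : y \notin nb x by rewrite yx.
    by apply: cr; rewrite in_setD ?x1 ?x2 ?y1 ?y2.
  case/set0Pn: o2 => y /setDP[y2 yF].
  have yS : y \in S by rewrite eS inE yF inE y2 orbT.
  have [y1 _] := sS1 y yS; have := in_set0 y; by rewrite -e0 inE yS -eI inE y1 y2.
have [a1 aF] := sS1 a aS.
have AS x : x \in A -> x \notin F -> x \in S.
  move=> xA xF; have [->//|ne] := eqVneq x a.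
  have x1 : x \in W1 by move: xA; rewrite -eI => /setIP[].
  apply: (subsetP (clS a aS)); rewrite in_setI in_setD xF x1 !andbT.
  by apply: (cliqueP _ _ (cut_clique hc)); rewrite // eq_sym.
have eSW : S :|: (W2 :\: F) = (W1 :|: W2) :\: F.
  apply: cW.
  - by rewrite subUset setSD ?subsetUr // andbT (subset_trans sS) // setSD // subsetUl.
  - by apply/set0Pn; exists a; rewrite inE aS.
  move=> x xS; apply/subsetP => y /setIP[yx /setDP[yW yF]].
  rewrite in_setU in_setD yF /=; have [y2|y2] := boolP (y \in W2); first by rewrite orbT.
  rewrite orbF; have y1 : y \in W1 by move: yW; rewrite inE (negbTE y2) orbF.
  have xS' : x \in S.
    case/setUP: xS => // /setDP[x2 xF]; apply: AS => //.
    rewrite -eI inE x2 andbT; apply: contraT => x1.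
    suff : x \notin nb y by rewrite nbC yx.
    by apply: cr; rewrite in_setD ?x1 ?x2 ?y1 ?y2.
  by apply: (subsetP (clS x xS')); rewrite in_setI yx in_setD yF.
apply/eqP; rewrite eqEsubset sS; apply/subsetP => x /setDP[x1 xF].
have : x \in S :|: (W2 :\: F) by rewrite eSW inE xF inE x1.
case/setUP => // /setDP[x2 _]; apply: AS => //; by rewrite -eI inE x1.
Qed.

Lemma leaves4 L K : prime_decomposition 4 D L -> K \in L ->
  node4 K /\ forall A, ~ missing_face 4 K A.
Proof.
move=> hL; apply: (prime_decomposition_leaves (P := node4)) hL node4_root K => //.
exact: node4_cut.
Qed.

End Tree4.

(** Each vertex of the triangle has both of its edges there, so the triangle is closed. *)
Lemma cyc_triangle (V : finType) (X S : {set V}) H : cyc X H -> S \subset X -> #|S| = 3 ->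
  (forall f : {set V}, f \subset S -> #|f| = 2 -> f \in H) -> S = X.
Proof.
case=> _ c2 deg cl sS cS hS; apply: cl => //; first by rewrite -card_gt0 cS.
move=> f fH /set0Pn[y /setIP[yf yS]].
suff : f \in [set [set y; z] | z in S :\ y].
  case/imsetP => z /setD1P[_ zS] ->; by rewrite subUset !sub1set yS.
have cSy : #|S :\ y| = 2 by have := cardsD1 y S; rewrite yS cS add1n => -[<-].
suff -> : [set [set y; z] | z in S :\ y] = [set f in H | y \in f] by rewrite inE fH.
apply/eqP; rewrite eqEcard deg ?(subsetP sS) // card_in_imset ?cSy ?andbT.
  apply/subsetP => _ /imsetP[z /setD1P[zy zS] ->]; rewrite inE set21 andbT.
  by apply: hS; rewrite ?subUset ?sub1set ?yS ?zS // cards2 eq_sym zy.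
move=> a b /setD1P[ay _] _ /setP/(_ a).
by rewrite !inE eqxx orbT (negbTE ay) /= => /esym/eqP.
Qed.

Lemma cyc_K3 (V : finType) (X : {set V}) : #|X| = 3 ->
  cyc X [set f : {set V} | (f \subset X) && (#|f| == 2)].
Proof.
move=> X3; have pairs x : x \in X ->
    [set f : {set V} in [set f : {set V} | (f \subset X) && (#|f| == 2)] | x \in f] =
    [set [set x; y] | y in X :\ x].
  move=> xX; apply/setP => f; rewrite in_set in_set; apply/idP/imsetP.
    case/andP => /andP[sf /cards2P[a [b [ab e]]]] xf; move: xf sf; rewrite e.
    rewrite in_set2 subUset !sub1set => /orP[]/eqP-> /andP[aX bX].
      by exists b; rewrite // in_setD1 (eq_sym b) ab.
    by exists a; rewrite ?in_setD1 ?ab // setUC.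
  case=> y /setD1P[yx yX] ->; rewrite subUset !sub1set xX yX set21 cards2 (eq_sym x) yx.
  by [].
have deg x : x \in X ->
    #|[set f : {set V} in [set f : {set V} | (f \subset X) && (#|f| == 2)] | x \in f]| = 2.
  move=> xX; rewrite pairs // card_in_imset.
    by have := cardsD1 x X; rewrite xX X3 add1n => -[<-].
  move=> a b /setD1P[ax _] _ /setP/(_ a).
  by rewrite !inE eqxx orbT (negbTE ax) /= => /esym/eqP.
split => //.
- by rewrite -card_gt0 X3.
- by move=> f; rewrite inE => /andP[sf /eqP].
move=> S sS /set0Pn[x xS] hS; apply/eqP; rewrite eqEsubset sS.
apply/subsetP => y yX; have [->//|yx] := eqVneq y x.
apply: (subsetP (hS [set x; y] _ _)); rewrite ?set22 //.
  by rewrite inE subUset !sub1set yX (subsetP sS) // cards2 (eq_sym x) yx.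
by apply/set0Pn; exists x; rewrite inE set21.
Qed.

(** * The two kinds of prime factors *)

Section Leaves.
Variables (V : finType) (E : {set {set V}}) (F : {set V}) (D KF : {set {set V}}).
Variable LF : {set {set {set V}}}.
Hypothesis E2 : forall f, f \in E -> #|f| = 2.
Implicit Types (A B S U W X Y f s T : {set V}) (K Ki Kj : {set {set V}}).
Local Notation nb := (nb E).
Local Notation cnb := (cnb E).
Local Notation edg := (edg E).
Local Notation clique := (clique E).
Hypothesis F_sub : forall U, U \subset F -> 3 <= #|U| -> #|edg U| + 6 <= 3 * #|U|.
Hypothesis KF_face : forall f, f \in KF -> [/\ f \subset F, clique f & #|f| <= 3].
Hypothesis KF0 : finset.set0 \in KF.
Hypothesis KF1 : forall x, x \in F -> [set x] \in KF.
Hypothesis KF2 : forall f, f \in E -> f \subset F -> f \in KF.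
Hypothesis KF_lnk : forall x, x \in F -> cyc (lv E F [set x]) (lnk KF [set x]).
Hypothesis F4 : 4 <= #|F|.
Hypothesis F_tight : #|edg F| + 6 = 3 * #|F|.
Hypothesis hLF : prime_decomposition 3 KF LF.
Hypothesis sparse4 : forall U, 4 <= #|U| -> #|edg U| + 10 <= 4 * #|U|.
Hypothesis D_small : forall f, clique f -> #|f| <= 3 -> f \in D.
Hypothesis D_out : forall f, f \in D -> ~~ (f \subset F) -> clique f /\ #|f| <= 4.
Hypothesis D_in : forall f, f \in D -> f \subset F ->
  f \in KF \/ exists2 K, K \in LF & f \in vertex_set K |: K.
Hypothesis D_cell : forall K, K \in LF -> vertex_set K \in D.

Variable K : {set {set V}}.
Hypothesis nK : node4 E F D K.
Hypothesis pK : forall A, ~ missing_face 4 K A.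
Let W := vertex_set K.

Lemma leaf4_clique f : f \subset W -> clique f -> #|f| <= 4 -> f \in K.
Proof.
move=> fW cf f4; have [[hN1 hN2 hN3] _ _ _ _] := nK.
have [e|ne] := eqVneq #|f| 4; last first.
  by apply: hN2 => //; apply: D_small => //; rewrite -ltnS ltn_neqAle ne.
apply: contraT => fK; case: (pK (A := f)); split => // B pB.
apply: hN2; last exact: subset_trans (proper_sub pB) fW.
apply: D_small; first exact: cliqueS (proper_sub pB) cf.
by rewrite -ltnS -e proper_card.
Qed.

Lemma leaf4_sub f : f \in K -> ~~ (f \subset F) -> [/\ f \subset W, clique f & #|f| <= 4].
Proof.
move=> fK nf; have [[hN1 _ _] _ _ _ _] := nK; split; first exact: sub_vertex_set.
  by case: (hN1 f fK) => [/D_out/(_ nf)[]|[]].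
by case: (hN1 f fK) => [/D_out/(_ nf)[]|[->]].
Qed.

Lemma leaf4_link u x f : u \in W -> x \in W -> f \subset W -> u != x ->
  clique (u |: (x |: f)) -> #|f| = 2 -> u \notin f -> x \notin f -> f \in lnk K [set u; x].
Proof.
move=> uW xW fW ux cl f2 uf xf; rewrite inE f2 eqxx -setUA leaf4_clique //.
- rewrite andbT -setI_eq0; apply/eqP/setP => y; rewrite in_setI in_set2 in_set0.
  apply/negbTE/negP => /andP[yf /orP[/eqP e|/eqP e]]; [move: uf|move: xf]; by rewrite -e yf.
- by rewrite !subUset !sub1set uW xW.
- by rewrite !cardsU1 f2; case: (_ \notin _); case: (_ \notin _).
Qed.

(** The link of the edge ux is a cycle that contains the triangle on the other three vertices of
    [B], hence is that triangle. *)
Lemma clique_nb_closed B u x : clique B -> #|B| = 5 -> B \subset W -> u \notin F ->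
  u \in B -> x \in B -> u != x -> W :&: nb u :&: nb x \subset B.
Proof.
move=> cB B5 sBW uF uB xB ux; have [_ _ _ hL _] := nK.
have uW := subsetP sBW _ uB; have xW := subsetP sBW _ xB.
have xu : x \in nb u by apply: (cliqueP _ _ cB).
have [_ /(_ x xW xu) hc] := hL u uW uF.
pose S := B :\ u :\ x.
have cS : #|S| = 3.
  have c4 : #|B :\ u| = 4 by have := cardsD1 u B; rewrite uB B5 add1n => -[<-].
  by have := cardsD1 x (B :\ u); rewrite c4 in_setD1 eq_sym ux xB add1n => -[<-].
suff eS : S = lv E W [set u; x].
  have -> : W :&: nb u :&: nb x = lv E W [set u; x].
    apply/setP => y; rewrite [RHS]inE subUset !sub1set.
    by rewrite 2!in_setI -andbA (nbC _ u y) (nbC _ x y).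
  by rewrite -eS /S; apply: subset_trans (subsetDl _ _) (subsetDl _ _).
apply: (cyc_triangle hc) => //.
  apply/subsetP => y /setD1P[yx /setD1P[yu yB]].
  rewrite inE (subsetP sBW) // subUset !sub1set.
  by rewrite !(cliqueP _ _ cB).
move=> f fS f2; have fB : f \subset B.
  by apply: subset_trans fS _; apply: subset_trans (subsetDl _ _) (subsetDl _ _).
apply: leaf4_link => //.
- exact: subset_trans sBW.
- by apply: cliqueS cB; rewrite !subUset !sub1set uB xB.
- by apply/negP => /(subsetP fS); rewrite !inE eqxx andbF.
- by apply/negP => /(subsetP fS); rewrite !inE eqxx.
Qed.

(** By [clique_nb_closed] the rest [R] of the star is joined to [B] only through [u]. Tightness then
    gives [u |: R] as many as 4 |R| edges, more than [sparse4] or the number of pairs allows unless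
    [R] is empty. *)
Lemma clique_star B u : clique B -> #|B| = 5 -> B \subset W -> u \notin F ->
  u \in B -> W :&: cnb u = B.
Proof.
move=> cB B5 sBW uF uB; have [_ _ _ hL _] := nK.
have uW := subsetP sBW _ uB; have [tN _] := hL u uW uF.
pose R := (W :&: nb u) :\: B.
have sBN : B \subset W :&: cnb u.
  apply/subsetP => y yB; rewrite inE (subsetP sBW) //= in_setU1.
  by have [//|ne] := eqVneq y u; apply: (cliqueP _ _ cB); rewrite // eq_sym.
have eN : W :&: cnb u = B :|: (u |: R).
  apply/setP => y; apply/idP/setUP => [/setIP[yW yu]|[/(subsetP sBN)//|/setU1P[->|]]].
  - have [yB|yB] := boolP (y \in B); [by left|right].
    case/setU1P: yu => [->|yu]; first exact: setU11.
    by rewrite in_setU1 in_setD yB in_setI yW yu orbT.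
  - by rewrite in_setI uW setU11.
  - by case/setDP => /setIP[yW yu] _; rewrite in_setI yW in_setU1 yu orbT.
have eI : B :&: (u |: R) = [set u].
  apply/setP => y; rewrite in_setI in_setU1 in_setD in_set1.
  by case: eqP => [->|_]; [rewrite uB|case: (y \in B)].
have nc : no_cross E B (u |: R).
  move=> x y /setDP[xB]; rewrite in_setU1 => /norP[xu _] /setDP[yR yB].
  apply/negP => yx; case/setU1P: yR => [e|/setDP[yNu _]]; first by rewrite e uB in yB.
  have ux : u != x by rewrite eq_sym.
  by move: yB; rewrite (subsetP (clique_nb_closed cB B5 sBW uF uB xB ux)) // inE yNu.
have := card_edg_cut E2 nc; rewrite -eN eI (card_edg_clique E2 cB) B5.
rewrite (card_edg_clique E2 (clique1 E u)) cards1 addn0 => h.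
have uR : u \notin R by rewrite in_setD in_setI (negbTE (nb_irr E2 u)) !andbF.
have cN : #|W :&: cnb u| = 5 + #|R|.
  have := cardsUI B (u |: R); rewrite -eN eI cards1 cardsU1 uR B5.
  by move: #|R| #|_ :&: cnb u|; clear; lia.
suff R0 : #|R| = 0 by rewrite eN (cards0_eq R0) setU0; apply/setUidPl; rewrite sub1set.
have cuR : #|u |: R| = #|R|.+1 by rewrite cardsU1 uR.
have e4 : #|edg (u |: R)| = 4 * #|R|.
  by move: tN; rewrite cN h (_ : 'C(5, 2) = 10) //; move: #|edg _| #|R|; clear; lia.
have [h4|h4] := leqP 4 #|u |: R|.
  by have := sparse4 h4; rewrite e4 cuR; move: #|R|; clear; lia.
have := card_edg_sub E2 (u |: R); rewrite e4 cuR; rewrite cuR in h4.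
by case: #|R| h4 => [|[|[|]]].
Qed.

(** [u] and [v] have no neighbours off [B], so deleting both removes 4 + 3 edges. If the factor had
    a sixth vertex, at least eight would have to go for the rest to stay within its bound. *)
Lemma leaf4_clique5 B u v : clique B -> #|B| = 5 -> B \subset W -> u \notin F -> v \notin F ->
  u \in B -> v \in B -> u != v -> W = B.
Proof.
move=> cB B5 sBW uF vF uB vB uv; have [_ W5 tW _ _] := nK; rewrite -/W in W5 tW.
have uW := subsetP sBW _ uB; have vW := subsetP sBW _ vB.
have nbB x : x \in B -> x \notin F -> W :&: nb x = B :\ x.
  move=> xB xF; rewrite -(clique_star cB B5 sBW xF xB) cnbE ?(subsetP sBW) //.
  by rewrite setU1K // in_setI (negbTE (nb_irr E2 x)) andbF.
have c4 x : x \in B -> #|B :\ x| = 4.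
  by move=> xB; have := cardsD1 x B; rewrite xB B5 add1n => -[<-].
have vu : v \in W :\ u by rewrite !inE eq_sym uv.
have := card_edg_del E2 uW; rewrite nbB // c4 // => e1.
have := card_edg_del E2 vu; rewrite setIDAC nbB // => e2.
have c3 : #|B :\ v :\ u| = 3.
  by have := cardsD1 u (B :\ v); rewrite c4 // in_setD1 uv uB /= add1n => -[<-].
rewrite c3 in e2.
have cW1 := cardsD1 u W; rewrite uW add1n in cW1.
have cW2 := cardsD1 v (W :\ u); rewrite vu add1n in cW2.
apply/esym/eqP; rewrite eqEcard sBW B5 /=.
rewrite leqNgt; apply/negP => W6.
have h4 : 4 <= #|W :\ u :\ v| by move: W6; rewrite cW1 cW2.
have := sparse4 h4; move: tW; rewrite e1 e2 cW1 cW2.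
by move: #|edg _| #|_ :\ v| => a b; clear; lia.
Qed.

Lemma leaf4_adjacent u v : u \in W -> v \in W -> u \notin F -> v \notin F -> v \in nb u ->
  clique W /\ #|W| = 5.
Proof.
move=> uW vW uF vF vu; have uv := nb_neq E2 vu.
have uu : u \in nb v by rewrite nbC.
have [_ W5 tW hL _] := nK; rewrite -/W in W5 tW hL.
have [tu /(_ v vW vu) hc] := hL u uW uF; have [tv _] := hL v vW vF.
set X := lv E W [set u; v] in hc; set H := lnk K [set u; v] in hc.
have XP y : (y \in X) = [&& y \in W, y \in nb u & y \in nb v].
  by rewrite inE subUset !sub1set (nbC _ y u) (nbC _ y v).
have uX : u \notin X by rewrite XP (negbTE (nb_irr E2 u)) andbF.
have vX : v \notin X by rewrite XP (negbTE (nb_irr E2 v)) !andbF.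
have eH : edg X \subset H.
  apply/subsetP => f fX; have fE : f \in E by move: fX; rewrite inE => /andP[].
  have sf : f \subset X by move: fX; rewrite inE => /andP[].
  have sfW : f \subset W by apply/subsetP => y /(subsetP sf); rewrite XP => /and3P[].
  have sfu : f \subset nb u by apply/subsetP => y /(subsetP sf); rewrite XP => /and3P[].
  have sfv : f \subset nb v by apply/subsetP => y /(subsetP sf); rewrite XP => /and3P[].
  apply: leaf4_link => //.
  - apply: clique_setU1; first by apply: clique_setU1 => //; exact: clique_edge.
    by rewrite subUset sub1set vu.
  - exact: E2.
  - by apply: contra uX; apply: (subsetP sf).
  - by apply: contra vX; apply: (subsetP sf).
have eXm : #|edg X| <= #|X| by rewrite -(cyc_card hc) subset_leq_card.
set Nu := W :&: cnb u in tu; set Nv := W :&: cnb v in tv.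
have eI : Nu :&: Nv = u |: (v |: X).
  apply/setP => y; rewrite !in_setI !in_setU1 XP; case yW: (y \in W) => /=; last first.
    by rewrite orbF; case: eqP yW => [->|_]; [rewrite uW|case: eqP => [->|//]; rewrite vW].
  case: eqP => [->|_] /=; first by rewrite uu orbT.
  by case: eqP => [->|_] /=; [rewrite vu|].
have uvX : u \notin v |: X by rewrite in_setU1 negb_or uv.
have cI : #|Nu :&: Nv| = #|X|.+2 by rewrite eI !cardsU1 uvX vX.
have sXu : X \subset nb u by apply/subsetP => y; rewrite XP => /and3P[].
have sXv : X \subset nb v by apply/subsetP => y; rewrite XP => /and3P[].
have eIe : #|edg (Nu :&: Nv)| = 1 + 2 * #|X| + #|edg X|.
  rewrite eI (card_edg_del E2 (setU11 u _)) setU1K // (card_edg_del E2 (setU11 v _)) setU1K //.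
  have -> : (v |: X) :&: nb v = X.
    by rewrite setIUl (setIidPl sXv) (_ : _ :&: _ = finset.set0) ?set0U //;
       apply/setP => y; rewrite !inE; case: eqP => [->|//]; rewrite -nbE (negbTE (nb_irr E2 v)).
  have -> : (u |: (v |: X)) :&: nb u = v |: X.
    rewrite setIUl (_ : [set u] :&: _ = finset.set0) ?set0U.
      by apply/setIidPl; rewrite subUset sub1set vu.
    by apply/setP => y; rewrite in_setI in_set1 in_set0; case: eqP => [->|//]; rewrite (negbTE (nb_irr E2 u)).
  by rewrite cardsU1 vX; move: #|edg X| #|X|; clear => a b; lia.
have := cardsUI (edg Nu) (edg Nv); rewrite -edgI eIe.
have sU : #|edg Nu :|: edg Nv| <= #|edg (Nu :|: Nv)|.
  by apply: subset_leq_card; rewrite subUset !edgS ?subsetUl ?subsetUr.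
have cU := cardsUI Nu Nv; rewrite cI in cU.
have X0 : 0 < #|X| by rewrite card_gt0; case: hc.
have sIU : #|Nu :&: Nv| <= #|Nu :|: Nv|.
  by apply: subset_leq_card; apply: subset_trans (subsetIl _ _) (subsetUl _ _).
(* The cycle has as many edges as vertices, and its edges are pairs: m <= C(m, 2). *)
have X3 : 3 <= #|X|.
  have : #|H| <= 'C(#|X|, 2).
    rewrite -cards_draws; apply/subset_leq_card/subsetP => f fH.
    by have [_ /(_ f fH)[f2 sf] _ _] := hc; rewrite inE sf f2 /=.
  by rewrite (cyc_card hc); case: #|X| X0 => [|[|[|]]].
have U4 : 4 <= #|Nu :|: Nv| by apply: leq_trans sIU; rewrite cI !ltnS (leq_trans _ X3).
have spU := sparse4 U4 => eUI.
have [Xe eXe] : #|X| = 3 /\ 3 <= #|edg X|.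
  move: spU sU eUI cU tu tv eXm X3; clear.
  move: #|edg (Nu :|: Nv)| #|edg Nu :|: edg Nv| #|edg Nu| #|edg Nv| #|edg X| => a b c d x.
  by move: #|Nu| #|Nv| #|Nu :|: Nv| #|X| => i j k m *; split; lia.
have cX : clique X.
  apply/cliqueP => a b aX bX ab; rewrite nbE.
  have : [set a; b] \in [set f : {set V} | (f \subset X) && (#|f| == 2)].
    by rewrite inE subUset !sub1set aX bX cards2 ab.
  suff -> : [set f : {set V} | (f \subset X) && (#|f| == 2)] = edg X by rewrite inE => /andP[].
  apply/esym/eqP; rewrite eqEcard cards_draws Xe eXe andbT.
  by apply/subsetP => f fX; rewrite in_set; move: fX; rewrite inE => /andP[/E2-> ->].
have cB : clique (u |: (v |: X)).
  apply: clique_setU1; first exact: clique_setU1.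
  by rewrite subUset sub1set vu.
have B5 : #|u |: (v |: X)| = 5 by rewrite !cardsU1 uvX vX Xe.
have sB : u |: (v |: X) \subset W.
  by rewrite !subUset !sub1set uW vW; apply/subsetP => y; rewrite XP => /andP[].
by rewrite (leaf4_clique5 cB B5 sB uF vF) // ?setU11 // setU1r ?setU11.
Qed.

(** Connectivity outside [F] turns two vertices there into an adjacent pair, to which
    [leaf4_adjacent] applies. *)
Lemma leaf4_simplex : 2 <= #|W :\: F| ->
  [/\ #|W| = 5, K = simplex_boundary W & 2 <= #|W :\: F|].
Proof.
move=> W2; have [hN W5 _ _ [_ cW]] := nK; rewrite -/W in cW.
have [u uWF] : exists u, u \in W :\: F by apply/card_gt0P; apply: ltnW.
have [v vWF vu] : exists2 v, v \in W :\: F & v \in nb u.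
  apply: contrapT => h; move: W2; rewrite -(cW [set u]) ?cards1 //.
  - by rewrite sub1set.
  - by apply/set0Pn; exists u; rewrite set11.
  - move=> x /set1P->; apply/subsetP => y /setIP[yu yW]; by case: h; exists y.
have [[uW uF] [vW vF]] := (setDP uWF, setDP vWF).
have [cl c5] := leaf4_adjacent uW vW uF vF vu; split => //.
apply/setP => f; rewrite /simplex_boundary in_setD1 powersetE.
have nWF : ~~ (W \subset F) by apply/subsetPn; exists u.
apply/idP/andP => [fK|[nf sf]].
  split; last exact: sub_vertex_set.
  by apply: contraTneq fK => ->; apply/negP => /leaf4_sub/(_ nWF)[_ _]; rewrite c5.
apply: leaf4_clique => //; first exact: cliqueS cl.
by rewrite -ltnS -c5 proper_card // properEneq nf.
Qed.

Section Pyramid.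
Variable v : V.
Hypotheses (vW : v \in W) (vF : v \notin F) (eWF : W :\: F = [set v]).
Let Y := W :&: F.

(** Deleting [v] removes at most |Y| edges and leaves at most 3 |Y| - 6, while their sum has to be 4
    (|Y| + 1) - 10; so both bounds are attained. *)
Lemma base_tight : W :&: nb v = Y /\ #|edg Y| + 6 = 3 * #|Y|.
Proof.
have [_ W5 tW _ _] := nK; rewrite -/W in W5 tW.
have eY : W :\ v = Y by rewrite -eWF /Y setDDr setDv set0U.
have cW := cardsD1 v W; rewrite vW eY add1n in cW.
have sN : W :&: nb v \subset Y.
  by rewrite -eY subsetD1 subsetIl in_setI (negbTE (nb_irr E2 v)) andbF.
have Y3 : 3 <= #|Y| by rewrite -ltnS -cW (leq_trans _ W5).
have sY := F_sub (subsetIr W F) Y3; rewrite -/Y in sY.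
have := card_edg_del E2 vW; rewrite eY => eW.
have cN := subset_leq_card sN.
have h : #|Y| <= #|W :&: nb v| /\ 3 * #|Y| <= #|edg Y| + 6.
  move: tW sY eW cN; rewrite cW; clear; move: #|edg W| #|edg Y| #|Y| #|W :&: nb v| => a b c d *.
  by split; lia.
by split; [apply/eqP; rewrite eqEcard sN h.1|apply/eqP; rewrite eqn_leq sY h.2].
Qed.

Let YP y : y \in Y -> [/\ y \in W, y \in F, y \in nb v & v != y].
Proof.
move=> yY; have [yW yF] := setIP yY; have [e _] := base_tight.
have : y \in W :&: nb v by rewrite e.
by case/setIP => _ yv; rewrite yW yF yv (nb_neq E2 yv).
Qed.

Lemma base_link y : y \in Y -> cyc (lv E Y [set y]) (lnk K [set v; y]).
Proof.
case/YP => yW yF yv _; have [_ _ _ hL _] := nK.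
have [_ /(_ y yW yv)] := hL v vW vF.
suff -> : lv E Y [set y] = lv E W [set v; y] by [].
have [e _] := base_tight; apply/setP => z; rewrite lv1 -e.
by rewrite [RHS]inE subUset !sub1set 2!in_setI -andbA (nbC _ v z) (nbC _ y z).
Qed.

Lemma base_link_clique y f : y \in Y -> f \in lnk K [set v; y] -> clique (y |: f).
Proof.
move=> yY; rewrite inE => /and3P[_ _ fK].
have nF : ~~ ([set v; y] :|: f \subset F) by rewrite !subUset !sub1set (negbTE vF).
have [_ cl _] := leaf4_sub fK nF; apply: cliqueS cl.
by rewrite setUSS // sub1set set22.
Qed.

(** Counting edges across the cut leaves only the case of two tight sides meeting in all of [A]. In
    the link of the edge from [v] to a vertex [x] of [A], the other two vertices of [A] then
    separate the cycle, so they are not joined in it. Yet together with [v] and [x] they form a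
    4-clique, which is a face. *)
Lemma base_unseparated : unseparated E Y.
Proof.
move=> A Y1 Y2 cA A3 eY sI nc; apply: contrapT => /not_orP[n1 n2].
have [_ tY] := base_tight.
have [s1 s2] : Y1 \subset Y /\ Y2 \subset Y by rewrite eY subsetUl subsetUr.
have sub1 : Y1 \subset F by apply: subset_trans s1 (subsetIr _ _).
have sub2 : Y2 \subset F by apply: subset_trans s2 (subsetIr _ _).
set I := Y1 :&: Y2 in sI.
have p1 : #|I| < #|Y1|.
  rewrite proper_card // properEneq subsetIl andbT; apply: contra_not_neq n2 => e.
  by rewrite eY -e; apply/setUidPr/subsetIr.
have p2 : #|I| < #|Y2|.
  rewrite proper_card // properEneq subsetIr andbT; apply: contra_not_neq n1 => e.
  by rewrite eY -e; apply/setUidPl/subsetIl.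
have cI := card_edg_clique E2 (cliqueS sI cA); have c3 := subset_leq_card sI; rewrite A3 in c3.
have := card_edg_cut E2 nc; rewrite -eY -/I cI => eE.
have cY := cardsUI Y1 Y2; rewrite -eY -/I in cY.
have [_ W5 _ _ _] := nK; rewrite -/W in W5.
have Y4 : 4 <= #|Y|.
  have := cardsID F W; rewrite eWF cards1 -/Y addn1 => h; by rewrite -ltnS h.
(* Below three vertices the planar bound is replaced by the number of pairs. *)
have bd U : U \subset F -> [\/ #|edg U| + 6 <= 3 * #|U|, #|U| = 2 /\ #|edg U| <= 1 |
    #|U| <= 1 /\ #|edg U| = 0].
  move=> sU; have [U3|U3] := leqP 3 #|U|; first by constructor 1; apply: F_sub.
  have := card_edg_sub E2 U; case: #|U| U3 => [|[|[|]]] // _; rewrite ?leqn0.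
  - by move/eqP => h; constructor 3.
  - by move/eqP => h; constructor 3.
  - by move=> h; constructor 2.
have [I3 t1 t2 Y14 Y24] : [/\ #|I| = 3, #|edg Y1| + 6 = 3 * #|Y1|,
     #|edg Y2| + 6 = 3 * #|Y2|, 4 <= #|Y1| & 4 <= #|Y2|].
  move: (bd _ sub1) (bd _ sub2) p1 p2 c3 eE cY tY Y4; clear.
  move: #|edg Y1| #|edg Y2| #|edg Y| #|Y1| #|Y2| #|Y| #|I| => a b c x y z i.
  have [C0 C1 C2 C3] : [/\ 'C(0, 2) = 0, 'C(1, 2) = 0, 'C(2, 2) = 1 & 'C(3, 2) = 3] by [].
  move=> h1 h2 p1 p2 i3 eE cY tY Y4.
  have [e|[e|[e|e]]] : i = 0 \/ i = 1 \/ i = 2 \/ i = 3 by lia.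
  - by rewrite e C0 in p1 p2 eE cY *; case: h1 => [?|[? ?]|[? ?]]; case: h2 => [?|[? ?]|[? ?]]; split; lia.
  - by rewrite e C1 in p1 p2 eE cY *; case: h1 => [?|[? ?]|[? ?]]; case: h2 => [?|[? ?]|[? ?]]; split; lia.
  - by rewrite e C2 in p1 p2 eE cY *; case: h1 => [?|[? ?]|[? ?]]; case: h2 => [?|[? ?]|[? ?]]; split; lia.
  - by rewrite e C3 in p1 p2 eE cY *; case: h1 => [?|[? ?]|[? ?]]; case: h2 => [?|[? ?]|[? ?]]; split; lia.
have eI : I = A by apply/eqP; rewrite eqEcard sI A3 I3.
have [x xA] : exists x, x \in A by apply/card_gt0P; rewrite A3.
have sA1 : A \subset Y1 by rewrite -eI subsetIl.
have sA2 : A \subset Y2 by rewrite -eI subsetIr.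
have x1 := subsetP sA1 _ xA; have x2 := subsetP sA2 _ xA.
have cAx : #|A :\ x| = 2 by have := cardsD1 x A; rewrite xA A3 add1n => -[<-].
have /eqP/cards2P[y [z [yz eAx]]] := cAx.
have nd U : U \subset F -> A \subset U -> #|edg U| + 6 = 3 * #|U| -> 4 <= #|U| ->
    ~~ (U :&: nb x \subset [set y; z]).
  move=> sU sAU tU U4; have xU := subsetP sAU _ xA; rewrite -eAx; apply/negP => s.
  have cU := cardsD1 x U; rewrite xU add1n in cU.
  have U3 : 3 <= #|U :\ x| by rewrite -ltnS -cU.
  have := tight_degree E2 xU tU (F_sub (subset_trans (subsetDl _ _) sU) U3).
  by move/leq_trans => /(_ _ (subset_leq_card s)); rewrite cAx.
have xY := subsetP s1 _ x1; have hc := base_link xY.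
have eX : lv E Y [set x] = (Y1 :&: nb x) :|: (Y2 :&: nb x) by rewrite lv1 -setIUl -eY.
have eIx : (Y1 :&: nb x) :&: (Y2 :&: nb x) = [set y; z].
  rewrite -setIIl -/I eI -eAx; apply/setP => u; rewrite in_setI in_setD1.
  have [->|ux] := eqVneq u x; first by rewrite (negbTE (nb_irr E2 x)) andbF.
  case uA: (u \in A) => //=; apply: (cliqueP _ _ cA) => //; by rewrite eq_sym.
have hf f : f \in lnk K [set v; x] -> f \subset Y1 :&: nb x \/ f \subset Y2 :&: nb x.
  move=> fl; have cf := cliqueS (subsetUr _ _) (base_link_clique xY fl).
  have [_ /(_ f fl)[_ sf] _ _] := hc; rewrite lv1 subsetI in sf; case/andP: sf => sfY sfx.
  rewrite !subsetI sfx !andbT.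
  have [|||e|e] := clique_unseparated (Y := f) cf cA A3 (Y1 := f :&: Y1) (Y2 := f :&: Y2).
  - by rewrite -setIUr -eY (setIidPl sfY).
  - by rewrite -setIIr -/I eI subsetIr.
  - move=> a b; rewrite !in_setD !in_setI => /and3P[na af a1] /and3P[nb' bf b2].
    rewrite af in na; rewrite bf in nb'.
    by apply: nc; rewrite in_setD ?a1 ?b2 ?andbT.
  - by left; apply/setIidPl.
  - by right; apply/setIidPl.
have [nH _ _] := cut_degrees hc yz eX eIx (nd _ sub1 sA1 t1 Y14) (nd _ sub2 sA2 t2 Y24) hf.
case/negP: nH; have [xW xF xv vx] := YP xY.
have sAv : A \subset nb v by apply/subsetP => u /(subsetP sA1)/(subsetP s1)/YP[].
have sAW : A \subset W by apply/subsetP => u /(subsetP sA1)/(subsetP s1)/YP[].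
have sxz : [set y; z] \subset A by rewrite -eAx subsetDl.
apply: leaf4_link => //.
- exact: subset_trans sAW.
- by rewrite -eAx setD1K //; apply: clique_setU1.
- by rewrite cards2 yz.
- by apply/negP => /(subsetP sxz)/(subsetP sAv); rewrite (negbTE (nb_irr E2 v)).
- by rewrite -eAx !inE eqxx.
Qed.

(** The faces of [K] inside [F] need care: besides faces of [F] they may be vertex sets or faces of
    other cells, or inserted 4-cliques. By [full_in_leaf], another cell or a 4-clique can lie within
    the vertices of [K0] only by being all of them, and that set is the base of the pyramid. *)
Lemma leaf4_pyramid : exists2 K0, K0 \in LF &
  exists2 v, v \notin vertex_set K0 & K = pyramid_boundary v K0.
Proof.
have root := node3_root KF_face KF1 KF_lnk F4 F_tight.
have leaf K0 : K0 \in LF -> node3 E F KF K0 /\ forall A, ~ missing_face 3 K0 A.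
  by move=> K0L; apply: (leaves3 E2 F_sub KF_face) hLF K0L.
have [|K0 K0L sY] := unseparated_leaf E2 F_sub KF_face KF2 hLF root _ base_unseparated.
  apply/subsetP => y /YP[_ yF _ _]; apply/vertex_setP.
  by exists [set y]; rewrite ?KF1 ?set11.
have [n0 p0] := leaf K0 K0L; have [[_ h0 _] s0F W4 _ _] := n0.
have full X H : X \subset vertex_set K0 -> X != finset.set0 ->
  (forall x, x \in X -> cyc (lv E X [set x]) (H x)) ->
  (forall x f, x \in X -> f \in H x -> clique (x |: f)) -> X = vertex_set K0.
  move=> h1 h2 h3 h4; exact: (full_in_leaf E2 F_sub KF_face KF0 KF1 KF2 n0 p0 h1 h2 h3 h4).
have inK0 f : (f \in K0) = [&& f \subset vertex_set K0, clique f & #|f| <= 3].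
  exact: (leaf3P KF_face).
have eY : Y = vertex_set K0.
  apply: (full _ (fun y => lnk K [set v; y])) => //; last exact: base_link_clique.
    rewrite -card_gt0; have [_ W5 _ _ _] := nK; have := cardsID F W.
    by rewrite eWF cards1 -/Y addn1 => h; move: W5; rewrite -/W -h ltnS; apply: leq_trans.
  exact: base_link.
have v0 : v \notin vertex_set K0 by apply: contra vF; apply: (subsetP s0F).
exists K0 => //; exists v => //.
have eW : W = v |: vertex_set K0.
  by rewrite -eY /Y -{1}(setID W F) eWF setUC.
have [[hN1 hN2 _] _ _ _ _] := nK.
have s0v : vertex_set K0 \subset nb v by rewrite -eY; apply/subsetP => y /YP[].
have s0W : vertex_set K0 \subset W by rewrite eW subsetUr.
apply/setP => f; rewrite /pyramid_boundary in_setU in_setU1.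
apply/idP/idP => [fK|/orP[/orP[/eqP->|]|/imsetP[f' f'K0 ->]]].
- have fW := sub_vertex_set fK; rewrite -/W eW in fW.
  have [vf|vf] := boolP (v \in f).
    have nf : ~~ (f \subset F) by apply/subsetPn; exists v.
    have [_ cf f4] := leaf4_sub fK nf; apply/orP; right; apply/imsetP.
    exists (f :\ v); last by rewrite setD1K.
    rewrite inK0 (cliqueS (subsetDl _ _) cf) subDset fW /=.
    by have := cardsD1 v f; rewrite vf add1n => e; rewrite -ltnS -e.
  have fW0 : f \subset vertex_set K0.
    apply/subsetP => y yf; have := subsetP fW y yf; rewrite in_setU1 => /orP[/eqP e|//].
    by rewrite -e yf in vf.
  have fF := subset_trans fW0 s0F.
  rewrite -orbA; have [//|nf] := eqVneq f (vertex_set K0); rewrite /=.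
  suff -> : f \in K0 by [].
  case: (hN1 f fK) => [fD|[f4 cf]].
    case: (D_in fD fF) => [fKF|[K' K'L /setU1P[e|fK']]].
    + exact: h0.
    + have [n' p'] := leaf K' K'L; have [_ s'F W'4 _ hL'] := n'.
      case/eqP: nf; apply: (full f (fun x => lnk K' [set x])) => //.
      * by rewrite e -card_gt0 (leq_trans _ W'4).
      * by move=> x; rewrite e => /hL'.
      * move=> x g xf; rewrite inE => /and3P[_ _].
        by rewrite (leaf3P KF_face KF0 KF1 KF2 n' p') => /and3P[].
    + have [n' p'] := leaf K' K'L; move: fK'.
      by rewrite (leaf3P KF_face KF0 KF1 KF2 n' p') inK0 fW0 => /and3P[_ -> ->].
  case/eqP: nf.
  have lvf x : x \in f -> lv E f [set x] = f :\ x.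
    move=> xf; rewrite lv1; apply/setP => y; rewrite in_setI in_setD1.
    have [->|yx] := eqVneq y x; first by rewrite (negbTE (nb_irr E2 x)) andbF.
    by case yf: (y \in f) => //=; apply: (cliqueP _ _ cf); rewrite // eq_sym.
  apply: (full f (fun x => [set g : {set V} | (g \subset f :\ x) && (#|g| == 2)])) => //.
  + by rewrite -card_gt0 f4.
  + move=> x xf; rewrite lvf //; apply: cyc_K3.
    by have := cardsD1 x f; rewrite xf f4 add1n => -[<-].
  + move=> x g xf; rewrite inE => /andP[sg _]; apply: cliqueS cf.
    by rewrite subUset sub1set xf (subset_trans sg) ?subsetDl.
- by apply: hN2 => //; apply: D_cell.
- rewrite inK0 => /and3P[sf cf f3]; apply: leaf4_clique => //; last exact: ltnW.
  exact: subset_trans s0W.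
- move: f'K0; rewrite inK0 => /and3P[sf cf f3].
  apply: leaf4_clique; first by rewrite eW setUS.
    by apply: clique_setU1 => //; apply: subset_trans s0v.
  by rewrite cardsU1; case: (_ \notin _) => //=; apply: ltnW.
Qed.
End Pyramid.

Lemma leaf4_cases :
  ([/\ #|W| = 5, K = simplex_boundary W & 2 <= #|W :\: F|]) \/
  (exists2 K0, K0 \in LF & exists2 v, v \notin vertex_set K0 & K = pyramid_boundary v K0).
Proof.
have [W2|W2] := leqP 2 #|W :\: F|; [left; by have [] := leaf4_simplex W2|].
right; have [_ _ _ _ [W0 _]] := nK; rewrite -/W in W0.
have /cards1P[v eWF] : #|W :\: F| == 1 by rewrite eqn_leq -ltnS W2 card_gt0.
have /setDP[vW vF] : v \in W :\: F by rewrite eWF set11.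
exact: leaf4_pyramid vW vF eWF.
Qed.
End Leaves.

Local Open Scope ring_scope.

(** * Face numbers of stacked pyramids *)

Section Independence.
Variables (R : realFieldType) (N : nat) (V : finType) (g : V -> 'rV[R]_N).
Implicit Types (X A B C G S U f : {set V}) (c d : 'cV[R]_N).
Local Notation rk := (rk g).
Local Notation ev := (ev g).
Local Notation fcs := (fcs g).
Local Notation upper := (upper g).
Local Notation verts := (verts g).
Local Notation simple_base := (simple_base g).

Lemma rk_setU_card A B : (rk (A :|: B) <= rk A + #|B|)%N.
Proof.
have [m] := ubnP #|B|; elim: m B => // m IH B hm.
have [->|[x xB]] := set_0Vmem B; first by rewrite setU0 leq_addr.
have cB := cardsD1 x B; rewrite xB add1n in cB.
rewrite cB addnS -{1}(setD1K xB) setUCA.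
by apply: leq_trans (rk_setU1 g _ _) _; rewrite ltnS IH // -cB.
Qed.

Lemma rk_card A : (rk A <= #|A|)%N.
Proof. by have := rk_setU_card finset.set0 A; rewrite set0U rk0. Qed.

Definition indep A := rk A == #|A|.

Lemma indepE A : indep A = (rk A == #|A|)%N. Proof. by []. Qed.

Lemma indepS A B : B \subset A -> indep A -> indep B.
Proof.
move=> sBA /eqP iA; rewrite /indep eqn_leq rk_card /=.
have eA : B :|: (A :\: B) = A by rewrite -{1}(setIidPr sBA) setID.
have := rk_setU_card B (A :\: B); rewrite eA iA.
have := cardsID B A; rewrite (setIidPr sBA) => <-.
by rewrite leq_add2r.
Qed.

(** For each point of an independent set some functional vanishes at all the others but not at it,
    so deleting one point gives a face; all other subsets are intersections of such faces. *)
Lemma indep_face A B : indep A -> B \subset A -> B \in fcs A.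
Proof.
move=> iA; have [m] := ubnP #|A :\: B|; elim: m B => // m IH B hm sBA.
have [e|[x /setDP[xA xB]]] := set_0Vmem (A :\: B).
  have -> : B = A by apply/eqP; rewrite eqEsubset sBA -setD_eq0 e eqxx.
  exact: fcs_full.
have -> : B = (x |: B) :&: (A :\ x).
  apply/setP => y; rewrite in_setI in_setU1 in_setD1.
  have [->|yx] /= := eqVneq y x; first exact/negbTE.
  by case yB: (y \in B) => //=; rewrite (subsetP sBA).
apply: fcsI.
  apply: IH; last by rewrite subUset sub1set xA.
  rewrite -ltnS (leq_trans _ hm) // ltnS proper_card //.
  apply/properP; split; first by rewrite setDS // subsetUr.
  by exists x; rewrite ?in_setD ?xB // setU11.
have rx : (rk (A :\ x) < rk A)%N.
  rewrite (eqP iA) (cardsD1 x A) xA add1n ltnS; exact: rk_card.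
have [c [cA [i iA' ci]]] := rk_sep rx.
have ix : i = x.
  by apply/eqP; apply: contraNT ci => ix; rewrite cA // in_setD1 ix.
rewrite ix in ci; move: ci; rewrite neq_lt => /orP[ci|ci].
  apply: (@fcs_intro _ _ _ _ _ _ (- c)); first exact: subsetDl.
    by move=> j jA; rewrite evN cA // oppr0.
  move=> j jA; rewrite in_setD1 jA andbT negbK => /eqP->.
  by rewrite evN oppr_gt0.
apply: (@fcs_intro _ _ _ _ _ _ c) => //; first exact: subsetDl.
by move=> j jA; rewrite in_setD1 jA andbT negbK => /eqP->.
Qed.

(** A face of rank one above [A] contains some [x |: A], itself a face of that same rank. *)
Lemma full_simple X A : A \in fcs X -> X :\: A \subset verts X A -> simple_base X A.
Proof.
move=> AX full B; rewrite in_upper => /and3P[BX sAB /eqP rB].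
have [x xB xA] : exists2 x, x \in B & x \notin A.
  by apply/subsetPn; apply/negP => /(rkS g); rewrite rB addn1 ltnn.
exists x => //; apply/esym.
have /(subsetP full)/vertsP[xX _ xF] : x \in X :\: A.
  by rewrite in_setD xA (subsetP (fcs_sub BX)).
have sB : x |: A \subset B by rewrite subUset sub1set xB.
apply: (fcs_rk_inj xF (fcs_sub BX) sB).
by rewrite rB (rk_fcs_setU1 AX xX xA) addn1.
Qed.

(** An edge of the figure has two vertices, and every point off [A] is a vertex; so its points off
    [A] are [v] and one other. *)
Lemma full_simple2 X A : A \in fcs X -> X :\: A \subset verts X A ->
  forall v, v \in verts X A -> simple_base X (v |: A).
Proof.
move=> AX full v vV B Bu; have sb := full_simple AX full.
have Bu' : B \in upper X A 2 by move: Bu; rewrite upper_point // inE => /andP[].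
have vB : v \in B by move: Bu; rewrite upper_point // inE => /andP[].
have c2 := card_edge_verts AX sb Bu'.
have eB : B :\: A = B :&: verts X A.
  apply/setP => y; rewrite in_setD in_setI; apply/andP/andP => -[h1 h2]; split => //.
    apply: (subsetP full); rewrite in_setD h1.
    by move: Bu'; rewrite in_upper => /andP[/fcs_sub/subsetP->].
  by case/vertsP: h2.
have vvB : v \in B :&: verts X A by rewrite in_setI vB.
have c1 : #|(B :&: verts X A) :\ v| = 1%N.
  by have := cardsD1 v (B :&: verts X A); rewrite vvB c2 add1n => -[<-].
have /cards1P[x ex] : #|(B :&: verts X A) :\ v| == 1%N by rewrite c1.
have : x \in (B :&: verts X A) :\ v by rewrite ex set11.
rewrite in_setD1 -eB in_setD => /and3P[xv xA xB].
exists x; first by rewrite in_setU1 negb_or xv.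
rewrite -{1}(setID B A) eB -(setD1K vvB) ex.
have sAB : A \subset B by move: Bu'; rewrite in_upper => /and3P[].
by rewrite (setIidPr sAB) setUC setUCA setUA.
Qed.

(** The figure is a polygon: the diamond property gives degree 2 and the simplex path connectivity.
    Its edges are recorded by their two points off [A], to match [lnk]. *)
Lemma cyc_figure X A : A \in fcs X -> rk X = (rk A + 3)%N -> simple_base X A ->
  (forall C, C \in upper X A 2 -> #|C :\: A| = 2%N) ->
  cyc (verts X A) [set f : {set V} | [&& #|f| == 2%N, [disjoint f & A] & A :|: f \in upper X A 2]].
Proof.
move=> AX rX sb hC; set H := [set f | _].
have memH f : f \in H -> f = (A :|: f) :&: verts X A.
  rewrite inE => /and3P[f2 dfA Cu].
  have s : (A :|: f) :&: verts X A \subset (A :|: f) :\: A.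
    apply/subsetP => y /setIP[yC /vertsP[_ yA _]]; by rewrite in_setD yA.
  have e : (A :|: f) :\: A = f by rewrite setDUl setDv set0U; apply/setDidPl.
  by apply/esym/eqP; rewrite eqEcard (card_edge_verts AX sb Cu) (eqP f2) andbT -{2}e.
split.
- have [|B [BX pAB _ rB]] := fcs_next AX (fcs_full g X).
    rewrite properEneq (fcs_sub AX) andbT; apply/eqP => e.
    by move/eqP: rX; rewrite e -[X in X == _]addn0 eqn_add2l.
  have [|x xv _] := upper_verts AX sb (B := B).
    by rewrite in_upper BX proper_sub // rB addn1 /=.
  by apply/set0Pn; exists x.
- move=> f fH; split; first by move: fH; rewrite inE => /and3P[/eqP].
  by rewrite (memH f fH) subsetIr.
- move=> x xV; have [xX xA xF] := vertsP _ _ _ _ xV.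
  have -> : 2%N = #|upper X (x |: A) 1|.
    apply/esym/diamond => //.
    by rewrite (rk_fcs_setU1 AX xX xA) rX addSnnS.
  rewrite upper_point //.
  have -> : [set C in upper X A 2 | x \in C] = [set A :|: f | f in [set f in H | x \in f]].
    apply/setP => C; rewrite in_set; apply/andP/imsetP => [[Cu xC]|[f]].
      have sAC : A \subset C by move: Cu; rewrite in_upper => /and3P[].
      have eC : C = A :|: (C :\: A) by rewrite -{1}(setID C A) (setIidPr sAC).
      exists (C :\: A) => //; rewrite in_set in_setD xA xC andbT in_set -eC Cu hC //.
      by rewrite -setI_eq0 setIDAC setDIl setDv setI0 !eqxx.
    rewrite in_set => /andP[fH xf] ->; rewrite in_setU xf orbT.
    by move: fH; rewrite in_set => /and3P[].
  rewrite card_in_imset // => f f'; rewrite [f \in _]in_set [f' \in _]in_set => /andP[fH _] /andP[f'H _] e.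
  by rewrite (memH f fH) e -(memH f' f'H).
- move=> S sS S0 hS; apply/eqP; rewrite eqEsubset sS; apply/subsetP => y yV.
  have [c [cA _ cp]] := fcs_pos AX.
  have cV x : x \in verts X A -> 0 < ev c x by case/vertsP => xX xA _; apply: cp.
  apply: (verts_connected AX sb cA sS S0) yV (cV y yV) => [x /(subsetP sS)/cV//|].
  move=> x z C xS Cu xC zC zV _.
  have sAC : A \subset C by move: Cu; rewrite in_upper => /and3P[].
  have eC : C = A :|: (C :\: A) by rewrite -{1}(setID C A) (setIidPr sAC).
  apply: (subsetP (hS (C :\: A) _ _)).
  + by rewrite in_set -eC Cu hC // -setI_eq0 setIDAC setDIl setDv setI0 !eqxx.
  + apply/set0Pn; exists x; rewrite in_setI xS andbT in_setD xC andbT.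
    by have /vertsP[] := subsetP sS x xS.
  + by rewrite in_setD zC andbT; case/vertsP: zV.
Qed.

End Independence.

(** * Faces after a stacking and after forming a pyramid *)

Section Stacking.
Variables (R : realFieldType) (N : nat) (V : finType) (g : V -> 'rV[R]_N).
Implicit Types (X A B C G S U f : {set V}) (c d : 'cV[R]_N).
Local Notation rk := (rk g).
Local Notation ev := (ev g).
Local Notation fcs := (fcs g).
Local Notation vanishes := (vanishes g).
Local Notation nonneg := (nonneg g).
Local Notation zeros := (zeros g).
Local Notation indep := (indep g).

(** The index is the rank, so that for homogenized points 2, 3, 4 give f_1, f_2, f_3. *)
Definition nfaces X k := #|[set A in fcs X | rk A == k]|.

Definition beyond_facet X G v :=
  [/\ rk (v |: X) = rk X, G \in fcs X, (rk G).+1 = rk X,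
      forall c, nonneg c X -> G = zeros c X -> ev c v < 0 &
      forall H c, H \in fcs X -> (rk H).+1 = rk X -> H != G -> nonneg c X ->
        H = zeros c X -> 0 < ev c v].

Lemma zeros_pos X A c : vanishes c A -> nonneg c X -> A \subset X ->
  (forall i, i \in X -> i \notin A -> 0 < ev c i) -> A = zeros c X.
Proof.
move=> cA c0 sA cp; apply/setP => i; rewrite inE; apply/idP/andP => [iA|[iX /eqP ci]].
  by rewrite (subsetP sA) // cA ?eqxx.
by apply: contraT => /(cp _ iX); rewrite ci ltxx.
Qed.

Lemma nfaces_indep X k : indep X -> (nfaces X k <= 'C(#|X|, k))%N.
Proof.
move=> iX; rewrite -cards_draws; apply/subset_leq_card/subsetP => A hA; rewrite in_set.
move: hA; rewrite in_set => /andP[AX /eqP rA].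
by rewrite (fcs_sub AX) -rA; have /eqP-> := indepS (fcs_sub AX) iX; rewrite /=.
Qed.

Section Step.
Variables (X G : {set V}) (v : V).
Hypothesis bey : beyond_facet X G v.
Let X' := v |: X.

Lemma beyond_new : v \notin X.
Proof.
have [_ GX _ hG _] := bey; have [c [cG c0 cp]] := fcs_pos GX.
apply/negP => vX; have := hG c c0 (zeros_pos cG c0 (fcs_sub GX) cp).
by rewrite ltNge c0.
Qed.

(** Such a functional is a nonnegative combination of functionals of facets through [x]; these
    differ from [G], so they are positive at [v]. The combination is peeled off one facet at a time,
    each time making a new point vanish. *)
Lemma beyond_ge0 c x : x \in X -> x \notin G -> nonneg c X -> ev c x = 0 ->
  0 <= ev c v /\ (ev c v = 0 -> vanishes c X).
Proof.
have [rX GX rG hG hH] := bey; move=> xX xG.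
have [m] := ubnP #|X :\: zeros c X|; elim: m c => // m IH c hm c0 cx.
have ZX : zeros c X \in fcs X by apply/fcsP; exists c.
have [sXZ|/subsetPn[z zX zZ]] := boolP (X \subset zeros c X).
  have cX : vanishes c X by move=> i /(subsetP sXZ); rewrite inE => /andP[_ /eqP].
  have sX : X \subset v |: X by apply: subsetUr.
  have := rk_vanish sX _ cX; rewrite rX leqnn => /(_ isT) cX'.
  by rewrite cX' ?setU11.
have [H [HX sZH zH rH]] := facet_avoiding ZX zX zZ.
have xZ : x \in zeros c X by rewrite inE xX cx eqxx.
have HG : H != G by apply: contraNneq xG => <-; apply: (subsetP sZH).
have [h [hH0 h0 hp]] := fcs_pos HX.
have hv := hH H h HX (esym rH) HG h0 (zeros_pos hH0 h0 (fcs_sub HX) hp).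
have [j] := exists_argmin (P := [in X :\: H]) (fun i => ev c i / ev h i)
  (introT setDP (conj zX zH)).
rewrite in_setD => /andP[jH jX] hj.
have cj : 0 < ev c j.
  rewrite lt_def c0 // andbT; apply: contra jH => cj.
  by apply: (subsetP sZH); rewrite inE jX.
pose t := ev c j / ev h j; have t0 : 0 < t by rewrite divr_gt0 ?hp.
pose c' := c - t *: h.
have c'0 : nonneg c' X.
  move=> k kX; rewrite !evE; have [kH|kH] := boolP (k \in H).
    by rewrite hH0 // mulr0 subr0 c0.
  have := hj k; rewrite -/t in_setD kH kX => /(_ isT).
  by rewrite ler_pdivlMr ?hp //; lra.
have c'x : ev c' x = 0 by rewrite !evE cx (hH0 x) ?mulr0 ?subr0 ?(subsetP sZH).
have [|c'v _] := IH c' _ c'0 c'x.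
  rewrite ltnS in hm; apply: leq_trans hm; apply: proper_card; apply/properP; split.
    apply/subsetP => k; rewrite !in_setD => /andP[kZ ->]; rewrite andbT.
    apply: contra kZ => kZ; rewrite inE; move: (kZ); rewrite inE => /andP[-> /eqP ck].
    by rewrite /= !evE ck (hH0 k) ?mulr0 ?subr0 ?(subsetP sZH).
  exists j; first by rewrite in_setD jX andbT inE jX (gt_eqF cj).
  rewrite in_setD negb_and negbK inE jX /= !evE /t divfK ?subrr ?eqxx //.
  by rewrite gt_eqF ?hp.
have cv : 0 < ev c v.
  by move: c'v; rewrite !evE; have := mulr_gt0 t0 hv; lra.
by split; [exact: ltW|move=> e; move: cv; rewrite e ltxx].
Qed.

(** By [beyond_ge0], a supporting functional that vanishes at [v] and at a point of [X] off [G]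
    vanishes everywhere. *)
Lemma beyond_face A : A \in fcs X' -> v \in A -> A != X' -> A :\ v \subset G.
Proof.
case/fcsP => c c0 eA vA nA; apply/subsetP => x /setD1P[xv xA].
have xX : x \in X by move: xA; rewrite eA inE in_setU1 (negbTE xv) => /andP[].
apply: contraNT nA => xG.
have c0X : nonneg c X by move=> i iX; apply: c0; rewrite in_setU1 iX orbT.
have cx : ev c x = 0 by move: xA; rewrite eA inE => /andP[_ /eqP].
have cv : ev c v = 0 by move: vA; rewrite eA inE => /andP[_ /eqP].
have [_ /(_ cv) cX] := beyond_ge0 xX xG c0X cx.
rewrite eA; apply/eqP/setP => i; rewrite inE; apply/andP/idP => [[]//|iX']; split=> //.
by case/setU1P: iX' => [->|iX]; rewrite ?cv ?cX ?eqxx.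
Qed.

Lemma beyond_indep A : indep G -> A \in fcs X' -> v \in A -> A != X' -> indep A.
Proof.
move=> iG AX vA nA; have sG := beyond_face AX vA nA.
have [_ GX _ hG _] := bey; have [c [cG c0 cp]] := fcs_pos GX.
have cv := hG c c0 (zeros_pos cG c0 (fcs_sub GX) cp).
have cA : vanishes c (A :\ v) by move=> i /(subsetP sG)/cG.
have rA : rk A = (rk (A :\ v)).+1.
  by rewrite -{1}(setD1K vA) (rk_setU1_strict cA) ?lt_eqF.
by rewrite [indep A]indepE rA (cardsD1 v A) vA add1n eqSS; apply: indepS sG iG.
Qed.

Lemma beyond_old A : A \in fcs X' -> v \notin A -> A \in fcs X /\ A != G.
Proof.
move=> AX vA; have sA : A \subset X.
  apply/subsetP => i iA; have := subsetP (fcs_sub AX) i iA.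
  by rewrite in_setU1 => /orP[/eqP e|//]; rewrite -e iA in vA.
have AX0 : A \in fcs X by apply: fcs_sub_face AX (subsetUr _ _) sA.
split => //; apply/eqP => e; have [_ _ _ hG _] := bey.
have [c [cA c0 cp]] := fcs_pos AX.
have c0X : nonneg c X by move=> i iX; apply: c0; rewrite in_setU1 iX orbT.
have := hG c c0X; rewrite -e => /(_ (zeros_pos cA c0X sA _)).
have h i : i \in X -> i \notin A -> 0 < ev c i by move=> iX; apply: cp; rewrite in_setU1 iX orbT.
by move=> /(_ h); rewrite ltNge c0 ?setU11.
Qed.

(** The new faces consist of [v] and a subset of [G], and [G] itself is lost, which the boolean term
    records. An inequality suffices, as the face numbers of stacked polytopes are only used as upper
    bounds. *)
Lemma beyond_count k : indep G -> (k.+1 < rk X)%N ->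
  (nfaces X' k.+1 + (k.+2 == rk X) <= nfaces X k.+1 + 'C(#|G|, k))%N.
Proof.
move=> iG kX; have [rX GX rG _ _] := bey.
pose old := [set A in fcs X | rk A == k.+1] :\ G.
pose new := [set v |: f | f in [set f : {set V} | (f \subset G) && (#|f| == k)]].
have sub : [set A in fcs X' | rk A == k.+1] \subset old :|: new.
  apply/subsetP => A; rewrite in_set => /andP[AX /eqP rA]; apply/setUP.
  have nA : A != X' by apply: contraTneq kX => e; rewrite -rX -/X' -e rA ltnn.
  have [vA|vA] := boolP (v \in A); [right|left].
    apply/imsetP; exists (A :\ v); last by rewrite setD1K.
    rewrite in_set beyond_face //=; have /eqP := beyond_indep iG AX vA nA.
    by rewrite rA (cardsD1 v A) vA add1n => -[<-].
  by have [h1 h2] := beyond_old AX vA; rewrite in_setD1 h2 in_set h1 rA /=.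
have h1 : (nfaces X' k.+1 <= #|old| + #|new|)%N.
  exact: leq_trans (subset_leq_card sub) (leq_card_setU _ _).
have h2 : (#|new| <= 'C(#|G|, k))%N by rewrite -cards_draws leq_imset_card.
have h3 : (#|old| + (k.+2 == rk X) = nfaces X k.+1)%N.
  have -> : nfaces X k.+1 = ((G \in [set A in fcs X | rk A == k.+1]) + #|old|)%N by exact: cardsD1.
  by rewrite in_set GX -rG eqSS [X in (_ + nat_of_bool X)%N]eq_sym addnC.
rewrite -h3; move: h1 h2; clear; lia.
Qed.

Lemma beyond_facets P : indep G ->
  (forall A, A \in fcs X -> (rk A).+1 = rk X -> P A || indep A) ->
  forall A, A \in fcs X' -> (rk A).+1 = rk X' -> P A || indep A.
Proof.
move=> iG h A AX rA; have [rX _ _ _ _] := bey.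
have nA : A != X' by apply: contra_eq_neq rA => ->; rewrite -[X in _ != X]addn0 -addn1 eqn_add2l.
have [vA|vA] := boolP (v \in A); first by rewrite (beyond_indep iG AX vA nA) orbT.
by have [AX0 _] := beyond_old AX vA; apply: h => //; rewrite rA.
Qed.

End Step.

Section PyramidStep.
Variables (B : {set V}) (v : V).
Hypothesis rvB : rk (v |: B) = (rk B).+1.
Let X' := v |: B.

Lemma apex_new : v \notin B.
Proof.
apply/negP => vB; move: rvB; rewrite (setUidPr _) ?sub1set // => /eqP.
by rewrite -[X in X == _]addn0 -addn1 eqn_add2l.
Qed.

Lemma apex_rk A : v \in A -> A \subset X' -> rk A = (rk (A :\ v)).+1.
Proof.
move=> vA sA; have : (rk B < rk X')%N by rewrite /X' rvB.
case/rk_sep => c [cB [i]]; rewrite in_setU1 => /orP[/eqP->|/cB->]; last by rewrite eqxx.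
move=> ci; rewrite -{1}(setD1K vA) (rk_setU1_strict _ ci) //.
by move=> j /setD1P[jv jA]; apply: cB; have := subsetP sA j jA; rewrite in_setU1 (negbTE jv).
Qed.

Lemma apex_face A : A \in fcs X' -> A :\ v \in fcs B.
Proof.
move=> AX; have -> : A :\ v = A :&: B.
  apply/setP => i; rewrite in_setD1 in_setI; case iA: (i \in A); rewrite ?andbF ?andbT //=.
  have := subsetP (fcs_sub AX) i iA; rewrite in_setU1.
  by case: eqP => [->|_ /= ->//]; rewrite (negbTE apex_new).
exact: fcs_restrict AX (subsetUr _ _).
Qed.

(** A face of the pyramid is a face of the base, or one joined with the apex. *)
Lemma apex_count k : (nfaces X' k.+1 <= nfaces B k.+1 + nfaces B k)%N.
Proof.
pose new := [set v |: f | f in [set f in fcs B | rk f == k]].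
have sub : [set A in fcs X' | rk A == k.+1] \subset [set A in fcs B | rk A == k.+1] :|: new.
  apply/subsetP => A; rewrite in_set => /andP[AX /eqP rA]; apply/setUP.
  have := apex_face AX; have [vA|vA] := boolP (v \in A) => fA; [right|left].
    apply/imsetP; exists (A :\ v); last by rewrite setD1K.
    by rewrite in_set fA /=; move: rA; rewrite (apex_rk vA (fcs_sub AX)) => -[->].
  rewrite in_set rA eqxx andbT; suff <- : A :\ v = A by [].
  by apply/setP => i; rewrite in_setD1; case: eqP => [->|//]; rewrite (negbTE vA).
have := leq_trans (subset_leq_card sub) (leq_card_setU _ _).
by move=> h; apply: leq_trans h _; rewrite leq_add2l leq_imset_card.
Qed.

Lemma apex_facets : (forall A, A \in fcs B -> (rk A).+1 = rk B -> indep A) ->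
  forall A, A \in fcs X' -> (rk A).+1 = rk X' -> (A == B) || indep A.
Proof.
move=> h A AX rA; have [vA|vA] := boolP (v \in A); apply/orP; [right|left].
  have rAv := apex_rk vA (fcs_sub AX).
  have : indep (A :\ v) by apply: h (apex_face AX) _; rewrite -rAv; move: rA; rewrite rvB => -[].
  by rewrite [indep A]indepE rAv (cardsD1 v A) vA add1n eqSS.
have eA : A :\ v = A.
  by apply/setP => i; rewrite in_setD1; case: eqP => [->|//]; rewrite (negbTE vA).
have := apex_face AX; rewrite eA => AB; apply/eqP.
by apply: (fcs_rk_inj AB (subxx _) (fcs_sub AB)); move: rA; rewrite rvB => -[->].
Qed.
End PyramidStep.

Lemma nfaces_top B : nfaces B (rk B) = 1%N.
Proof.
apply/eqP/cards1P; exists B; apply/setP => A; rewrite in_set in_set1.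
apply/andP/eqP => [[AB /eqP rA]|->]; last by rewrite fcs_full.
by apply: (fcs_rk_inj AB (subxx _) (fcs_sub AB)); rewrite rA.
Qed.

End Stacking.

(* p i is homogenised to (1, p i), and (c, b) to the functional b - <., c>. *)
Section Homogenization.
Variables (R : realType) (e : nat) (V : finType) (p : V -> 'rV[R]_e).
Implicit Types (X A G : {set V}).
Let g i := row_mx (1 : 'rV[R]_1) (p i).

Lemma ev_homog c b i : ev g (col_mx b%:M (- c)) i = b - dot (p i) c.
Proof. by rewrite /ev /dot mul_row_col mulmxN mul1mx !mxE eqxx mulr1n. Qed.

Lemma homog_split (d : 'cV[R]_(1 + e)) : exists c b, d = col_mx b%:M (- c).
Proof.
exists (- dsubmx d), (usubmx d 0 0); rewrite opprK -[LHS]vsubmxK; congr col_mx.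
by apply/matrixP => i j; rewrite !ord1 !mxE eqxx mulr1n.
Qed.

Lemma supportsP X A c b : supports p X A c b <->
  nonneg g (col_mx b%:M (- c)) X /\ A = zeros g (col_mx b%:M (- c)) X.
Proof.
have ez : [set i in X | dot (p i) c == b] = zeros g (col_mx b%:M (- c)) X.
  by apply/setP => i; rewrite !in_set ev_homog subr_eq0 [b == _]eq_sym.
split=> -[h1 h2]; split.
- by move=> i iX; rewrite ev_homog subr_ge0 h1.
- by rewrite h2 ez.
- by move=> i iX; have := h1 i iX; rewrite ev_homog subr_ge0.
- by rewrite h2 ez.
Qed.

Lemma faces_fcs X : faces p X = fcs g X.
Proof.
apply/setP => A; rewrite [LHS]in_set; apply/asboolP/fcsP => [[c [b /supportsP[h1 h2]]]|[d h1 h2]].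
  by exists (col_mx b%:M (- c)).
have [c [b ed]] := homog_split d; exists c, b; apply/supportsP; by rewrite -ed.
Qed.

Lemma fvec_nfaces i : fvec p i = nfaces g setT i.+1.
Proof. by rewrite /fvec faces_fcs. Qed.

Lemma facet_fcs X G : facet p X G = (G \in fcs g X) && ((rk g G).+1 == rk g X).
Proof. by rewrite /facet faces_fcs. Qed.

Lemma beyondP X G v : beyond p X G v -> beyond_facet g X G v.
Proof.
case=> rX; rewrite facet_fcs => /andP[GX /eqP rG] hG hH; split => //.
  move=> d d0 dG; have [c [b ed]] := homog_split d.
  rewrite ed ev_homog subr_lt0; apply: hG; apply/supportsP; by rewrite -ed.
move=> H d HX rH HG d0 dH; have [c [b ed]] := homog_split d.
rewrite ed ev_homog subr_gt0; apply: (hH H) => //; last by apply/supportsP; rewrite -ed.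
by rewrite facet_fcs HX rH eqxx.
Qed.

(** The tetrahedron has 4, 6 and 4 faces of dimensions 0, 1, 2; a stacking over a triangle adds 1, 3
    and 3 - 1. Independence of the facets is needed to know that [G] is a triangle. *)
Lemma stacked_counts B : stacked p 3 B ->
  [/\ rk g B = 4%N, forall A, A \in fcs g B -> (rk g A).+1 = rk g B -> indep g A,
      (nfaces g B 1 <= #|B|)%N, (nfaces g B 2 + 6 <= 3 * #|B|)%N &
      (nfaces g B 3 + 4 <= 2 * #|B|)%N].
Proof.
elim=> {B} [X cX sX|X G v _ [r4 hf n1 n2 n3] /beyondP bey].
  have iX : indep g X by exact: sX.
  have rX : rk g X = 4%N by rewrite (eqP iX) cX.
  have hC k : (nfaces g X k <= 'C(4, k))%N by rewrite -cX; exact: nfaces_indep.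
  rewrite cX; split => //.
  - by move=> A AX _; apply: indepS (fcs_sub AX) iX.
  - by have := hC 2%N; rewrite (_ : 'C(4, 2) = 6%N) // -(leq_add2r 6).
  - by have := hC 3%N; rewrite (_ : 'C(4, 3) = 4%N) // -(leq_add2r 4).
have [rX GX rG _ _] := bey; have vX := beyond_new bey.
have iG : indep g G by apply: hf.
have cG : #|G| = 3%N by rewrite -(eqP iG); move: rG; rewrite r4 => -[->].
rewrite cardsU1 vX rX r4.
have h k : (k.+1 < 4)%N -> (nfaces g (v |: X) k.+1 + (k.+2 == 4) <= nfaces g X k.+1 + 'C(3, k))%N.
  by move=> hk; have := beyond_count bey iG (k := k); rewrite r4 cG; apply.
have h0 := h 0%N isT; have h1 := h 1%N isT; have h2 := h 2%N isT.
rewrite (_ : 'C(3, 0) = 1%N) // in h0; rewrite (_ : 'C(3, 1) = 3%N) // in h1.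
rewrite (_ : 'C(3, 2) = 3%N) // in h2.
move: h0 h1 h2 n1 n2 n3 => /=.
move: (nfaces g (v |: X) 1) (nfaces g (v |: X) 2) (nfaces g (v |: X) 3).
move: (nfaces g X 1) (nfaces g X 2) (nfaces g X 3) #|X| => a b c x a' b' c' h0 h1 h2 n1 n2 n3.
split => //; try lia.
move=> A AX rA; have := beyond_facets (P := pred0) bey iG _ AX; rewrite rX r4.
by move=> /(_ _ rA); apply => A' h' r'; rewrite hf // r4.
Qed.

(** The pyramid meets the three bounds by [stacked_counts], and a stacking over a tetrahedron adds
    4, 6 and 4 - 1 faces of dimensions 1, 2, 3. For |B| = 4 + s and n points the bounds read 4n -
    10, 6n - 20 - s and 3n - 10 - s. *)
Lemma stacked_pyramid_counts B X : stacked p 3 B -> stacked_pyramid p B X ->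
  [/\ rk g X = 5%N, forall A, A \in fcs g X -> (rk g A).+1 = rk g X -> (A == B) || indep g A,
      (nfaces g X 2 + 10 <= 4 * #|X|)%N, (nfaces g X 3 + 16 + #|B| <= 6 * #|X|)%N &
      (nfaces g X 4 + 6 + #|B| <= 3 * #|X|)%N].
Proof.
move=> /stacked_counts[r4 hB n1 n2 n3]; elim=> {X} [v rv|X G v _ [r5 hf m2 m3 m4] GB /beyondP bey].
  have rv' : rk g (v |: B) = (rk g B).+1 := rv.
  have vB := apex_new rv'; rewrite cardsU1 vB rv' r4.
  have h1 := apex_count rv' 1; have h2 := apex_count rv' 2; have h3 := apex_count rv' 3.
  have t4 := nfaces_top g B; rewrite r4 in t4; rewrite t4 in h3.
  split => //; last 3 first.
  - by move: h1 n1 n2; clear; lia.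
  - by move: h2 n2 n3; clear; lia.
  - by move: h3 n3; clear; lia.
  move=> A AX rA; apply: (apex_facets rv' hB AX); by rewrite rA rv' r4.
have [rX GX rG _ _] := bey; have vX := beyond_new bey.
have iG : indep g G by have := hf G GX rG; rewrite (negbTE GB).
have cG : #|G| = 4%N by rewrite -(eqP iG); move: rG; rewrite r5 => -[->].
rewrite cardsU1 vX rX r5.
have h k : (k.+1 < 5)%N -> (nfaces g (v |: X) k.+1 + (k.+2 == 5) <= nfaces g X k.+1 + 'C(4, k))%N.
  by move=> hk; have := beyond_count bey iG (k := k); rewrite r5 cG; apply.
have h1 := h 1%N isT; have h2 := h 2%N isT; have h3 := h 3%N isT.
rewrite (_ : 'C(4, 1) = 4%N) // in h1; rewrite (_ : 'C(4, 2) = 6%N) // in h2.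
rewrite (_ : 'C(4, 3) = 4%N) // in h3.
split => //; last 3 first.
- by move: h1 m2; clear; lia.
- by move: h2 m3; clear; lia.
- by move: h3 m4; clear; lia.
move=> A AX rA; have := beyond_facets (P := pred1 B) bey iG _ AX; rewrite rX r5.
by move=> /(_ _ rA); apply => A' h' r'; apply: hf => //; rewrite r5.
Qed.

End Homogenization.

(** * The graph of the polytope *)

Section Poly.
Variables (R : realFieldType) (N : nat) (V : finType) (g : V -> 'rV[R]_N) (F : {set V}).
Implicit Types (X A B C G S U f : {set V}) (c d : 'cV[R]_N).
Local Notation rk := (rk g).
Local Notation ev := (ev g).
Local Notation fcs := (fcs g).
Local Notation upper := (upper g).
Local Notation verts := (verts g).
Local Notation simple_base := (simple_base g).
Local Notation indep := (indep g).
Hypothesis face0 : finset.set0 \in fcs setT.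
Hypothesis face1 : forall i, [set i] \in fcs setT.
Hypothesis rV : rk setT = 5%N.
Hypotheses (FV : F \in fcs setT) (rF : rk F = 4%N).
Hypothesis simplicial : forall G, G \in fcs setT -> rk G = 4%N -> G != F -> indep G.

Definition edges := [set f in fcs setT | #|f| == 2%N].
Local Notation E := edges.
Local Notation nb := (nb E).

Lemma edges2 f : f \in E -> #|f| = 2%N.
Proof. by rewrite inE => /andP[_ /eqP]. Qed.

Lemma edges_face f : f \in E -> f \in fcs setT.
Proof. by rewrite inE => /andP[]. Qed.

Lemma in_edges f : (f \in E) = (f \in fcs setT) && (#|f| == 2%N).
Proof. by rewrite inE. Qed.

(** A proper face of [F] lies in a ridge of [F], and the diamond property provides a second facet
    through that ridge. Hence every proper face other than [F] is a face of a simplex. *)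
Lemma face_facet A : A \in fcs setT -> A != setT -> A != F ->
  exists G, [/\ G \in fcs setT, rk G = 4%N, G != F & A \subset G].
Proof.
move=> AV AT AF; have [sAF|/subsetPn[x xA xF]] := boolP (A \subset F); last first.
  have [y _ yA] : exists2 y, y \in setT & y \notin A.
    by apply/subsetPn; rewrite subTset.
  have [G [GV sAG yG]] := facet_avoiding AV (in_setT y) yA; rewrite rV => -[rG].
  by exists G; split => //; apply: contraNneq xF => <-; apply: (subsetP sAG).
have [x xF xA] : exists2 x, x \in F & x \notin A.
  by apply/subsetPn; apply: contra AF => sFA; rewrite eqEsubset sAF.
have [H [HF sAH xH]] := facet_avoiding (fcs_sub_face AV (subsetT _) sAF) xF xA.
rewrite rF => -[rH]; have HV := fcs_trans FV HF.
have : #|upper setT H 1| = 2%N by apply: diamond; rewrite // rV -rH.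
rewrite (cardsD1 F) in_upper FV (fcs_sub HF) rF -rH /= add1n => -[/eqP/cards1P[G eG]].
have : G \in upper setT H 1 :\ F by rewrite eG set11.
rewrite in_setD1 in_upper -rH => /and4P[GF GV sHG /eqP rG].
by exists G; split => //; apply: subset_trans sHG.
Qed.

Lemma face_subface A B : A \in fcs setT -> A != setT -> A != F -> B \subset A ->
  B \in fcs setT /\ rk B = #|B|.
Proof.
move=> AV AT AF sBA; have [G [GV rG GF sAG]] := face_facet AV AT AF.
have iG := simplicial GV rG GF; have sBG := subset_trans sBA sAG.
split; first exact: fcs_trans GV (indep_face iG sBG).
by apply/eqP; apply: indepS iG.
Qed.

Lemma face_subface_rk A B : A \in fcs setT -> (rk A < 4)%N -> B \subset A ->
  B \in fcs setT /\ rk B = #|B|.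
Proof.
move=> AV rA; apply: face_subface => //.
  by apply: contraTneq rA => ->; rewrite rV.
by apply: contraTneq rA => ->; rewrite rF.
Qed.

Lemma face_subface_out A B u : A \in fcs setT -> A != setT -> u \in A -> u \notin F ->
  B \subset A -> B \in fcs setT /\ rk B = #|B|.
Proof. by move=> AV AT uA uF; apply: face_subface => //; apply: contraNneq uF => <-. Qed.

Lemma face_card A : A \in fcs setT -> (rk A < 4)%N -> rk A = #|A|.
Proof. by move=> AV rA; case: (face_subface_rk AV rA (subxx _)). Qed.

Lemma face_card_out A u : A \in fcs setT -> A != setT -> u \in A -> u \notin F ->
  rk A = #|A|.
Proof. by move=> AV AT uA uF; case: (face_subface_out AV AT uA uF (subxx _)). Qed.

Lemma rk_edge f : f \in E -> rk f = 2%N.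
Proof.
move=> fE; rewrite -(edges2 fE); apply: face_card; first exact: edges_face.
by apply: leq_ltn_trans (rk_card _ _) _; rewrite edges2.
Qed.

Lemma rk1 x : rk [set x] = 1%N.
Proof.
have nx : x \notin finset.set0 by rewrite in_set0.
by have := rk_fcs_setU1 face0 (in_setT x) nx; rewrite setU0 rk0.
Qed.

Lemma small_face_rk A : A \in fcs setT -> (#|A| < 4)%N -> rk A = #|A|.
Proof. by move=> AV cA; apply: face_card => //; apply: leq_ltn_trans (rk_card _ _) cA. Qed.

Lemma small_simple A : A \in fcs setT -> (rk A < 3)%N -> simple_base setT A.
Proof.
move=> AV rA B; rewrite in_upper addn1 => /and3P[BV sAB /eqP rB].
have cA := face_card AV (ltnW rA).
have rB4 : (rk B < 4)%N by rewrite rB.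
have cB := face_card BV rB4.
have : #|B :\: A| = 1%N.
  by have := cardsID A B; rewrite (setIidPr sAB) -cA -cB rB -addn1 => /addnI.
move/eqP/cards1P => [x ex]; have : x \in B :\: A by rewrite ex set11.
rewrite in_setD => /andP[xA xB]; exists x => //.
by rewrite -{1}(setID B A) (setIidPr sAB) ex setUC.
Qed.

Lemma verts0 : verts setT finset.set0 = setT.
Proof. by apply/setP => x; rewrite in_setT; apply/vertsP; rewrite in_setT in_set0 setU0 face1. Qed.

Lemma verts1 w : verts setT [set w] = nb w.
Proof.
apply/setP => x; rewrite nbE in_edges setUC; apply/vertsP/andP => [[_ xw xF]|[xF c2]].
  by rewrite xF cardsU1 xw cards1.
rewrite in_setT; split => //; apply/negP => xw; move: c2.
by rewrite (setUidPr _) ?cards1 // sub1set.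
Qed.

Lemma nb_face x y : (y \in nb x) = ([set x; y] \in fcs setT) && (x != y).
Proof. by rewrite nbE in_edges cards2; case: (x == y); rewrite ?andbF ?andbT. Qed.

Lemma face_nb C x y : C \in fcs setT -> C != setT -> C != F -> x \in C -> y \in C -> x != y ->
  y \in nb x.
Proof.
move=> CV CT CF xC yC xy; rewrite nb_face xy andbT.
have [|//] := face_subface (B := [set x; y]) CV CT CF.
by rewrite subUset !sub1set xC.
Qed.

(** The functional cutting out [F] is positive exactly off [F], and the simplex path for it stays
    where it is positive. *)
Lemma conn_out S : S \subset ~: F -> S != finset.set0 ->
  (forall x, x \in S -> nb x :\: F \subset S) -> S = ~: F.
Proof.
move=> sS S0 hS; have [c [cF c0 cp]] := fcs_pos FV.
have pos_out x : (0 < ev c x) = (x \notin F).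
  by have [xF|xF] := boolP (x \in F); [rewrite cF // ltxx|rewrite cp].
apply/eqP; rewrite eqEsubset sS; apply/subsetP => y; rewrite in_setC => yF.
have sb0 : simple_base setT finset.set0 by apply: small_simple; rewrite // rk0.
apply: (verts_connected face0 sb0 (c0 := c)) => //.
- by move=> i; rewrite in_set0.
- by rewrite verts0 subsetT.
- by move=> x /(subsetP sS); rewrite in_setC pos_out.
- move=> x z C xS Cu xC zC _; rewrite pos_out => zF.
  have [<-//|xz] := eqVneq x z.
  move: Cu; rewrite in_upper rk0 add0n => /and3P[CV _ /eqP rC].
  apply: (subsetP (hS x xS)); rewrite in_setD zF /=.
  apply: face_nb xC zC xz => //.
    by apply: contra_eq_neq rC => ->; rewrite rV.
  by apply: contra_eq_neq rC => ->; rewrite rF.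
- by rewrite verts0 in_setT.
- by rewrite pos_out.
Qed.

(** If all edges at [x] stayed in [F], the negative of the functional of [F] would be nonnegative
    along them, hence everywhere. *)
Lemma nb_out x : x \in F -> exists2 w, w \notin F & w \in nb x.
Proof.
move=> xF; apply: contrapT => h.
have [c [cF c0 cp]] := fcs_pos FV.
have [y _ yF] : exists2 y, y \in setT & y \notin F.
  by apply/subsetPn; apply/negP => /(rkS g); rewrite rV rF.
suff : nonneg g (- c) setT.
  by move=> /(_ y (in_setT y)); rewrite evN oppr_ge0 leNgt cp.
apply: (nonneg_next (face1 x)) => [i /set1P->|B BV pB rB i iB].
  by rewrite evN cF // oppr0.
have rB' : rk B = 2%N by rewrite rB rk1.
have xB : x \in B by rewrite (subsetP (proper_sub pB)) ?set11.
rewrite evN cF ?oppr0 //; apply: contraT => iF; case: h; exists i => //.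
apply: face_nb xB iB _ => //.
- by apply: contra_eq_neq rB' => ->; rewrite rV.
- by apply: contra_eq_neq rB' => ->; rewrite rF.
- by apply: contraNneq iF => <-.
Qed.

(** The edge lies in a facet other than [F], a tetrahedron, whose four vertices belong to both
    closed stars. *)
Lemma nb_common w w' : w \notin F -> w' \in nb w ->
  (4 <= #|(w |: nb w) :&: (w' |: nb w')|)%N.
Proof.
move=> wF ww'; have eE : [set w; w'] \in E by rewrite -nbE.
have [||G [GV rG GF sG]] := face_facet (edges_face eE).
- by apply: contra_eq_neq (rk_edge eE) => ->; rewrite rV.
- by apply: contra_eq_neq (rk_edge eE) => ->; rewrite rF.
have GT : G != setT by apply: contra_eq_neq rG => ->; rewrite rV.
move: sG; rewrite subUset !sub1set => /andP[wG w'G].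
have <- : #|G| = 4%N by rewrite -rG; apply/esym/eqP; apply: simplicial.
have cl x : x \in G -> G \subset x |: nb x.
  move=> xG; apply/subsetP => y yG; rewrite in_setU1.
  by have [//|yx] := eqVneq y x; apply: face_nb xG yG _ => //; rewrite eq_sym.
by apply: subset_leq_card; rewrite subsetI !cl.
Qed.

Definition link w := [set f in E | (f \subset nb w) && (w |: f \in fcs setT)].

Lemma link_upper w : w \notin F ->
  [set w |: f | f in link w] = upper setT [set w] 2.
Proof.
move=> wF; apply/setP => C; apply/imsetP/idP => [[f]|].
  rewrite in_set => /and3P[fE fn fw] ->; rewrite in_upper fw subsetUl rk1 /=.
  have wf : w \notin f by apply/negP => /(subsetP fn); rewrite (negbTE (nb_irr edges2 w)).
  by rewrite small_face_rk ?cardsU1 ?wf ?edges2.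
rewrite in_upper rk1 sub1set => /and3P[CV wC /eqP rC].
have CT : C != setT by apply: contra_eq_neq rC => ->; rewrite rV.
have CF : C != F by apply: contraNneq wF => <-.
have r4 : (rk C < 4)%N by rewrite rC.
have cC : #|C :\ w| = 2%N.
  by apply: succn_inj; rewrite -[3%N]rC (face_card CV r4) (cardsD1 w C) wC.
exists (C :\ w); last by rewrite setD1K.
rewrite in_set in_edges cC setD1K // CV !andbT.
have [-> _] /= := face_subface CV CT CF (subsetDl C [set w]).
apply/subsetP => y; rewrite in_setD1 => /andP[yw yC].
by apply: face_nb wC yC _; rewrite // eq_sym.
Qed.

Lemma link_inj w : {in link w &, injective (fun f => w |: f)}.
Proof.
move=> f f'; rewrite !in_set => /and3P[_ fn _] /and3P[_ fn' _] e.
have wn (x : {set V}) : x \subset nb w -> w \notin x.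
  by move=> xn; apply/negP => /(subsetP xn); rewrite (negbTE (nb_irr edges2 w)).
by rewrite -(setU1K (wn _ fn)) e setU1K ?wn.
Qed.

Lemma simple_edge w : forall v, v \in verts setT [set w] -> simple_base setT (v |: [set w]).
Proof.
move=> v; rewrite verts1 => vw; have eE : v |: [set w] \in E by rewrite setUC -nbE.
by apply: small_simple; rewrite ?rk_edge ?edges_face.
Qed.

Lemma simple_vertex w : simple_base setT [set w].
Proof. by apply: small_simple; rewrite ?rk1. Qed.

Lemma euler_vertex w :
  (#|nb w| + #|upper setT [set w] 3| = #|upper setT [set w] 2| + 2)%N.
Proof.
rewrite -(verts1 w); apply: euler; rewrite ?rk1 ?rV //.
  exact: simple_vertex.
exact: simple_edge.
Qed.

Lemma facet_nb w C : C \in upper setT [set w] 3 -> C != F -> C :&: nb w = C :\ w.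
Proof.
rewrite in_upper rk1 sub1set => /and3P[CV wC /eqP rC] CF.
have CT : C != setT by apply: contra_eq_neq rC => ->; rewrite rV.
apply/setP => y; rewrite in_setI in_setD1 andbC; case yC: (y \in C); rewrite ?andbF //= !andbT.
have [->|yw] := eqVneq y w; first exact/negbTE/nb_irr/edges2.
by apply: face_nb wC yC _; rewrite // eq_sym.
Qed.

Lemma facet_nb_card w C : C \in upper setT [set w] 3 -> C != F -> #|C :&: nb w| = 3%N.
Proof.
move=> Cu CF; rewrite facet_nb //; move: Cu.
rewrite in_upper rk1 sub1set => /and3P[CV wC /eqP rC].
have := cardsD1 w C; rewrite wC add1n.
by have /eqP <- := simplicial CV rC CF; rewrite rC => -[<-].
Qed.

Lemma link_card w : w \notin F -> (#|link w| + 6 = 3 * #|nb w|)%N.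
Proof.
move=> wF; rewrite -(card_in_imset (@link_inj w)) link_upper // -(verts1 w).
apply: edges_eq; rewrite ?rk1 ?rV //.
- exact: simple_vertex.
- exact: simple_edge.
- move=> C Cu; rewrite verts1 facet_nb_card //; move: Cu.
  rewrite in_upper sub1set => /and3P[_ wC _]; by apply: contraNneq wF => <-.
Qed.

Lemma link_edg w : w \notin F -> link w \subset edg E (nb w).
Proof. by move=> _; apply/subsetP => f; rewrite !in_set => /and3P[-> ->]. Qed.

(** In the configuration [A :|: U] each point of [U] is still a vertex over [A], so that [edges_le]
    applies to it. *)
Lemma sub_figure_le A U : A \in fcs setT -> A :&: U = finset.set0 ->
  (forall x, x \in U -> x |: A \in fcs setT) -> (rk (A :|: U) <= rk A + 4)%N ->
  (3 <= #|U|)%N -> (#|upper (A :|: U) A 2| + 6 <= 3 * #|U|)%N.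
Proof.
move=> AV AU hU rX U3; set X := A :|: U in rX *.
have AX : A \in fcs X := fcs_sub_face AV (subsetT _) (subsetUl _ _).
have eV : verts X A = U.
  apply/setP => x; apply/vertsP/idP => [[]|xU].
    by rewrite in_setU => /orP[->|].
  split; first by rewrite in_setU xU orbT.
    by apply/negP => xA; have := in_set0 x; rewrite -AU in_setI xA xU.
  apply: fcs_sub_face (hU x xU) (subsetT _) _.
  by rewrite subUset sub1set in_setU xU orbT subsetUl.
have full : X :\: A \subset verts X A by rewrite eV setDUl setDv set0U subsetDl.
have := edges_le AX (full_simple AX full) (full_simple2 AX full) rX.
by rewrite eV; apply.
Qed.

Lemma link_sub w B : w \notin F -> B \subset nb w -> (3 <= #|B|)%N ->
  (#|[set f in link w | f \subset B]| + 6 <= 3 * #|B|)%N.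
Proof.
move=> wF sB B3; have wB : w \notin B.
  by apply/negP => /(subsetP sB); rewrite (negbTE (nb_irr edges2 w)).
apply: leq_trans (sub_figure_le (face1 w) _ _ _ B3).
- rewrite leq_add2r -(card_in_imset (f := fun f => w |: f)); last first.
    move=> f f'; rewrite in_set [f' \in _]in_set => /andP[fl _] /andP[fl' _].
    exact: link_inj.
  apply/subset_leq_card/subsetP => C /imsetP[f]; rewrite in_set => /andP[fl fB] ->.
  have : w |: f \in upper setT [set w] 2 by rewrite -link_upper // imset_f.
  rewrite !in_upper => /and3P[fV -> ->]; rewrite !andbT.
  by apply: fcs_sub_face fV (subsetT _) _; rewrite setUS.
- by apply/setP => x; rewrite !inE; case: eqP => [->|//]; rewrite (negbTE wB).
- by move=> x /(subsetP sB); rewrite nb_face setUC => /andP[].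
- by rewrite rk1 -[X in (_ <= X)%N]rV rkS ?subsetT.
Qed.

Lemma F_edges_le U : U \subset F -> (3 <= #|U|)%N -> (#|edg E U| + 6 <= 3 * #|U|)%N.
Proof.
move=> sU U3; apply: leq_trans (sub_figure_le face0 _ _ _ U3).
- rewrite leq_add2r; apply/subset_leq_card/subsetP => f; rewrite in_set set0U => /andP[fE fU].
  rewrite in_upper sub0set rk_edge // rk0 andbT /=.
  by rewrite (fcs_sub_face (edges_face fE)) ?subsetT.
- exact: set0I.
- by move=> x _; rewrite setU0.
- by rewrite set0U rk0 -rF rkS.
Qed.

Lemma F_card4 : (4 <= #|F|)%N.
Proof. by rewrite -rF rk_card. Qed.

Lemma F_face C : C \in fcs F -> C != F -> rk C = #|C| /\ C \in fcs setT.
Proof.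
move=> CF nF; have CV := fcs_trans FV CF; split => //.
have CT : C != setT.
  apply: contraNneq nF => e; apply/eqP/esym.
  by apply/eqP; rewrite eqEsubset (fcs_sub CF) e subsetT.
by case: (face_subface CV CT nF (subxx _)).
Qed.

Lemma F_upper x k B : B \in upper F x k -> B != F -> B \in upper setT x k.
Proof.
by rewrite !in_upper => /and3P[BF -> ->] _; rewrite (fcs_trans FV BF).
Qed.

Lemma F_edges_eq : (#|edg E F| + 6 = 3 * #|F|)%N.
Proof.
have F0 : finset.set0 \in fcs F := fcs_sub_face face0 (subsetT _) (sub0set _).
have eV : verts F finset.set0 = F.
  apply/setP => x; apply/vertsP/idP => [[]//|xF]; split; rewrite ?in_set0 //.
  by rewrite setU0 (fcs_sub_face (face1 x)) ?subsetT ?sub1set.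
have full : F :\: finset.set0 \subset verts F finset.set0 by rewrite eV setD0.
have -> : edg E F = upper F finset.set0 2.
  apply/setP => f; rewrite in_set in_upper sub0set rk0 /=; apply/andP/andP => [[fE sf]|[fF /eqP rf]].
    by rewrite (fcs_sub_face (edges_face fE)) ?subsetT // rk_edge.
  have nF : f != F by apply: contra_eq_neq rf => ->; rewrite rF.
  have [cf fV] := F_face fF nF.
  by rewrite in_edges fV -cf rf (fcs_sub fF).
have := edges_eq F0 (full_simple F0 full) (full_simple2 F0 full); rewrite eV; apply.
  by rewrite rF rk0.
move=> C; rewrite in_upper rk0 => /and3P[CF _ /eqP rC].
have nF : C != F by apply: contra_eq_neq rC => ->; rewrite rF.
by rewrite (setIidPl (fcs_sub CF)); have [<- _] := F_face CF nF.
Qed.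

Lemma upper_edges : upper setT finset.set0 2 = E.
Proof.
apply/setP => f; rewrite in_upper sub0set rk0 in_edges /=.
case fV: (f \in fcs setT) => //=; apply/eqP/eqP => [rf|cf].
  by rewrite -face_card ?rf.
by rewrite small_face_rk ?cf.
Qed.

Lemma sum_upper_vertex k :
  (\sum_x #|upper setT [set x] k| = \sum_(B in upper setT finset.set0 k.+1) #|B|)%N.
Proof.
have := sum_card_point face0 k; rewrite verts0.
under eq_bigr do rewrite setU0; under [in RHS]eq_bigr do rewrite setIT.
by move=> <-; apply: eq_bigl => x; rewrite in_setT.
Qed.

Lemma sum_degree : (\sum_x #|nb x| = 2 * #|E|)%N.
Proof.
transitivity (\sum_x #|upper setT [set x] 1|)%N.
  apply: eq_bigr => x _; rewrite -(verts1 x).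
  have -> : upper setT [set x] 1 = [set B in upper setT [set x] 1 | B \subset setT].
    by apply/setP => B; rewrite in_set subsetT andbT.
  by rewrite -card_verts_upper ?setTI ?fcs_full //; apply: simple_vertex.
rewrite sum_upper_vertex upper_edges (eq_bigr (fun=> 2%N)) => [|f /edges2//].
by rewrite sum_nat_const mulnC.
Qed.

Lemma sum_triangles :
  (\sum_x #|upper setT [set x] 2| = 3 * #|upper setT finset.set0 3|)%N.
Proof.
rewrite sum_upper_vertex mulnC -sum_nat_const; apply: eq_bigr => B.
rewrite in_upper rk0 => /and3P[BV _ /eqP rB].
by rewrite -face_card // rB.
Qed.

Lemma sum_facets :
  (\sum_x #|upper setT [set x] 3| + 4 = 4 * #|upper setT finset.set0 4| + #|F|)%N.
Proof.
have Fu : F \in upper setT finset.set0 4 by rewrite in_upper FV sub0set rF rk0.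
rewrite sum_upper_vertex (big_setD1 F) //= (eq_bigr (fun=> 4%N)) => [|B].
  rewrite sum_nat_const (cardsD1 F (upper setT _ 4)) Fu; lia.
rewrite in_setD1 in_upper rk0 => /and4P[BF BV _ /eqP rB].
by have /eqP <- := simplicial BV rB BF.
Qed.

Lemma card_edg_deg S x : x \in S -> #|[set f in edg E S | x \in f]| = #|S :&: nb x|.
Proof.
move=> xS; have := card_edg_del edges2 xS.
rewrite -(cardsID (edg E (S :\ x)) (edg E S)) -edgI (setIidPr (subsetDl _ _)).
move/addnI => <-; apply: eq_card => f; rewrite in_set in_setD.
rewrite [f \in edg E (S :\ x)]in_set subsetD1.
rewrite [f \in edg E S]in_set; case: (f \in E) => //=.
by case: (f \subset S); rewrite ?andbF //= andbT negbK.
Qed.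

Lemma sum_degree_F : (\sum_(x in F) #|F :&: nb x| + 12 = 6 * #|F|)%N.
Proof.
have -> : (\sum_(x in F) #|F :&: nb x| = 2 * #|edg E F|)%N.
  rewrite -(degree_sum (X := F)) => [|f]; last first.
    by rewrite in_set => /andP[/edges2-> ->].
  by apply: eq_bigr => x xF; rewrite card_edg_deg.
by have := F_edges_eq; lia.
Qed.

(** In the figure at [x], the incidences of vertices and 2-faces are counted in two ways. Every
    facet through [x] contributes three, except [F], which contributes the degree of [x] within
    [F]. *)
Lemma vertex_flags x : (3 * #|upper setT [set x] 3| + (x \in F) * #|F :&: nb x| =
  2 * #|upper setT [set x] 2| + 3 * (x \in F))%N.
Proof.
have r5 : rk setT = (rk [set x] + 4)%N by rewrite rV rk1.
have := sum_facet_verts (face1 x) (@simple_vertex x) r5; rewrite verts1 => <-.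
have [xF|xF] := boolP (x \in F); last first.
  rewrite mul0n muln0 !addn0 mulnC -sum_nat_const; apply: eq_bigr => C Cu.
  rewrite facet_nb_card //; apply: contraNneq xF => <-.
  by move: Cu; rewrite in_upper sub1set => /and3P[].
have Fu : F \in upper setT [set x] 3 by rewrite in_upper FV sub1set xF rF rk1.
rewrite (big_setD1 F) //= (eq_bigr (fun=> 3%N)) => [|B]; last first.
  by rewrite in_setD1 => /andP[BF Bu]; rewrite facet_nb_card.
rewrite sum_nat_const (cardsD1 F (upper setT _ 3)) Fu; lia.
Qed.

(** Euler's relation and the flag count at a vertex, summed over all vertices, give two linear
    equations for f_2 and f_3. [F] enters through its number of vertices and the sum 6 |F| - 12 of
    its degrees. *)
Lemma face_numbers s : #|F| = (4 + s)%N ->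
  (#|upper setT finset.set0 3| + 2 * #|V| + s = 2 * #|E|)%N /\
  (#|upper setT finset.set0 4| + #|V| + s = #|E|)%N.
Proof.
move=> cF; have h1 := sum_degree; have h2 := sum_triangles; have h3 := sum_facets.
have h4 := sum_degree_F.
have h5 : (\sum_x (#|nb x| + #|upper setT [set x] 3|) =
    \sum_(x : V) (#|upper setT [set x] 2| + 2))%N.
  by apply: eq_bigr => x _; apply: euler_vertex.
have h6 : (3 * (\sum_x #|upper setT [set x] 3|) + \sum_x (x \in F) * #|F :&: nb x| =
    2 * (\sum_x #|upper setT [set x] 2|) + 3 * (\sum_x (x \in F)))%N.
  rewrite !big_distrr -!big_split /=.
  by apply: eq_bigr => x _; apply: vertex_flags.
have e1 : (\sum_x (x \in F) * #|F :&: nb x| = \sum_(x in F) #|F :&: nb x|)%N.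
  by rewrite [RHS]big_mkcond; apply: eq_bigr => x _; case: (x \in F); rewrite ?mul1n ?mul0n.
have e2 : (\sum_x (x \in F) = #|F|)%N.
  by rewrite -sum1_card [RHS]big_mkcond; apply: eq_bigr => x _; case: (x \in F).
have e3 : (\sum_(x : V) 2 = 2 * #|V|)%N by rewrite sum_nat_const mulnC.
rewrite !big_split /= in h5.
rewrite e1 e2 in h6; rewrite e3 in h5.
rewrite h1 h2 in h5; rewrite h2 in h6.
move: h3 h4 h5 h6; rewrite cF.
move: (\sum_x #|upper setT [set x] 3|)%N (\sum_(x in F) #|F :&: nb x|)%N.
move: #|upper _ _ 3| #|upper _ _ 4| #|E| #|V|; clear => a b c d x y *.
by split; lia.
Qed.

Definition boundary_F := fcs F :\ F.

Lemma boundary_F_face f : f \in boundary_F -> [/\ f \subset F, clique E f & (#|f| <= 3)%N].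
Proof.
rewrite in_setD1 => /andP[fF fV]; have [rf fT] := F_face fV fF.
have fne : f != setT.
  apply: contraNneq fF => e; move: (fcs_sub fV); rewrite e subTset => /eqP->.
  exact: eqxx.
split; first exact: fcs_sub fV.
  by apply/cliqueP => x y xf yf xy; apply: face_nb fT fne fF xf yf xy.
by rewrite -rf -ltnS -rF (rk_fcs_lt fV) // properEneq fF (fcs_sub fV).
Qed.

Lemma boundary_F0 : finset.set0 \in boundary_F.
Proof.
rewrite in_setD1 (fcs_sub_face face0) ?subsetT ?sub0set // andbT.
by apply/eqP => e; have := F_card4; rewrite -e cards0.
Qed.

Lemma boundary_F1 x : x \in F -> [set x] \in boundary_F.
Proof.
move=> xF; rewrite in_setD1 (fcs_sub_face (face1 x)) ?subsetT ?sub1set // andbT.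
by apply/eqP => e; have := F_card4; rewrite -e cards1.
Qed.

Lemma boundary_F2 f : f \in E -> f \subset F -> f \in boundary_F.
Proof.
move=> fE fF; rewrite in_setD1 (fcs_sub_face (edges_face fE)) ?subsetT // andbT.
by apply/eqP => e; have := F_card4; rewrite -e edges2.
Qed.

Lemma boundary_F_link x : x \in F -> cyc (lv E F [set x]) (lnk boundary_F [set x]).
Proof.
move=> xF; have xFc : [set x] \in fcs F.
  by rewrite (fcs_sub_face (face1 x)) ?subsetT ?sub1set.
have rx : rk F = (rk [set x] + 3)%N by rewrite rF rk1.
have sb : simple_base F [set x].
  move=> B Bu; apply: simple_vertex; apply: (F_upper Bu).
  by apply/eqP => e; move: Bu; rewrite e in_upper rF rk1 => /and3P[_ _ /eqP].
have hC C : C \in upper F [set x] 2 -> #|C :\: [set x]| = 2%N.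
  rewrite in_upper rk1 sub1set => /and3P[CF xC /eqP rC].
  have nF : C != F by apply: contra_eq_neq rC => ->; rewrite rF.
  have [cC _] := F_face CF nF; apply: succn_inj; rewrite -[3%N]rC cC.
  by rewrite (cardsD1 x C) xC.
have := cyc_figure xFc rx sb hC.
have -> : verts F [set x] = lv E F [set x].
  apply/setP => y; rewrite [RHS]in_set sub1set nbC nb_face.
  apply/vertsP/and3P => [[yF yx fy]|[yF fy yx]]; rewrite in_set1 in yx *.
    by rewrite eq_sym; split => //; rewrite setUC (fcs_trans FV fy).
  split => //; first by rewrite eq_sym.
  by rewrite setUC (fcs_sub_face fy) ?subsetT // subUset !sub1set xF yF.
suff -> : lnk boundary_F [set x] = [set f : {set V} |
  [&& #|f| == 2%N, [disjoint f & [set x]] & [set x] :|: f \in upper F [set x] 2]] by [].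
apply/setP => f; rewrite [LHS]in_set [RHS]in_set.
have [f2|] //= := boolP (#|f| == 2%N); have [df|] //= := boolP [disjoint f & [set x]].
have c3 : #|[set x] :|: f| = 3%N.
  rewrite cardsU1 (eqP f2); move: df; rewrite -setI_eq0 setIC => /eqP/setP/(_ x).
  by rewrite in_setI set11 in_set0 /= => ->.
rewrite in_upper subsetUl rk1 in_setD1; apply/andP/andP => [[fF fV]|[fV /eqP rf]].
  by rewrite fV; have [-> _] := F_face fV fF; rewrite c3.
by rewrite fV; split => //; apply: contra_eq_neq rf => ->; rewrite rF.
Qed.

(** Since links are induced, a common neighbour of [u] and [v] spans a triangular face with them; so
    the common neighbours are the vertices of the figure at the edge, which is a polygon. *)
Lemma edge_link (D : {set {set V}}) u v :
  (forall f, u \in f -> (f \in D) = (f \in fcs setT) && (f != setT)) ->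
  link u = edg E (nb u) -> u \notin F -> v \in nb u ->
  cyc (lv E setT [set u; v]) (lnk D [set u; v]).
Proof.
move=> hD ind uF vu; set A := [set u; v].
have eA : A \in E by rewrite -nbE.
have AV := edges_face eA; have rA := rk_edge eA.
have rx : rk setT = (rk A + 3)%N by rewrite rV rA.
have uA : u \in A by rewrite set21.
have hC C : C \in upper setT A 2 -> #|C :\: A| = 2%N.
  rewrite in_upper rA => /and3P[CV sAC /eqP rC].
  have CT : C != setT by apply: contra_eq_neq rC => ->; rewrite rV.
  have cC := face_card_out CV CT (subsetP sAC _ uA) uF.
  apply: (@addnI 2); rewrite -[X in (X + _)%N](edges2 eA) -{1}(setIidPr sAC) cardsID -cC rC //.
have := cyc_figure AV rx (small_simple AV _) hC; rewrite rA => /(_ isT).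
have -> : verts setT A = lv E setT A.
  apply/setP => y; rewrite [RHS]in_set in_setT subUset !sub1set (nbC _ y u) (nbC _ y v) /=.
  apply/vertsP/andP => [[_ yA fy]|[yu yv]].
    have fT : y |: A != setT.
      have := rk_fcs_setU1 AV (in_setT y) yA; rewrite rA => e.
      by apply: contra_eq_neq e => ->; rewrite rV.
    have fF : y |: A != F by apply: contraNneq uF => <-; rewrite setU1r.
    move: yA; rewrite in_set2 negb_or => /andP[yu yv].
    have [uC vC] : u \in y |: A /\ v \in y |: A by split; apply: setU1r; [exact: set21|exact: set22].
    by split; apply: (face_nb fy fT fF) (setU11 _ _) _ => //; rewrite eq_sym.
  split; rewrite ?in_setT //.
    by rewrite in_set2 negb_or eq_sym (nb_neq edges2 yu) eq_sym (nb_neq edges2 yv).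
  have : [set v; y] \in link u.
    by rewrite ind in_set -nbE yv subUset !sub1set vu yu.
  rewrite in_set => /and3P[_ _]; suff -> : y |: A = u |: [set v; y] by [].
  by rewrite setUC -setUA.
suff -> : lnk D A = [set f : {set V} |
  [&& #|f| == 2%N, [disjoint f & A] & A :|: f \in upper setT A 2]] by [].
apply/setP => f; rewrite [LHS]in_set [RHS]in_set.
have [f2|] //= := boolP (#|f| == 2%N); have [df|] //= := boolP [disjoint f & A].
have c4 : #|A :|: f| = 4%N.
  have dAf : A :&: f = finset.set0 by apply/eqP; rewrite setIC setI_eq0.
  by rewrite cardsU dAf cards0 subn0 (edges2 eA) (eqP f2).
have uf : u \in A :|: f by rewrite in_setU uA.
rewrite in_upper subsetUl rA hD //; apply/andP/andP => [[fV fT]|[fV /eqP rf]].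
  by rewrite fV (face_card_out fV fT uf uF) c4.
by rewrite fV; split => //; apply: contra_eq_neq rf => ->; rewrite rV.
Qed.

End Poly.

(** * Vertices of the polytope as faces of the homogenized configuration *)

Section Vertices.
Variables (R : realType) (e : nat) (V : finType) (p : V -> 'rV[R]_e).
Let g i := row_mx (1 : 'rV[R]_1) (p i).

(** The functional with constant value 1 on the homogenized points cuts out the empty face. *)
Lemma homog_face0 : finset.set0 \in fcs g [set: V].
Proof.
apply: (@fcs_intro _ _ _ _ _ _ (col_mx (1%:M : 'cV_1) (- (0 : 'cV_e)))).
- exact: sub0set.
- by move=> i; rewrite in_set0.
- by move=> i _ _; rewrite ev_homog /dot mulmx0 mxE subr0 ltr01.
Qed.

(** If no functional separated the point from the others, Farkas' lemma would write it as a
    nonnegative combination of them, and the homogenizing coordinate makes the weights add up to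
    1. *)
Lemma homog_vertex i : ~ hull p (~: [set i]) (p i) -> [set i] \in fcs g [set: V].
Proof.
move=> hi; have [x [hx xi]] : exists x : 'cV_(1 + e),
    (forall j, j \in ~: [set i] -> (g j *m x) 0 0 <= 0) /\ 0 < (g i *m x) 0 0.
  apply: contrapT => hn; apply: hi.
  have [x hx|w [w0 wE]] := farkas (A := ~: [set i]) (g := g) (b := g i).
    by rewrite leNgt; apply/negP => xi; apply: hn; exists x.
  exists w; split => //.
    have := congr1 (fun u => lsubmx u 0 0) wE; rewrite row_mxKl mxE eqxx => h.
    apply: esym; rewrite [LHS]h linear_sum summxE; apply: eq_bigr => j _.
    by rewrite linearZ /= row_mxKl !mxE eqxx mulr1.
  have := congr1 rsubmx wE; rewrite row_mxKr => ->.
  by rewrite linear_sum; apply: eq_bigr => j _; rewrite linearZ /= row_mxKr.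
have [c [b ex]] := homog_split x.
(* A constant functional minus [x], with the constant chosen so that [d] is zero at [i]; it is
   positive at the other points. *)
pose d := col_mx (ev g x i)%:M (- (0 : 'cV_e)) - x.
have evd j : ev g d j = ev g x i - ev g x j.
  by rewrite /d evD evN ev_homog /dot mulmx0 mxE subr0.
apply: (@fcs_intro _ _ _ _ _ _ d); first exact: subsetT.
  by move=> j /set1P->; rewrite evd subrr.
move=> j _ ji; rewrite evd subr_gt0; apply: le_lt_trans xi.
by apply: hx; rewrite in_setC.
Qed.

End Vertices.

(** * From the polytope to the combinatorial hypotheses *)

Section Assembly.
Variables (R : realType) (e s : nat) (V : finType) (p : V -> 'rV[R]_e) (F : {set V}).
Variable LF : {set {set {set V}}}.
Hypothesis hP : family_P 4 s p F.
Hypothesis hLF : prime_decomposition 3 (boundary p F) LF.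
Let g i := row_mx (1 : 'rV[R]_1) (p i).
Local Notation E := (edges g).
Local Notation fcs := (fcs g).

Let face0 : finset.set0 \in fcs setT. Proof. exact: homog_face0. Qed.
Let face1 i : [set i] \in fcs setT.
Proof. by case: hP => -[_ h] _ _ _; apply: homog_vertex. Qed.
Let rV : rk g setT = 5%N. Proof. by case: hP => -[]. Qed.
Let FV : F \in fcs setT.
Proof. by case: hP => _ + _ _; rewrite facet_fcs => /andP[]. Qed.
Let rF : rk g F = 4%N.
Proof. by case: hP => _ + _ _; rewrite facet_fcs => /andP[_]; rewrite -/g rV => /eqP[]. Qed.
Let simplicial G : G \in fcs setT -> rk g G = 4%N -> G != F -> indep g G.
Proof.
case: hP => _ _ _ h GV rG GF; apply: h GF; rewrite facet_fcs GV /=.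
by rewrite -/g rG rV.
Qed.
Let cF : #|F| = (4 + s)%N. Proof. by case: hP. Qed.

Lemma face_counts : (nfaces g setT 3 + 2 * #|V| + s = 2 * #|E|)%N /\
  (nfaces g setT 4 + #|V| + s = #|E|)%N.
Proof.
have e0 k : nfaces g setT k = #|upper g setT finset.set0 k|.
  by apply: eq_card => A; rewrite in_upper sub0set rk0 add0n in_set.
rewrite !e0; exact: (face_numbers face0 face1 rV FV rF simplicial cF).
Qed.

Lemma edges_count : nfaces g setT 2 = #|E|.
Proof.
rewrite -(upper_edges rV FV rF simplicial); apply: eq_card => A.
by rewrite in_upper sub0set rk0 add0n in_set.
Qed.

(** For [p], f_2 = 2 f_1 - 2n - s and f_3 = f_1 - n - s; so an upper bound on any one of the three
    numbers for [q] bounds the edges of [p]. *)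
Lemma edges_le_S (q : V -> 'rV[R]_4) i : (1 <= i <= 3)%N -> family_S 4 s q ->
  fvec p i = fvec q i -> (#|E| + 10 <= 4 * #|V|)%N.
Proof.
have [e2 e3] := face_counts; have e1 := edges_count.
move=> /andP[i1 i3] [B [sB cB pB]] hi.
have [_ _ q1 q2 q3] := stacked_pyramid_counts sB pB.
rewrite cB cardsT in q1 q2 q3; rewrite !fvec_nfaces -/g in hi.
case: i i1 i3 hi => [|[|[|[|i]]]] // _ _ hi.
- by rewrite -e1 hi.
- by rewrite hi in e2; move: e2 q2; clear; lia.
- by rewrite hi in e3; move: e3 q3; clear; lia.
Qed.

Let E2 : forall f, f \in E -> #|f| = 2%N. Proof. exact: edges2. Qed.
Let edgT : edg E setT = E.
Proof. by apply/setP => f; rewrite in_set subsetT andbT. Qed.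
Let nF : F != setT. Proof. by apply: contra_eq_neq rF => ->; rewrite rV. Qed.

Hypothesis few_edges : (#|E| + 10 <= 4 * #|V|)%N.

Let tight : (#|edg E setT| + 10 <= 4 * #|V|)%N. Proof. by rewrite edgT. Qed.

Let Fsub (U : {set V}) : U \subset F -> (3 <= #|U|)%N -> (#|edg E U| + 6 <= 3 * #|U|)%N.
Proof. exact: (F_edges_le face0 face1 rV FV rF simplicial). Qed.
Let lkE w : w \notin F -> link g w \subset edg E (nb E w). Proof. exact: link_edg. Qed.
Let lkC w : w \notin F -> (#|link g w| + 6 = 3 * #|nb E w|)%N.
Proof. exact: (link_card face0 face1 rV FV rF simplicial). Qed.
Let lkS w (B : {set V}) : w \notin F -> B \subset nb E w -> (3 <= #|B|)%N ->
  (#|[set f in link g w | f \subset B]| + 6 <= 3 * #|B|)%N.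
Proof. exact: (link_sub face0 face1 rV FV rF simplicial). Qed.
Let cnn (S : {set V}) : S \subset ~: F -> S != finset.set0 ->
  (forall x, x \in S -> nb E x :\: F \subset S) -> S = ~: F.
Proof. exact: (conn_out face0 face1 rV FV rF simplicial). Qed.
Let nbo x : x \in F -> exists2 w, w \notin F & w \in nb E x.
Proof. exact: (nb_out face0 face1 rV FV rF simplicial). Qed.
Let nb4 w w' : w \notin F -> w' \in nb E w ->
  (4 <= #|(w |: nb E w) :&: (w' |: nb E w')|)%N.
Proof. exact: (nb_common rV FV rF simplicial). Qed.

Let sparse4 (U : {set V}) : (4 <= #|U|)%N -> (#|edg E U| + 10 <= 4 * #|U|)%N.
Proof. exact: (sparse E2 lkE lkC lkS Fsub cnn nbo nb4). Qed.
Let ind w : w \notin F -> edg E (nb E w) = link g w.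
Proof. exact: (link_induced E2 lkE lkC lkS Fsub cnn nbo nb4). Qed.
Let stt w : w \notin F -> (#|edg E (cnb E w)| + 10 = 4 * #|cnb E w|)%N.
Proof. exact: (star_tight E2 lkE lkC lkS Fsub cnn nbo nb4). Qed.
Let V_tight : (#|edg E setT| + 10 = 4 * #|V|)%N.
Proof.
apply/eqP; rewrite eqn_leq tight.
exact: (lower_bound E2 lkE lkC lkS cnn nbo nb4 nF).
Qed.

Local Notation KF := (boundary_F g F).
Let eKF : boundary p F = KF. Proof. by rewrite /boundary faces_fcs. Qed.
Let hLF' : prime_decomposition 3 KF LF. Proof. by rewrite -eKF. Qed.
Let KFf (f : {set V}) : f \in KF -> [/\ f \subset F, clique E f & (#|f| <= 3)%N].
Proof. exact: (boundary_F_face rV FV rF simplicial). Qed.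
Let KF0 : finset.set0 \in KF. Proof. exact: boundary_F0. Qed.
Let KF1 x : x \in F -> [set x] \in KF. Proof. exact: (boundary_F1 face1 rF). Qed.
Let KF2 (f : {set V}) : f \in E -> f \subset F -> f \in KF. Proof. exact: (boundary_F2 rF). Qed.
Let KFl x : x \in F -> cyc (lv E F [set x]) (lnk KF [set x]).
Proof. exact: (boundary_F_link face0 face1 rV FV rF simplicial). Qed.
Let F4 : (4 <= #|F|)%N. Proof. exact: (F_card4 rF). Qed.
Let Ft : (#|edg E F| + 6 = 3 * #|F|)%N.
Proof. exact: (F_edges_eq face0 face1 rV FV rF simplicial). Qed.

Let D := refine_facet (boundary p setT) F LF.

Let leaf K : K \in LF -> node3 E F KF K /\ forall A, ~ missing_face 3 K A.
Proof. by move=> KL; apply: (leaves3 E2 Fsub KFf) hLF' KL. Qed.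

Lemma refineP (f : {set V}) : reflect ([/\ f \in fcs setT, f != setT & f != F] \/
  exists2 K, K \in LF & f \in vertex_set K |: K) (f \in D).
Proof.
rewrite /D /refine_facet /boundary faces_fcs in_setU in_setD1 in_setD1.
apply: (iffP orP) => -[].
- by case/and3P => h1 h2 h3; left.
- by case/bigcupP => K KL fK; right; exists K.
- by case=> h1 h2 h3; left; apply/and3P.
- by case=> K KL fK; right; apply/bigcupP; exists K.
Qed.

Lemma cell_sub K (f : {set V}) : K \in LF -> f \in vertex_set K |: K -> f \subset F.
Proof.
move=> KL; have [[_ sF _ _ _] _] := leaf KL.
by case/setU1P => [->//|/sub_vertex_set sK]; apply: subset_trans sF.
Qed.

Lemma refine_out (f : {set V}) u : u \in f -> u \notin F ->
  (f \in D) = (f \in fcs setT) && (f != setT).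
Proof.
move=> uf uF; apply/refineP/andP => [[[]//|[K KL fK]]|[h1 h2]].
  by case/negP: uF; apply: (subsetP (cell_sub KL fK)).
by left; split => //; apply: contraNneq uF => <-.
Qed.

Let V5 : (5 <= #|V|)%N.
Proof. by rewrite -rV -cardsT; apply: rk_card. Qed.

(** Inside [F] the clique is a face of some cell; otherwise the remaining pair at a vertex off [F]
    is an edge of its link, links being induced. *)
Let D_small (f : {set V}) : clique E f -> (#|f| <= 3)%N -> f \in D.
Proof.
move=> cf f3; have [fF|/subsetPn[u uf uF]] := boolP (f \subset F).
  have [K0 K0L fK0] := clique_in_leaf E2 Fsub KFf KF0 KF1 KF2 KFl F4 Ft hLF' fF cf f3.
  by apply/refineP; right; exists K0; rewrite // setU1r.
have fT : f != setT by apply: contraTneq f3 => ->; rewrite cardsT -ltnNge ltnW.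
rewrite (refine_out uf uF) fT andbT -(setD1K uf).
have fn : f :\ u \subset nb E u.
  apply/subsetP => y /setD1P[yu yf]; by apply: (cliqueP _ _ cf); rewrite // eq_sym.
have cfu : clique E (f :\ u) := cliqueS (subsetDl _ _) cf.
have ef : #|f| = (#|f :\ u|).+1 by rewrite (cardsD1 u f) uf.
have [|[|]] : #|f :\ u| = 0%N \/ #|f :\ u| = 1%N \/ #|f :\ u| = 2%N.
  by move: f3; rewrite ef; move: #|f :\ u|; clear; lia.
- by move/cards0_eq->; rewrite setU0.
- move=> /eqP/cards1P[y ey]; rewrite ey; apply: edges_face; rewrite -nbE.
  by apply: (subsetP fn); rewrite ey set11.
- move=> c2; have : f :\ u \in link g u.
    by rewrite -ind // in_set fn (clique_pair cfu).
  by rewrite in_set => /and3P[].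
Qed.

Let leafP K (f : {set V}) : K \in LF ->
  (f \in K) = [&& f \subset vertex_set K, clique E f & (#|f| <= 3)%N].
Proof. by move=> KL; have [n0 p0] := leaf KL; apply: (leaf3P KFf). Qed.

Let D_edge (f : {set V}) : f \in D -> #|f| = 2%N -> f \in E.
Proof.
move=> /refineP[[fV _ _]|[K KL /setU1P[->|fK]]] f2.
- by rewrite in_edges fV f2.
- by have [[_ _ h4 _ _] _] := leaf KL; rewrite f2 in h4.
- by move: fK; rewrite (leafP _ KL) => /and3P[_ cf _]; apply: clique_pair.
Qed.

Let D_out (f : {set V}) : f \in D -> ~~ (f \subset F) -> clique E f /\ (#|f| <= 4)%N.
Proof.
move=> fD /subsetPn[u uf uF]; move: fD; rewrite (refine_out uf uF) => /andP[fV fT].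
have fF : f != F by apply: contraNneq uF => <-.
split.
  apply/cliqueP => x y xf yf xy.
  exact: (face_nb rV FV rF simplicial fV fT fF xf yf xy).
rewrite -(face_card_out rV FV rF simplicial fV fT uf uF) -ltnS -rV.
by apply: (rk_fcs_lt fV) (subsetT _); rewrite properEneq fT subsetT.
Qed.

Let D_in (f : {set V}) : f \in D -> f \subset F ->
  f \in KF \/ exists2 K, K \in LF & f \in vertex_set K |: K.
Proof.
move=> /refineP[[fV fT fF] sF|]; last by right.
by left; rewrite in_setD1 fF (fcs_sub_face fV (subsetT _) sF).
Qed.

Let D_cell K : K \in LF -> vertex_set K \in D.
Proof. by move=> KL; apply/refineP; right; exists K; rewrite ?setU11. Qed.

Let D_lnk u v : u \notin F -> v \in nb E u ->
  cyc (lv E setT [set u; v]) (lnk D [set u; v]).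
Proof.
move=> uF vu; apply: (edge_link rV FV rF simplicial) => //.
  by move=> f uf; rewrite (refine_out uf).
by apply/esym/ind.
Qed.

Lemma prime_factors L K : prime_decomposition 4 D L -> K \in L ->
  ([/\ #|vertex_set K| = 5%N, K = simplex_boundary (vertex_set K) &
       (2 <= #|vertex_set K :\: F|)%N]) \/
  (exists2 K0, K0 \in LF & exists2 v, v \notin vertex_set K0 & K = pyramid_boundary v K0).
Proof.
move=> hL KL.
have [nK pK] := leaves4 E2 Fsub sparse4 V5 V_tight nF cnn stt D_small D_edge D_lnk hL KL.
exact: (leaf4_cases E2 Fsub KFf KF0 KF1 KF2 KFl F4 Ft hLF' sparse4 D_small D_out D_in D_cell nK pK).
Qed.

Lemma hull_sub_facet (G : {set V}) : (hull p G `<=` hull p F)%classic -> G \subset F.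
Proof.
move=> sGF; apply/subsetP => i iG.
have [c [cF' c0 cp]] := fcs_pos FV.
have : hull p G (p i).
  exists (fun j => (j == i)%:R); split.
  - by move=> j; case: (j == i); rewrite ?ler01.
  - by rewrite (bigD1 i) //= eqxx big1 ?addr0 // => j /andP[_ /negbTE->].
  - rewrite (bigD1 i) //= eqxx scale1r big1 ?addr0 // => j /andP[_ /negbTE->].
    by rewrite scale0r.
case/sGF => w [w0 w1 wi].
have gi : g i = \sum_(j in F) w j *: g j.
  apply/eqP; rewrite -[X in _ == X]hsubmxK; apply/eqP; rewrite /g; congr row_mx.
    rewrite linear_sum /=; apply/matrixP => a b; rewrite !ord1 summxE mxE eqxx -[LHS]w1.
    by apply: eq_bigr => j _; rewrite linearZ /= row_mxKl !mxE eqxx mulr1.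
  by rewrite linear_sum wi; apply: eq_bigr => j _; rewrite linearZ /= row_mxKr.
have evi : ev g c i = 0.
  rewrite /ev gi mulmx_suml summxE big1 // => j jF.
  by rewrite -scalemxAl mxE -/(ev g c j) cF' // mulr0.
by apply: contraT => iF; have := cp i (in_setT _) iF; rewrite evi ltxx.
Qed.

(** Four of the five vertices omit only one, so they cannot avoid both of those off [F]. *)
Lemma hull_far (W G : {set V}) : #|W| = 5%N -> (2 <= #|W :\: F|)%N ->
  G \subset W -> #|G| = 4%N -> ~ (hull p G `<=` hull p F)%classic.
Proof.
move=> W5 W2 sG G4 /hull_sub_facet sGF.
have : (#|W :\: F| <= #|W :\: G|)%N by rewrite subset_leq_card // setDS.
by rewrite leqNgt (leq_ltn_trans _ W2) // -ltnS cardsD (setIidPr sG) G4 W5.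
Qed.

End Assembly.

Theorem theorem3p4 (R : realType) (n s e : nat)
    (p : 'I_n -> 'rV[R]_e) (F : {set 'I_n})
    (hP : family_P 4 s p F)
    (LF : {set {set {set 'I_n}}})
    (hLF : prime_decomposition 3 (boundary p F) LF)
    (L : {set {set {set 'I_n}}})
    (hL : prime_decomposition 4 (refine_facet (boundary p [set: 'I_n]) F LF) L)
    (hf : exists i : nat, (1 <= i <= 3)%N /\
          exists q : 'I_n -> 'rV[R]_4, family_S 4 s q /\ fvec p i = fvec q i) :
  forall K, K \in L ->
    (exists B : {set 'I_n},
       [/\ #|B| = 5%N, K = simplex_boundary B &
           forall G : {set 'I_n}, G \subset B -> #|G| = 4%N ->
             ~ (hull p G `<=` hull p F)%classic])
    \/
    (exists2 K0, K0 \in LF &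
       exists2 v, v \notin vertex_set K0 & K = pyramid_boundary v K0).
Proof.
have [i [i13 [q [hS hi]]]] := hf; have few := edges_le_S hP i13 hS hi.
move=> K KL; have [[W5 eK W2]|] := prime_factors hP hLF few hL KL; last by right.
by left; exists (vertex_set K); split => // G; apply: (hull_far hP W5 W2).
Qed.
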